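(* Let $R \geq 2$ be an integer. (i) For every integer $k > 0$ the proportion of graphs $\mathcal{G} \in \mathbf{G}_{n,R}$ which have properties (1)--(4) below approaches $1$ as $n \to \infty$: (1) If $p \leq k$ then $\mathcal{G}$ has no subgraph $\mathcal{H}$ with exactly $p$ vertices and more than $p$ edges. It follows that whenever $p_1, p_2 \geq 3$ and $p_1 + p_2 + p_3 \leq k$, then $\mathcal{G}$ does not have a $p_1$-cycle and a different $p_2$-cycle such that there is a $p_3$-path from a vertex in the first cycle to a vertex in the second cycle. (2) If $p, q \leq k$ then there is no vertex $v$ with degree less than $R$ and $p$-path from $v$ to a vertex that belongs to a $q$-cycle. In particular, no $q$-cycle contains a vertex of degree less than $R$. (3) There do not exist distinct vertices $v_1, v_2, v_3$, all of which have degree at most $R-1$, such that for all distinct $i, j \in \{1,2,3\}$ there is a path of length at most $k$ from $v_i$ to $v_j$. (4) There do not exist distinct vertices $v$ and $w$ such that $\deg_{\mathcal{G}}(v) \leq R-1$, $\deg_{\mathcal{G}}(w) \leq R-2$ and there is a path of length at most $k$ from $v$ to $w$. (ii) Let $k \geq 3$ be an integer. There are positive $\lambda_3, \ldots, \lambda_k, \mu_1, \ldots, \mu_k \in \mathbb{Q}$ such that for all $r_3, \ldots, r_k, s_1, \ldots, s_k \in \mathbb{N}$ the proportion of $\mathcal{G} \in \mathbf{G}_{n,R}$ which, for $p = 3, \ldots, k$, have exactly $r_p$ $p$-cycles and, for $p = 1, \ldots, k$, have exactly $s_p$ $p$-paths with both endpoints of degree $R-1$, approaches $$\Bigg(\prod_{p=3}^k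 \frac{(\lambda_p)^{r_p} e^{-\lambda_p}}{r_p!}\Bigg)\Bigg(\prod_{p=1}^k \frac{(\mu_p)^{s_p} e^{-\mu_p}}{s_p!}\Bigg) \quad \text{as } n \to \infty.$$ Moreover, the mentioned proportion approaches this value independently of the number of vertices with degree $R-2$ (that is, for every fixed $j \in \mathbb{N}$, the same limit holds for the proportion taken among those $\mathcal{G} \in \mathbf{G}_{n,R}$ with exactly $j$ vertices of degree $R-2$). (iii) If $R \geq 3$ then for every $k \in \mathbb{N}$ the proportion of $\mathcal{G} \in \mathbf{G}_{n,R}$ such that $\mathcal{G}$ has a connected component with at most $k$ vertices approaches $0$ as $n \to \infty$.
   Context: A graph is a finite undirected graph without loops or multiple edges. For positive integers $n$ and $R$, $\mathbf{G}_{n,R}$ denotes the set of graphs with vertex set $\{1,\ldots,n\}$ in which the degree of every vertex is at most $R$. The proportion of $\mathcal{G} \in \mathbf{G}_{n,R}$ with a property $P$ is $|\{\mathcal{G} \in \mathbf{G}_{n,R} : \mathcal{G} \text{ has } P\}| / |\mathbf{G}_{n,R}|$. $\deg_{\mathcal{G}}(v)$ is the degree of $v$ in $\mathcal{G}$. A $p$-path ($p \geq 1$) is a path with $p$ edges (its length is $p$) and pairwise distinct vertices; a $p$-cycle ($p \geq 3$) is a cycle with $p$ edges. Subgraphs need not be induced. When paths and cycles are counted, they are counted as subgraphs (so a path and its reversal are the same path, and the starting point and direction of a cycle are irrelevant). $\mathbb{N}$ is the set of non-negative integers. *)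

(* Defs.v *)
From HB Require Import structures.
From mathcomp Require Import all_boot all_order all_algebra.
From mathcomp Require Import boolp reals.

Set Implicit Arguments.
Unset Strict Implicit.
Unset Printing Implicit Defensive.

Import GRing.Theory.

(* The vertex set {1, ..., n} is represented by 'I_n; an edge is a set of
   exactly two vertices, so there are no loops and no multiple edges. *)
Record graph (n : nat) := Graph {
  edges :> {set {set 'I_n}};
  edgesP : [forall e in edges, #|e| == 2]
}.

HB.instance Definition _ n := [isSub for @edges n].
HB.instance Definition _ n := [Finite of graph n by <:].

Definition adj n (G : graph n) : rel 'I_n :=
  fun x y => [set x; y] \in edges G.

Definition deg n (G : graph n) (v : 'I_n) : nat := #|[set w | adj G v w]|.

Definition bounded_graphs (n R : nat) : {set graph n} :=
  [set G | [forall v, deg G v <= R]].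

(* The proportion of the members of A satisfying P; it is 0 if A is empty. *)
Definition proportion (K : realType) (T : finType) (A : {set T})
    (P : T -> Prop) : K :=
  (#|[set x in A | `[< P x >]]|%:R / #|A|%:R)%R.

Section Subgraphs.
Variables (n : nat) (G : graph n).

Definition has_subgraph (U : {set 'I_n}) (F : {set {set 'I_n}}) : bool :=
  (F \subset edges G) && [forall e in F, e \subset U].

Definition is_path (p : nat) (v : 'I_n) (s : seq 'I_n) : bool :=
  [&& 0 < p, size s == p, path (adj G) v s & uniq (v :: s)].

Definition is_cycle (p : nat) (c : seq 'I_n) : bool :=
  [&& 2 < p, size c == p, cycle (adj G) c & uniq c].

Definition path_edges (v : 'I_n) (s : seq 'I_n) : {set {set 'I_n}} :=
  [set:: pairmap (fun x y => [set x; y]) v s].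

Definition cycle_edges (c : seq 'I_n) : {set {set 'I_n}} :=
  if c is x :: s then path_edges x (rcons s x) else set0.

(* Subgraphs that are p-paths (p >= 1) or p-cycles (p >= 3) have no isolated
   vertices, so they are identified with their edge sets; this makes the
   starting point and the direction irrelevant.  The vertex set of such a
   subgraph C is cover C. *)
Definition cycles (p : nat) : {set {set {set 'I_n}}} :=
  [set cycle_edges c | c : p.-tuple 'I_n & is_cycle p c].

Definition paths_with_end_degree (d p : nat) : {set {set {set 'I_n}}} :=
  [set path_edges u.1 u.2 | u : 'I_n * p.-tuple 'I_n &
     [&& is_path p u.1 u.2, deg G u.1 == d & deg G (last u.1 u.2) == d]].

Definition path_from_to (p : nat) (v w : 'I_n) : Prop :=
  exists2 s, is_path p v s & last v s = w.

Definition path_at_most (k : nat) (v w : 'I_n) : Prop :=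
  exists2 p, p <= k & path_from_to p v w.

Definition component (v : 'I_n) : {set 'I_n} :=
  [set w | connect (adj G) v w].

Definition no_dense_subgraph (k : nat) : Prop :=
  forall p, p <= k ->
    ~ exists U F, [/\ has_subgraph U F, #|U| = p & p < #|F|].

Definition no_close_cycles (k : nat) : Prop :=
  forall p1 p2 p3, 3 <= p1 -> 3 <= p2 -> p1 + p2 + p3 <= k ->
    ~ exists C D, [/\ C \in cycles p1, D \in cycles p2, C <> D &
        exists v w, [/\ v \in cover C, w \in cover D & path_from_to p3 v w]].

Definition no_deficient_near_cycle (R k : nat) : Prop :=
  forall p q, p <= k -> q <= k ->
    ~ exists v w C, [/\ deg G v < R, path_from_to p v w,
        C \in cycles q & w \in cover C].

Definition no_deficient_on_cycle (R k : nat) : Prop :=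
  forall q, q <= k ->
    ~ exists v C, [/\ deg G v < R, C \in cycles q & v \in cover C].

Definition no_close_deficient_triple (R k : nat) : Prop :=
  ~ exists v : 'I_3 -> 'I_n,
      [/\ injective v, forall i, deg G (v i) <= R - 1 &
          forall i j, i <> j -> path_at_most k (v i) (v j)].

Definition no_close_deficient_pair (R k : nat) : Prop :=
  ~ exists v w, [/\ v <> w, deg G v <= R - 1, deg G w <= R - 2 &
      path_at_most k v w].

Definition has_counts (R k : nat) (r s : nat -> nat) : Prop :=
  (forall p, 3 <= p <= k -> #|cycles p| = r p) /\
  (forall p, 1 <= p <= k -> #|paths_with_end_degree (R - 1) p| = s p).

Definition has_small_component (k : nat) : Prop :=
  exists v, #|component v| <= k.

End Subgraphs.

Definition bounded_graphs_with (n R j : nat) : {set graph n} :=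
  [set G in bounded_graphs n R | #|[set v | deg G v == R - 2]| == j].

(* Main.v *)
Require Import Defs.
From mathcomp Require Import all_boot all_order all_algebra.
From mathcomp Require Import perm zify ring lra.

(* Attach R slots to every vertex and choose uniformly a matching of the nR
   slots, i.e. a partition into blocks of size 1 and 2.  If no block of size 2
   lies at a single vertex and no two of them join the same vertices, then the
   matching projects to a graph G of maximal degree at most R, and it arises
   together with prod_v R!/(R - deg v)! matchings from the same G.  So uniform
   graphs are matchings weighted by w = prod_v (R - deg v)!, and w has a bounded
   second moment, whence unlikely events of matchings are unlikely for graphs.

   With I(N) matchings of N points, I(N - s)/I(N) is of order N^(-s/2), so a set
   of v vertices in whose blocks (among these vertices) more than 2v slots take
   part is found with probability O(n^(-1/2)) only.  Without such sets ("sparse"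
   graphs) 2 e(W) + sum_(v in W) (R - deg v) <= 2 |W| for all small W, which
   yields (i) and (iii) by counting edges.

   Short cycles, and paths both of whose ends have a free slot, are connected
   and use exactly two slots at each of their vertices.  Loops, double edges and
   vertices with two free slots are the degenerate cases.  Two such structures
   that overlap use too many slots.  Hence conditioning on the presence of one
   of them has the only effect of raising its count by one, up to the removal of
   a few slots, which hardly changes any probability (move the partner of a slot
   elsewhere).  This gives x_t P(X = x) = lambda_t P(X = x - e_t) + O(n^(-1/2))
   for the vector X of all counts, and so a Poisson limit for X.  Graphs with
   exactly j vertices of degree R - 2 all have w = 2^j with high probability, so
   conditioning on j leaves the other counts unaffected. *)


Set Implicit Arguments.
Unset Strict Implicit.
Unset Printing Implicit Defensive.

Import Order.TTheory GRing.Theory Num.Theory.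

(** * Matchings of a finite set *)

(** The degrees of a uniform graph are not fixed in advance, which is why slots may stay free: the
    number of completions of a partial matching then depends only on the number of remaining points.
    The price is an unbounded weight. Rare events are transferred by cutting at a level L: either w
    <= L, or w <= w^2/L, and the second moment absorbs the latter part. All estimates rest on one
    balance: v vertices can be chosen in at most n^v ways and each prescribed slot costs n^(-1/2),
    so two slots per vertex give a bounded mean, one slot more gives a vanishing one, and fixing one
    vertex in advance also gives a vanishing one. The recursion determines P(X = x) only up to the
    common factor P(X = 0). Bounded means make X tight, and total mass one then identifies this
    factor. Since the tilt 2^j varies with j, the unconditioned part of (ii) is not the limit of a
    single event. It is a mixture over j of limits that agree, which needs a bound on the mass of
    large j that is uniform in n, and a lower bound for the total mass; the latter comes from j =
    0. *)

Fixpoint involutions (m : nat) : nat :=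
  match m with
  | 0 => 1
  | m1.+1 => match m1 with
             | 0 => 1
             | m2.+1 => involutions m1 + m1 * involutions m2
             end
  end.

Lemma involutionsSS m :
  involutions m.+2 = involutions m.+1 + m.+1 * involutions m.
Proof. by []. Qed.

Lemma involutions_gt0 m : 0 < involutions m.
Proof.
suff : 0 < involutions m /\ 0 < involutions m.+1 by case.
elim: m => // m [h1 h2]; split=> //.
by rewrite involutionsSS addn_gt0 h2.
Qed.

Lemma involutions_rec m :
  0 < m -> involutions m = involutions (m - 1) + (m - 1) * involutions (m - 2).
Proof. by case: m => [|[|m]] // _; rewrite involutionsSS !subSS !subn0. Qed.

Lemma setUDK (T : finType) (A B : {set T}) : A \subset B -> A :|: (B :\: A) = B.
Proof. by move=> /setIidPr sAB; rewrite -{1}sAB setID. Qed.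

Section Matchings.
Variable P : finType.
Implicit Types (T U : {set P}) (A B M : {set {set P}}) (b c : {set P}).

Definition matchings T : {set {set {set P}}} :=
  [set M : {set {set P}} | partition M T & [forall b in M, #|b| <= 2]].

Lemma matchingsP M T :
  reflect [/\ cover M = T, trivIset M & forall b, b \in M -> 0 < #|b| <= 2]
          (M \in matchings T).
Proof.
rewrite inE; apply: (iffP andP).
  move=> [/and3P[/eqP cM tM M0] /forall_inP h]; split=> // b bM.
  rewrite h // andbT card_gt0; apply: contraNneq M0 => <-; exact: bM.
move=> [cM tM h]; split; last by apply/forall_inP => b /h /andP[].
apply/and3P; split; [exact/eqP|exact: tM|].
by apply/negP => /h; rewrite cards0.
Qed.

Lemma trivIset_eq M b c x :
  trivIset M -> b \in M -> c \in M -> x \in b -> x \in c -> b = c.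
Proof.
move=> tM bM cM xb xc.
by rewrite -(def_pblock tM bM xb) -(def_pblock tM cM xc).
Qed.

Lemma sub_cover A B : A \subset B -> cover A \subset cover B.
Proof. by move=> sAB; apply/bigcupsP => b bA; exact/bigcup_sup/(subsetP sAB). Qed.

Lemma mem_cover A b x : b \in A -> x \in b -> x \in cover A.
Proof. by move=> bA xb; apply/bigcupP; exists b. Qed.

Lemma coverU A B : cover (A :|: B) = cover A :|: cover B.
Proof. by rewrite /cover bigcup_setU. Qed.

Lemma matching_cover M T A :
  M \in matchings T -> A \subset M -> A \in matchings (cover A).
Proof.
move=> /matchingsP[cM tM h] sA; apply/matchingsP; split=> //.
  exact: trivIsetS sA tM.
by move=> b /(subsetP sA) /h.
Qed.

Lemma matching_sub_cover M T A :
  M \in matchings T -> A \subset M -> cover A \subset T.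
Proof. by case/matchingsP=> <- _ _; exact: sub_cover. Qed.

Lemma matchingU A U M T : A \in matchings U -> M \in matchings T ->
  [disjoint U & T] -> A :|: M \in matchings (U :|: T).
Proof.
move=> /matchingsP[cA tA hA] /matchingsP[cM tM hM] dUT; apply/matchingsP.
split; first by rewrite coverU cA cM.
  by apply: trivIsetU => //; rewrite cA cM.
by move=> b /setUP[/hA|/hM].
Qed.

Lemma matchings_disjoint A U M T : A \in matchings U -> M \in matchings T ->
  [disjoint U & T] -> [disjoint A & M].
Proof.
move=> /matchingsP[cA tA hA] /matchingsP[cM tM hM] dUT.
rewrite disjoints_subset; apply/subsetP => b bA; rewrite inE; apply/negP => bM.
have /andP[+ _] := hA _ bA; rewrite card_gt0 => /set0Pn[x xb].
move/disjoint_setI0/setP/(_ x): dUT; rewrite !inE -cA -cM.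
by rewrite (mem_cover bA xb) (mem_cover bM xb).
Qed.

Lemma coverD M A : trivIset M -> A \subset M -> cover (M :\: A) = cover M :\: cover A.
Proof.
move=> tM sA; apply/setP => x; rewrite !inE; apply/bigcupP/andP.
  move=> [b /setDP[bM bA] xb]; split; last exact: mem_cover xb.
  apply/bigcupP => -[c cA xc]; case/negP: bA.
  by rewrite (trivIset_eq tM bM (subsetP sA _ cA) xb xc).
move=> [xA /bigcupP[b bM xb]]; exists b => //; rewrite inE bM andbT.
by apply: contra xA => bA; exact: mem_cover xb.
Qed.

Lemma matchingD M T A :
  M \in matchings T -> A \subset M -> M :\: A \in matchings (T :\: cover A).
Proof.
move=> /matchingsP[cM tM h] sA; apply/matchingsP; split.
- by rewrite coverD // cM.
- exact: trivIsetD.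
- by move=> b /setDP[/h].
Qed.

(** Deleting the blocks of A is a bijection onto the matchings of the remaining points, with inverse
    [A :|: M]. The predicate is carried along because later events are evaluated after the
    deletion. *)
Lemma card_matchings_sup A U T (Q : pred {set {set P}}) :
  A \in matchings U -> U \subset T ->
  #|[set M in matchings T | (A \subset M) && Q M]| =
  #|[set M in matchings (T :\: U) | Q (A :|: M)]|.
Proof.
move=> mA sUT; have cA : cover A = U by case/matchingsP: mA.
have dis M : M \in matchings (T :\: U) -> [disjoint A & M].
  move=> mM; apply: matchings_disjoint mA mM _.
  by rewrite disjoint_sym disjoints_subset setDE subsetIr.
rewrite -(card_in_imset (f := fun M => A :|: M)
            (D := [set M in matchings (T :\: U) | Q (A :|: M)])).
  apply: eq_card => M; rewrite inE; apply/and3P/imsetP.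
    move=> [mM sA QM]; exists (M :\: A); last by rewrite setUDK.
    by rewrite inE -{1}cA matchingD //= setUDK.
  move=> [M']; rewrite inE => /andP[mM' QM'] ->; split; rewrite ?subsetUl //.
  rewrite -[T](setUDK sUT); apply: matchingU => //.
  by rewrite disjoint_sym disjoints_subset setDE subsetIr.
move=> M1 M2 /setIdP[m1 _] /setIdP[m2 _] e.
have r M : M \in matchings (T :\: U) -> M = (A :|: M) :\: A.
  move=> mM; rewrite setDUl setDv set0U; apply/esym/setDidPl.
  by rewrite disjoint_sym; exact: dis.
by rewrite (r M1) // (r M2) // e.
Qed.

Lemma matching_block T M a : M \in matchings T -> a \in T ->
  exists2 d, d \in T & [set a; d] \in M.
Proof.
move=> /matchingsP[cM tM h] aT; have : a \in cover M by rewrite cM.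
case/bigcupP=> b bM ab.
have /andP[_] := h _ bM; rewrite leq_eqVlt ltnS => /orP[|b1]; last first.
  exists a => //; rewrite setUid.
  suff -> : [set a] = b by [].
  by apply/eqP; rewrite eqEcard sub1set ab cards1.
move=> /cards2P[x [y [xy eb]]]; rewrite eb !inE in ab.
have sb : b \subset T by rewrite -cM; exact: bigcup_sup.
case/orP: ab => /eqP ->; [exists y|exists x]; rewrite -?eb //.
- by rewrite (subsetP sb) // eb !inE eqxx orbT.
- by rewrite (subsetP sb) // eb !inE eqxx.
- by rewrite setUC -eb.
Qed.

Lemma pair_inj (a d e : P) : [set a; d] = [set a; e] -> d = e.
Proof.
move=> h; have := set22 a d; rewrite h !inE => /orP[/eqP da|/eqP //].
by have := set22 a e; rewrite -h da !inE orbb => /eqP.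
Qed.

Lemma card_matchings_split a T (Q : pred {set {set P}}) : a \in T ->
  #|[set M in matchings T | Q M]| =
  \sum_(d in T) #|[set M in matchings T | ([set a; d] \in M) && Q M]|.
Proof.
move=> aT; under eq_bigr do rewrite -sum1dep_card.
rewrite (exchange_big_dep [in [set M in matchings T | Q M]]) /=; last first.
  by move=> d M dT /and3P[mM _ QM]; rewrite in_set mM.
rewrite -sum1_card; apply: eq_bigr => M /setIdP[mM QM].
have [d dT adM] := matching_block mM aT.
rewrite (bigD1 d) /=; last by rewrite dT mM adM.
rewrite big1 // => e /andP[/andP[eT /and3P[_ aeM _]] /negP []].
have [_ tM _] := matchingsP _ _ mM.
by apply/eqP/(@pair_inj a)/(trivIset_eq tM aeM adM (x := a)); rewrite !inE eqxx.
Qed.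

Lemma matching_pair a d : [set [set a; d]] \in matchings [set a; d].
Proof.
apply/matchingsP; split; rewrite ?cover1 ?trivIset1 //.
by move=> b /set1P ->; rewrite cards2; case: (a != d).
Qed.

Lemma card_matchings T : #|matchings T| = involutions #|T|.
Proof.
have [m] := ubnP #|T|; elim: m T => // m IH T; rewrite ltnS => hT.
have [->|/set0Pn[a aT]] := eqVneq T set0.
  rewrite cards0 /= -(cards1 (set0 : {set {set P}})); apply: eq_card => M.
  rewrite !inE partition_set0; case: eqP => //= ->.
  by apply/forall_inP => b; rewrite inE.
have key d : d \in T ->
    #|[set M in matchings T | ([set a; d] \in M) && true]| =
    involutions #|T :\: [set a; d]|.
  move=> dT; rewrite -IH; last first.
    apply: leq_trans hT; apply: proper_card; rewrite properEneq subsetDl andbT.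
    by apply: contraTneq aT => <-; rewrite !inE eqxx.
  have sT : [set a; d] \subset T by apply/subsetP => x; rewrite !inE => /orP[]/eqP ->.
  have := card_matchings_sup xpredT (matching_pair a d) sT.
  under eq_finset do rewrite sub1set.
  move=> ->; apply: eq_card => M; rewrite !inE; exact: andbT.
have -> : #|matchings T| = #|[set M in matchings T | xpredT M]|.
  by apply: eq_card => M; rewrite !inE andbT.
(* The term d = a is the case of a singleton block and leaves one point fewer; each other d leaves
   two points fewer. *)
rewrite (card_matchings_split _ aT) (bigD1 a) //= key // setUid.
rewrite (eq_bigr (fun _ => involutions (#|T| - 2))); last first.
  move=> d /andP[dT da]; rewrite key // cardsD (setIidPr _); last first.
    by apply/subsetP => x; rewrite !inE => /orP[]/eqP ->.
  by rewrite cards2 eq_sym da.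
rewrite (eq_bigl [in T :\ a]); last by move=> d; rewrite !inE andbC.
rewrite sum_nat_const (cardsD1 a T) aT add1n [in RHS]involutions_rec //.
by rewrite subn1.
Qed.

End Matchings.

Section Relabel.
Variables (P Q : finType) (f : P -> Q).
Hypothesis f_inj : injective f.
Implicit Types (A B : {set {set P}}).

Definition relabel A : {set {set Q}} := [set f @: (b : {set P}) | b in A].

Lemma mem_relabel A b : (f @: (b : {set P}) \in relabel A) = (b \in A).
Proof. by rewrite mem_imset //; exact: imset_inj. Qed.

Lemma cover_relabel A : cover (relabel A) = f @: cover A.
Proof. by rewrite cover_imset imset_cover. Qed.

Lemma relabel_inj : injective relabel.
Proof. by apply: imset_inj; exact: imset_inj. Qed.

Lemma relabelS A B : (relabel A \subset relabel B) = (A \subset B).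
Proof.
apply/idP/idP => [|sAB]; last exact: imsetS.
by move/subsetP => s; apply/subsetP => b; rewrite -!mem_relabel; exact: s.
Qed.

Lemma relabel_matching T M :
  M \in matchings T -> relabel M \in matchings (f @: T).
Proof.
move=> /matchingsP[cM tM h]; apply/matchingsP; split.
- by rewrite cover_relabel cM.
- by rewrite imset_trivIset.
- by move=> b /imsetP[c cM' ->]; rewrite card_imset //; exact: h.
Qed.

End Relabel.

Lemma relabel_comp (P Q S : finType) (f : Q -> S) (g : P -> Q) A :
  relabel f (relabel g A) = relabel (f \o g) A.
Proof.
by rewrite /relabel -imset_comp; apply: eq_imset => b /=; rewrite -imset_comp.
Qed.

Lemma eq_relabel (P Q : finType) (f g : P -> Q) A :
  f =1 g -> relabel f A = relabel g A.
Proof.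
by move=> fg; apply: eq_in_imset => b _; exact: eq_imset.
Qed.

Lemma relabel_fix (P : finType) (f : P -> P) (A : {set {set P}}) :
  {in cover A, f =1 id} -> relabel f A = A.
Proof.
move=> fix_f; rewrite -[RHS]imset_id; apply: eq_in_imset => b bA.
rewrite -[RHS]imset_id; apply: eq_in_imset => x xb.
by apply: fix_f; exact: mem_cover xb.
Qed.

Lemma matching_of_involution (P : finType) (phi : P -> P) : involutive phi ->
  [set [set x; phi x] | x in [set: P]] \in matchings [set: P].
Proof.
move=> phiK; apply/matchingsP; split.
- apply/setP => x; rewrite inE; apply/bigcupP; exists [set x; phi x].
    exact: imset_f.
  by rewrite !inE eqxx.
- apply/trivIsetP => _ _ /imsetP[x _ ->] /imsetP[y _ ->]; apply: contraNT.
  rewrite -setI_eq0 => /set0Pn[z]; rewrite !inE => /andP[].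
  move=> /orP[]/eqP -> /orP[/eqP|/eqP]; rewrite ?eqxx //.
  + by move=> ->.
  + by move=> ->; rewrite phiK setUC.
  + by move=> <-; rewrite phiK setUC.
  + by move=> /(can_inj phiK) ->.
- by move=> _ /imsetP[x _ ->]; rewrite cards2; case: (x != _).
Qed.

(** * Slots of vertices and structures *)

(* The element (v, i) of [slot n R] is the i-th place where an edge can be
   attached to the vertex v; a block of size 1 of a matching is a free slot. *)
Definition slot (n R : nat) : finType := ('I_n * 'I_R)%type.

Section Slots.
Variables n R : nat.
Local Notation slot := (slot n R).
Implicit Types (A B M : {set {set slot}}) (U T : {set slot}) (W : {set 'I_n}).

Definition touched A : {set 'I_n} := [set x.1 | x in cover A].

Definition slots_at U (u : 'I_n) : {set slot} := [set x in U | x.1 == u].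

Definition overfull (K : nat) A : bool :=
  (#|touched A| <= K) && (2 * #|touched A| < #|cover A|).

(** The second clause is connectedness, phrased through sets of vertices closed under the blocks, so
    that no walks along blocks have to be handled. *)
Definition is_structure A : Prop :=
  (forall u, u \in touched A -> #|slots_at (cover A) u| = 2) /\
  (forall W, W != set0 -> W \subset touched A ->
     (forall b x y, b \in A -> x \in b -> y \in b -> x.1 \in W -> y.1 \in W) ->
     W = touched A).

Lemma mem_touched A x : x \in cover A -> x.1 \in touched A.
Proof. exact: imset_f. Qed.

Lemma touchedU A B : touched (A :|: B) = touched A :|: touched B.
Proof. by rewrite /touched coverU imsetU. Qed.

Lemma card_slots_at U :
  #|U| = \sum_(u in [set x.1 | x in U]) #|slots_at U u|.
Proof.
rewrite -sum1_card (partition_big_imset (fun x : slot => x.1)) /=.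
apply: eq_bigr => u _; rewrite -sum1_card; apply: eq_bigl => x.
by rewrite inE.
Qed.

Lemma slots_atS U T u : U \subset T -> slots_at U u \subset slots_at T u.
Proof.
move=> /subsetP sUT; apply/subsetP => x; rewrite !inE => /andP[/sUT -> ->] //.
Qed.

Lemma structure_card A :
  is_structure A -> #|cover A| = 2 * #|touched A|.
Proof.
case=> two _; rewrite card_slots_at mulnC -sum_nat_const.
by apply: eq_bigr => u; exact: two.
Qed.

(** At a common vertex both structures occupy the same two slots, hence share the blocks through
    them. The common vertices are therefore closed under the blocks of A, and connectedness makes
    them all vertices of A. *)
Lemma structure_overlap_sub M T A B : M \in matchings T ->
  A \subset M -> B \subset M -> is_structure A -> is_structure B ->
  (forall u, u \in touched (A :|: B) -> #|slots_at (cover (A :|: B)) u| <= 2) ->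
  touched A :&: touched B != set0 -> A \subset B.
Proof.
move=> /matchingsP[_ tM posM] sA sB [twoA conA] [twoB _] two meet.
have sameslots u : u \in touched A -> u \in touched B ->
    slots_at (cover A) u = slots_at (cover B) u.
  move=> uA uB; have uAB : u \in touched (A :|: B) by rewrite touchedU inE uA.
  transitivity (slots_at (cover (A :|: B)) u); last apply/esym.
    by apply/eqP; rewrite eqEcard twoA // two // slots_atS ?coverU ?subsetUl.
  by apply/eqP; rewrite eqEcard twoB // two // slots_atS ?coverU ?subsetUr.
have shared b x : b \in A -> x \in b -> x.1 \in touched B -> b \in B.
  move=> bA xb xB; have xA := mem_cover bA xb.
  have : x \in slots_at (cover B) x.1.
    by rewrite -sameslots //; [rewrite inE xA eqxx|exact: mem_touched].
  rewrite inE => /andP[/bigcupP[c cB xc] _].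
  by rewrite (trivIset_eq tM (subsetP sA _ bA) (subsetP sB _ cB) xb xc).
have eqW : touched A :&: touched B = touched A.
  apply: conA => //; first exact: subsetIl.
  move=> b x y bA xb yb; rewrite !inE => /andP[_ xB].
  rewrite (mem_touched (mem_cover bA yb)) /=.
  by apply: mem_touched; apply: mem_cover yb; exact: shared xB.
apply/subsetP => b bA.
have /andP[+ _] := posM _ (subsetP sA _ bA); rewrite card_gt0 => /set0Pn[x xb].
apply: shared (bA) (xb) _; have := mem_touched (mem_cover bA xb).
by rewrite -eqW inE => /andP[].
Qed.

(** Every vertex of the union carries at least two slots. If the total were only twice the number of
    vertices, each would carry exactly two, and each structure would contain the other. *)
Lemma structure_overlap M T A B : M \in matchings T ->
  A \subset M -> B \subset M -> is_structure A -> is_structure B ->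
  touched A :&: touched B != set0 -> A != B ->
  2 * #|touched (A :|: B)| < #|cover (A :|: B)|.
Proof.
move=> mM sA sB stA stB meet nAB; rewrite ltnNge; apply: contra nAB => le2.
have ge2 u : u \in touched (A :|: B) -> 2 <= #|slots_at (cover (A :|: B)) u|.
  rewrite touchedU inE coverU => /orP[uA|uB].
    by rewrite -(stA.1 u uA); apply/subset_leq_card/slots_atS/subsetUl.
  by rewrite -(stB.1 u uB); apply/subset_leq_card/slots_atS/subsetUr.
have two u : u \in touched (A :|: B) -> #|slots_at (cover (A :|: B)) u| <= 2.
  move=> uW; rewrite leqNgt; apply/negP => gt2; move: le2.
  rewrite card_slots_at leqNgt mulnC -sum_nat_const => /negP; apply.
  rewrite [X in X < _](bigD1 u) //= [X in _ < X](bigD1 u) //=.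
  rewrite -addSn leq_add //; apply: leq_sum => w /andP[wW _]; exact: ge2.
apply/eqP/setP/subset_eqP/andP; split.
  exact: structure_overlap_sub mM _ _ _ _ two meet.
apply: (structure_overlap_sub mM) => //; last by rewrite setIC.
by move=> u; rewrite setUC; exact: two.
Qed.

Lemma card_cover_le A : #|cover A| <= R * #|touched A|.
Proof.
rewrite card_slots_at mulnC -sum_nat_const; apply: leq_sum => u _.
rewrite -[R in _ <= R]card_ord -(card_in_imset (f := fun x : slot => x.2)).
  exact: max_card.
by move=> [v i] [w j]; rewrite !inE /= => /andP[_ /eqP ->] /andP[_ /eqP ->] ->.
Qed.

(** Such an A is a set of subsets of the slots over W. The bound is crude; what matters is that it
    does not involve n. *)
Lemma card_touched_eq W : #|[set A | touched A == W]| <= 2 ^ 2 ^ (R * #|W|).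
Proof.
pose B : {set slot} := setX W [set: 'I_R].
have -> : R * #|W| = #|B| by rewrite cardsX cardsT card_ord mulnC.
rewrite -card_powerset -card_powerset; apply: subset_leq_card.
apply/subsetP => A; rewrite !inE => /eqP tA; apply/subsetP => b bA.
rewrite inE; apply/subsetP => x xb; rewrite !inE andbT -tA.
by apply: mem_touched; exact: mem_cover xb.
Qed.

End Slots.

(** * Probabilities for a uniform random matching *)

Section InvolutionBounds.
Local Open Scope ring_scope.
Variable K : rcfType.
Local Notation inv m := ((involutions m)%:R : K).

Lemma inv_gt0 m : 0 < inv m.
Proof. by rewrite ltr0n involutions_gt0. Qed.

Lemma inv_neq0 m : inv m != 0.
Proof. by rewrite gt_eqF // inv_gt0. Qed.

(** In I(m+2) = I(m+1) + (m+1) I(m), a bound on I(m+1)/I(m) from one side bounds I(m+2)/I(m+1) from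
    the other, so both inequalities go through one induction. *)
Lemma involutions_ratio m :
  Num.sqrt m.+1%:R * inv m <= inv m.+1 <= (1 + Num.sqrt m%:R) * inv m.
Proof.
elim: m => [|m /andP[lo hi]]; first by rewrite /= sqrtr1 sqrtr0 addr0 !mulr1 lexx.
set s := Num.sqrt m%:R in hi *; set t := Num.sqrt m.+1%:R in lo hi *.
set u := Num.sqrt m.+2%:R.
have s0 : 0 <= s by exact: sqrtr_ge0.
have t0 : 0 < t by rewrite sqrtr_gt0 ltr0n.
have tt : t ^+ 2 = m.+1%:R by rewrite sqr_sqrtr // ler0n.
have ss : s ^+ 2 = m%:R by rewrite sqr_sqrtr // ler0n.
have uu : u ^+ 2 = m.+2%:R by rewrite sqr_sqrtr // ler0n.
have u0 : 0 <= u by exact: sqrtr_ge0.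
have u1 : 1 <= u by rewrite -sqrtr1 ler_sqrt ?ler1n.
have su : s <= u by rewrite ler_sqrt ?ler0n // ler_nat; lia.
rewrite involutionsSS natrD natrM -tt.
have a0 := inv_gt0 m; have b0 := inv_gt0 m.+1.
move: a0 b0 lo hi; set a := inv m; set b := inv m.+1 => a0 b0 lo hi.
(* This is m+1 = (m+2) - 1; it converts the upper bound 1 + s <= 1 + u for the previous ratio into
   the lower bound u for the next one. *)
have e : t ^+ 2 = (u - 1) * (u + 1).
  by rewrite -subr_sqr expr1n uu tt -[in RHS]addn1 natrD addrK.
apply/andP; split; last first.
  rewrite mulrDl mul1r lerD2l expr2 -mulrA ler_pM2l //.
rewrite -lerBDl -[X in _ - X]mul1r -mulrBl e -mulrA ler_wpM2l ?subr_ge0 //.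
apply: le_trans hi _; rewrite ler_pM2r // addrC lerD2r //.
Qed.

Definition delta (n : nat) : K := (Num.sqrt n%:R)^-1.

Lemma delta_ge0 n : 0 <= delta n.
Proof. by rewrite invr_ge0 sqrtr_ge0. Qed.

Lemma delta_le1 n : delta n <= 1.
Proof.
case: n => [|n]; first by rewrite /delta sqrtr0 invr0 ler01.
by rewrite invf_le1 ?sqrtr_gt0 ?ltr0n // -[leLHS]sqrtr1 ler_sqrt ?ler1n.
Qed.

Lemma delta_pow n w : (0 < n)%N -> n%:R ^+ w * delta n ^+ (2 * w) = 1.
Proof.
move=> n0; rewrite exprM -exprMn -[RHS](expr1n _ w); congr (_ ^+ w).
by rewrite exprVn sqr_sqrtr ?ler0n // divff // pnatr_eq0 -lt0n.
Qed.

Lemma involutions_sub n s m : (n + s <= m)%N -> (0 < n)%N ->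
  inv (m - s) <= delta n ^+ s * inv m.
Proof.
move=> + n0; elim: s => [|s IH] nm; first by rewrite subn0 expr0 mul1r.
apply: le_trans (_ : delta n * inv (m - s) <= _); last first.
  rewrite exprS -mulrA ler_wpM2l ?delta_ge0 //; apply: IH; lia.
have -> : (m - s = (m - s.+1).+1)%N by lia.
have /andP[+ _] := involutions_ratio (m - s.+1).
move=> h; rewrite /delta mulrC ler_pdivlMr ?sqrtr_gt0 ?ltr0n //.
apply: le_trans h; rewrite mulrC ler_wpM2r ?ler0n //.
by rewrite ler_sqrt ?ler0n // ler_nat; lia.
Qed.

End InvolutionBounds.

Section Probability.
Local Open Scope ring_scope.
Variables (K : rcfType) (P : finType).
Local Notation inv m := ((involutions m)%:R : K).
Implicit Types (T U : {set P}) (A B M : {set {set P}}).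
Implicit Types (Q D : pred {set {set P}}).

Definition Pr T Q : K := #|[set M in matchings T | Q M]|%:R / inv #|T|.

Lemma Pr_ge0 T Q : 0 <= Pr T Q.
Proof. by rewrite divr_ge0 ?ler0n. Qed.

Lemma Pr_mono T Q D : (forall M, M \in matchings T -> Q M -> D M) ->
  Pr T Q <= Pr T D.
Proof.
move=> QD; rewrite ler_pM2r ?invr_gt0 ?inv_gt0 // ler_nat.
apply: subset_leq_card; apply/subsetP => M /setIdP[mM QM].
by rewrite inE mM /= QD.
Qed.

Lemma eq_Pr T Q D : (forall M, M \in matchings T -> Q M = D M) -> Pr T Q = Pr T D.
Proof.
move=> h; apply/eqP; rewrite eq_le !Pr_mono // => M /h -> //.
Qed.

Lemma Pr1 T : Pr T xpredT = 1.
Proof.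
rewrite /Pr -card_matchings.
have -> : [set M in matchings T | true] = matchings T.
  by apply/setP => M; rewrite inE andbT.
by rewrite divff // card_matchings inv_neq0.
Qed.

Lemma Pr_le1 T Q : Pr T Q <= 1.
Proof. by rewrite -(Pr1 T) Pr_mono. Qed.

Lemma PrE T Q : Pr T Q = (\sum_(M in matchings T) (Q M)%:R) / inv #|T|.
Proof.
rewrite /Pr; congr (_ / _); rewrite -sum1_card natr_sum.
rewrite (eq_bigl (fun M => (M \in matchings T) && Q M)); last first.
  by move=> M; rewrite inE.
rewrite big_mkcondr; apply: eq_bigr => M _; by case: (Q M).
Qed.

Lemma Pr_exists T (X : finType) (F : {pred X}) (Q : X -> pred {set {set P}}) :
  Pr T (fun M => [exists x in F, Q x M]) <= \sum_(x in F) Pr T (Q x).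
Proof.
rewrite (eq_bigr _ (fun x _ => PrE T (Q x))) -mulr_suml PrE.
rewrite ler_pM2r ?invr_gt0 ?inv_gt0 // exchange_big /=; apply: ler_sum => M _.
case: exists_inP => [[x xF Qx]|_]; last by rewrite sumr_ge0 // => x _; rewrite ler0n.
by rewrite (bigD1 x) //= Qx lerDl sumr_ge0 // => y _; rewrite ler0n.
Qed.

Lemma Pr_or T Q D : Pr T (fun M => Q M || D M) <= Pr T Q + Pr T D.
Proof.
rewrite !PrE -mulrDl ler_pM2r ?invr_gt0 ?inv_gt0 // -big_split /=.
by apply: ler_sum => M _; case: (Q M); case: (D M); rewrite /= ?lexx ?lerDl ?ler01 ?add0r ?addr0 ?lexx.
Qed.

Lemma Pr_dist T Q1 Q2 D :
  (forall M, M \in matchings T -> Q1 M != Q2 M -> D M) ->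
  `|Pr T Q1 - Pr T Q2| <= Pr T D.
Proof.
move=> h; rewrite ler_norml; apply/andP; split.
  rewrite lerNl opprB lerBlDr; apply: le_trans (Pr_or _ _ _).
  by apply: Pr_mono => M /h; case: (D M); case: (Q1 M); case: (Q2 M) => //= ->.
rewrite lerBlDr; apply: le_trans (Pr_or _ _ _).
by apply: Pr_mono => M /h; case: (D M); case: (Q1 M); case: (Q2 M) => //= ->.
Qed.

(** Given that the blocks of A occur, the rest is a uniform matching of the remaining points; the
    quotient is the probability that they occur. *)
Lemma Pr_sub T A U Q : A \in matchings U -> U \subset T ->
  Pr T (fun M => (A \subset M) && Q M) =
  inv (#|T| - #|U|) / inv #|T| * Pr (T :\: U) (fun M => Q (A :|: M)).
Proof.
move=> mA sUT; rewrite /Pr (card_matchings_sup Q mA sUT).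
rewrite cardsD (setIidPr sUT) mulrCA mulrAC.
by rewrite divff ?inv_neq0 // mulrC mul1r mulrC.
Qed.

Lemma Pr_sub_le n T A : (n + #|cover A| <= #|T|)%N -> (0 < n)%N ->
  Pr T (fun M => A \subset M) <= delta K n ^+ #|cover A|.
Proof.
move=> nT n0.
have [/andP[mA sA]|/nandP hA] := boolP ((A \in matchings (cover A)) && (cover A \subset T)).
  have := Pr_sub xpredT mA sA.
  rewrite (eq_Pr (D := fun M => A \subset M)) => [|M _]; last by rewrite andbT.
  move=> ->; rewrite Pr1 mulr1 ler_pdivrMr ?inv_gt0 //.
  exact: involutions_sub.
(* If A is not a matching of points of T, then no matching of T contains it. *)
rewrite (eq_Pr (D := xpred0)) => [|M mM].
  rewrite PrE big1 ?mul0r ?exprn_ge0 ?delta_ge0 //.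
apply/negP => sA; case: hA => /negP; apply.
  exact: matching_cover mM sA.
exact: matching_sub_cover mM sA.
Qed.

End Probability.

(** * Union bounds over bounded sets of vertices *)

Section FirstMoment.
Local Open Scope ring_scope.
Variables (K : rcfType) (n R : nat).
Hypothesis n_gt0 : (0 < n)%N.
Local Notation slot := (slot n R).
Local Notation delta := (delta K n).
Implicit Types (T U : {set slot}) (A B M : {set {set slot}}).

Definition shape_bound (k : nat) : nat := 2 ^ 2 ^ (R * k).

Lemma sum_delta_touched k s (F : {set {set {set slot}}}) (Ws : {set {set 'I_n}}) :
  (forall A, A \in F ->
     [/\ touched A \in Ws, (#|touched A| <= k)%N & (s <= #|cover A|)%N]) ->
  \sum_(A in F) delta ^+ #|cover A| <= (#|Ws| * shape_bound k)%:R * delta ^+ s.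
Proof.
move=> hF; apply: le_trans (_ : \sum_(A in F) delta ^+ s <= _).
  apply: ler_sum => A /hF[_ _ sA]; apply: ler_wiXn2l sA.
    exact: delta_ge0.
  exact: delta_le1.
rewrite sumr_const -[leLHS]mulr_natl ler_wpM2r ?exprn_ge0 ?delta_ge0 // ler_nat.
rewrite -sum1_card (partition_big (@touched n R) [in Ws]) /=; last by move=> A /hF[].
rewrite -sum_nat_const; apply: leq_sum => W _.
rewrite sum1dep_card.
have [->|/set0Pn[A]] := eqVneq [set A in F | touched A == W] set0; first by rewrite cards0.
rewrite inE => /andP[/hF[_ Ak _] /eqP eW].
apply: leq_trans (_ : 2 ^ 2 ^ (R * #|W|) <= _)%N; last first.
  by rewrite /shape_bound !leq_exp2l // leq_mul2l -eW Ak orbT.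
apply: leq_trans (card_touched_eq R W); apply: subset_leq_card.
by apply/subsetP => B /setIdP[_ tB]; rewrite inE.
Qed.

Lemma bin_le_expn (m w : nat) : ('C(m, w) <= m ^ w)%N.
Proof.
apply: leq_trans (_ : m ^_ w <= _)%N; first by rewrite -bin_ffact leq_pmulr ?fact_gt0.
by elim: w => // w IH; rewrite ffactnSr expnSr leq_mul // leq_subr.
Qed.

(** For each w <= k there are at most n^w vertex sets of size w and at least 2w + 1 slots are
    prescribed, which leaves one factor [delta]. The k + 1 values of w give the factor [k.+1]. *)
Lemma sum_delta_overfull k :
  \sum_(A : {set {set slot}} | overfull k A) delta ^+ #|cover A| <=
  (k.+1 * shape_bound k)%:R * delta.
Proof.
rewrite (partition_big (fun A => inord #|touched A| : 'I_k.+1) xpredT) //=.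
rewrite natrM -mulrA mulr_natl -[X in _ *+ X]card_ord -sumr_const.
apply: ler_sum => w _.
pose F := [set A : {set {set slot}} | overfull k A & #|touched A| == w].
rewrite (eq_bigl [in F]) => [|A]; last first.
  rewrite !inE; case dA: (overfull k A) => //=; rewrite -val_eqE /= inordK //.
  by case/andP: dA.
apply: le_trans (sum_delta_touched (k := k) (s := (2 * w).+1)
  (Ws := [set W : {set 'I_n} | #|W| == w]) _) _.
  by move=> A; rewrite !inE => /andP[/andP[Ak Ad] /eqP <-].
rewrite card_draws card_ord natrM -mulrA mulrCA ler_wpM2l ?ler0n //.
rewrite exprSr mulrA -[leRHS]mul1r ler_wpM2r ?delta_ge0 //.
rewrite -[leRHS](delta_pow K w n_gt0) ler_wpM2r ?exprn_ge0 ?delta_ge0 //.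
by rewrite -natrX ler_nat bin_le_expn.
Qed.

Lemma Pr_overfull k T : (n + R * k <= #|T|)%N ->
  \sum_(A : {set {set slot}} | overfull k A) Pr K T (fun M => A \subset M) <=
  (k.+1 * shape_bound k)%:R * delta.
Proof.
move=> hT; apply: le_trans (sum_delta_overfull k); apply: ler_sum => A /andP[Ak _].
apply: Pr_sub_le => //; apply: leq_trans hT; rewrite leq_add2l.
by apply: leq_trans (card_cover_le A) _; rewrite leq_mul2l Ak orbT.
Qed.

Lemma card_draws_at (u : 'I_n) w :
  (#|[set W : {set 'I_n} | (u \in W) && (#|W| == w.+1)]| <= n ^ w)%N.
Proof.
apply: leq_trans (bin_le_expn n w); rewrite -[n in 'C(n, _)]card_ord -card_draws.
rewrite -[leqLHS](card_in_imset (f := fun W => W :\ u)).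
  apply: subset_leq_card; apply/subsetP => _ /imsetP[W + ->]; rewrite !inE.
  by move=> /andP[uW]; rewrite (cardsD1 u W) uW.
move=> W1 W2; rewrite !inE => /andP[u1 _] /andP[u2 _] e.
by rewrite -(setD1K u1) -(setD1K u2) e.
Qed.

(** The slot x fixes one vertex, so w + 1 vertices can be chosen in at most n^w ways while 2(w + 1)
    slots are prescribed. This leaves [delta] squared, of which one factor is given away. *)
Lemma sum_delta_at k (F : {set {set {set slot}}}) x :
  (forall A, A \in F ->
     [/\ x \in cover A, (#|touched A| <= k)%N & #|cover A| = (2 * #|touched A|)%N]) ->
  \sum_(A in F) delta ^+ #|cover A| <= (k * shape_bound k)%:R * delta.
Proof.
move=> hF; have hF0 A : A \in F -> (0 < #|touched A| <= k)%N.
  move=> /hF[xA -> _]; rewrite andbT card_gt0; apply/set0Pn; exists x.1.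
  exact: mem_touched.
case: k hF hF0 => [|k] hF hF0.
  by rewrite big1 ?mul0n ?mul0r // => A /hF0; case: #|touched A|.
rewrite (partition_big (fun A => inord #|touched A|.-1 : 'I_k.+1) xpredT) //=.
rewrite natrM -mulrA mulr_natl -[X in _ *+ X]card_ord -sumr_const.
apply: ler_sum => w _.
pose F' := [set A in F | #|touched A| == w.+1].
rewrite (eq_bigl [in F']) => [|A]; last first.
  rewrite !inE; case AF: (A \in F) => //=; have := hF0 A AF.
  by case: #|touched A| => //= m mk; rewrite -val_eqE /= inordK.
apply: le_trans (sum_delta_touched (k := k.+1) (s := (2 * w.+1)%N)
  (Ws := [set W : {set 'I_n} | (x.1 \in W) && (#|W| == w.+1)]) _) _.
  move=> A /setIdP[AF /eqP Aw]; have [xA Ak ->] := hF A AF.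
  by rewrite inE Aw eqxx -Aw Ak mem_touched.
rewrite natrM -mulrA mulrCA ler_wpM2l ?ler0n //.
apply: le_trans (_ : n%:R ^+ w * delta ^+ (2 * w.+1) <= _).
  by rewrite -natrX ler_wpM2r ?exprn_ge0 ?delta_ge0 // ler_nat card_draws_at.
rewrite mulnS exprD mulrCA (delta_pow K w n_gt0) mulr1 expr2 -[leRHS]mul1r.
by rewrite ler_wpM2r ?delta_ge0 // delta_le1.
Qed.

Lemma Pr_at k T (F : {set {set {set slot}}}) x : (n + R * k <= #|T|)%N ->
  (forall A, A \in F -> is_structure A /\ (#|touched A| <= k)%N) ->
  Pr K T (fun M => [exists A in F, (A \subset M) && (x \in cover A)]) <=
  (k * shape_bound k)%:R * delta.
Proof.
move=> hT hF; pose F' := [set A in F | x \in cover A].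
apply: le_trans (_ : \sum_(A in F') Pr K T (fun M => A \subset M) <= _).
  apply: le_trans (Pr_exists _ _ _ _); apply: Pr_mono => M _.
  move=> /exists_inP[A AF /andP[sA xA]]; apply/exists_inP; exists A => //.
  by rewrite inE AF.
apply: le_trans (sum_delta_at (F := F') (x := x) (k := k) _).
  apply: ler_sum => A /setIdP[AF _]; apply: Pr_sub_le => //.
  apply: leq_trans hT; rewrite leq_add2l.
  apply: leq_trans (card_cover_le A) _; rewrite leq_mul2l; apply/orP; right.
  by have [] := hF A AF.
move=> A /setIdP[AF xA]; have [stA Ak] := hF A AF; split=> //.
exact: structure_card.
Qed.

End FirstMoment.

(** * The Poisson recursion *)

Section Recursion.
Local Open Scope ring_scope.
Variables (K : rcfType) (n R k : nat) (I : finType).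
Hypothesis n_gt0 : (0 < n)%N.
Local Notation slot := (slot n R).
Local Notation delta := (delta K n).
Local Notation inv m := ((involutions m)%:R : K).
Local Notation Pr := (Pr K).
Implicit Types (T U : {set slot}) (A B C M : {set {set slot}}).
Implicit Types (x y : {ffun I -> nat}).

Variables (Str : I -> {set {set {set slot}}}) (v : I -> nat).
Hypothesis Str_structure : forall t A, A \in Str t -> is_structure A.
Hypothesis Str_matching : forall t A, A \in Str t -> A \in matchings (cover A).
Hypothesis Str_touched : forall t A, A \in Str t -> #|touched A| = v t.
Hypothesis Str_inj : forall t u A, A \in Str t -> A \in Str u -> t = u.
Hypothesis v_gt0 : forall t, (0 < v t)%N.
Hypothesis v_le : forall t, (v t <= k)%N.

Definition counts M : {ffun I -> nat} :=
  [ffun t => #|[set A in Str t | A \subset M]|].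

Definition allStr : {set {set {set slot}}} := \bigcup_t Str t.

Definition hits (s : slot) M : bool :=
  [exists A in allStr, (A \subset M) && (s \in cover A)].

Lemma allStrP A : A \in allStr -> is_structure A /\ (#|touched A| <= k)%N.
Proof. by case/bigcupP=> t _ At; rewrite (Str_touched At); split; eauto. Qed.

Lemma counts_eq M M' :
  (forall A, A \in allStr -> (A \subset M) = (A \subset M')) -> counts M = counts M'.
Proof.
move=> h; apply/ffunP => t; rewrite !ffunE; apply: eq_card => A; rewrite !inE.
by case At: (A \in Str t) => //=; apply: h; apply/bigcupP; exists t.
Qed.

Let c1 : K := (k * shape_bound R k)%:R.

Lemma Pr_hits T s : (n + R * k <= #|T|)%N -> Pr T (hits s) <= c1 * delta.
Proof. by move=> hT; apply: Pr_at => // A /allStrP. Qed.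

Lemma counts_del M a d : ~~ hits a M -> counts (M :\ [set a; d]) = counts M.
Proof.
move=> nh; apply: counts_eq => A AS; rewrite subsetD1.
case sA : (A \subset M) => //=; apply: contra nh => adA.
apply/exists_inP; exists A => //; rewrite sA /=; apply: mem_cover adA _.
by rewrite !inE eqxx.
Qed.

Lemma relabel_tperm_fix (b d : slot) A :
  b \notin cover A -> d \notin cover A -> relabel (tperm b d) A = A.
Proof.
move=> bA dA; apply: relabel_fix => s sA; rewrite tpermD //.
  by apply: contraNneq bA => ->.
by apply: contraNneq dA => ->.
Qed.

(** The transposition fixes every structure that avoids b and d. As b is not covered before and d is
    not covered after the move, only a structure through d before it or through b after it can
    matter. *)
Lemma counts_swap M b d : b \notin cover M ->
  ~~ hits d M -> ~~ hits b (relabel (tperm b d) M) ->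
  counts (relabel (tperm b d) M) = counts M.
Proof.
move=> bM nd nb; set f := tperm b d.
have finj : injective f by exact: perm_inj.
apply: counts_eq => A AS; apply/idP/idP => sA.
  rewrite -(relabelS finj) relabel_tperm_fix //.
    by apply: contra nb => bA; apply/exists_inP; exists A => //; rewrite sA.
  apply: contra bM => /(subsetP (sub_cover sA)); rewrite cover_relabel.
  by move=> /imsetP[s sM e]; suff <- : s = b by []; apply: finj; rewrite -e tpermL.
have <- : relabel f A = A; last by rewrite relabelS.
apply: relabel_tperm_fix.
  by apply: contra bM; exact: (subsetP (sub_cover sA)).
by apply: contra nd => dA; apply/exists_inP; exists A => //; rewrite sA.
Qed.

Lemma Pr_relabel T (f : slot -> slot) (Q : pred {set {set slot}}) :
  bijective f -> Pr (f @: T) Q = Pr T (fun M => Q (relabel f M)).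
Proof.
move=> [g fK gK]; have finj := can_inj fK; have ginj := can_inj gK.
rewrite /Pr card_imset //; congr (_%:R / _).
rewrite -[in RHS](card_imset _ (relabel_inj finj)); apply: eq_card => M.
apply/setIdP/imsetP => [[mM QM]|[M' /setIdP[mM' QM'] ->]].
  have e : M = relabel f (relabel g M).
    by rewrite relabel_comp relabel_fix // => s _ /=; rewrite gK.
  exists (relabel g M) => //; rewrite in_set -e QM andbT.
  have -> : T = g @: (f @: T).
    by rewrite -imset_comp -[LHS]imset_id; apply: eq_imset => s /=; rewrite fK.
  exact: relabel_matching.
by rewrite relabel_matching.
Qed.

Lemma Pr_swap T a b d y : a \in T -> b \in T -> d \in T -> d != a -> d != b ->
  (n + R * k + 2 <= #|T|)%N -> a != b ->
  `|Pr (T :\: [set a; d]) (fun M => counts M == y) -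
    Pr (T :\: [set a; b]) (fun M => counts M == y)| <= 2 * c1 * delta.
Proof.
move=> aT bT dT da db hT ab.
have card2 e : e \in T -> e != a -> (n + R * k <= #|T :\: [set a; e]|)%N.
  move=> eT ea; rewrite cardsD (setIidPr _) ?cards2 1?eq_sym ?ea; first by lia.
  by apply/subsetP => s; rewrite !inE => /orP[]/eqP ->.
have -> : T :\: [set a; d] = tperm b d @: (T :\: [set a; b]).
  apply/setP => s; rewrite -[s in RHS](tpermK b d) mem_imset; last exact: perm_inj.
  rewrite !inE; case: tpermP => [->|->|/eqP sb /eqP sd].
  - by rewrite bT dT (eq_sym b a) (eq_sym b d) (negbTE da) (negbTE db) (negbTE ab).
  - by rewrite !eqxx !orbT.
  - by rewrite (negbTE sb) (negbTE sd).
rewrite Pr_relabel; last by exists (tperm b d); exact: tpermK.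
set f := tperm b d; apply: le_trans (Pr_dist K
  (D := fun M => hits d M || hits b (relabel f M)) _) _.
  move=> M mM; apply: contraNT; rewrite negb_or => /andP[nd nb]; rewrite counts_swap //.
  by have [-> _ _] := matchingsP _ _ mM; rewrite !inE eqxx orbT.
apply: le_trans (Pr_or _ _ _ _) _.
rewrite -[2]/(1 + 1)%R mulrDl mulrDl mul1r lerD //.
  by apply: Pr_hits; apply: card2 => //; rewrite eq_sym.
rewrite -(Pr_relabel (T :\: [set a; b]) (hits b)); last first.
  by exists (tperm b d); exact: tpermK.
apply: Pr_hits; rewrite card_imset; last exact: perm_inj.
by apply: card2 => //; rewrite eq_sym.
Qed.

Lemma Pr_split T a Q : a \in T ->
  Pr T Q = \sum_(d in T) Pr T (fun M => ([set a; d] \in M) && Q M).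
Proof.
by move=> aT; rewrite /Pr (card_matchings_split _ aT) natr_sum mulr_suml.
Qed.

(** Independence: given A, the part of the matching outside A is uniform on the remaining slots. *)
Lemma Pr_sub_del T A Q : A \in matchings (cover A) -> cover A \subset T ->
  Pr T (fun M => (A \subset M) && Q (M :\: A)) =
  Pr T (fun M => A \subset M) * Pr (T :\: cover A) Q.
Proof.
move=> mA sA; rewrite (Pr_sub _ _ mA sA).
rewrite (eq_Pr (D := fun M => (A \subset M) && true) _ (T := T)) => [|M _]; last first.
  by rewrite andbT.
rewrite (Pr_sub _ _ mA sA) Pr1 mulr1; congr (_ * _); apply: eq_Pr => M mM.
congr (Q _); rewrite setDUl setDv set0U; apply/setDidPl.
rewrite disjoint_sym; apply: matchings_disjoint mA mM _.
by rewrite disjoint_sym disjoints_subset setDE subsetIr.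
Qed.

(* If d is the partner of a, then removing the block {a, d} rarely destroys a
   structure; and T minus {a, d} differs from T minus {a, b} by the transposition
   of b and d. *)
Lemma Pr_remove2 T a b y : a \in T -> b \in T -> a != b ->
  (n + R * k + 2 <= #|T|)%N ->
  `|Pr T (fun M => counts M == y) -
    Pr (T :\: [set a; b]) (fun M => counts M == y)| <= (3 * c1 + 1) * delta.
Proof.
move=> aT bT ab hT.
set p := fun d => Pr (T :\: [set a; d]) (fun M => counts M == y).
pose h d := Pr T (fun M => ([set a; d] \in M) && (counts (M :\ [set a; d]) == y)).
have m2 : (2 <= #|T|)%N by lia.
set r := inv (#|T| - 2) / inv #|T|; set r1 := inv (#|T| - 1) / inv #|T|.
have r1_ge0 : 0 <= r1 by rewrite divr_ge0 ?ler0n.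
have r_ge0 : 0 <= r by rewrite divr_ge0 ?ler0n.
have r1_le : r1 <= delta.
  rewrite ler_pdivrMr ?inv_gt0 // -[delta in leRHS]expr1.
  by apply: involutions_sub => //; lia.
(* Total probability for the partner of a: each other slot has probability r, and a stays free with
   probability r1. *)
have rr1 : (#|T| - 1)%:R * r + r1 = 1.
  rewrite /r /r1 mulrA -mulrDl -natrM -natrD addnC -involutions_rec; last by lia.
  by rewrite divff // inv_neq0.
have PrE2 d Q : d \in T ->
    Pr T (fun M => ([set a; d] \in M) && Q (M :\ [set a; d])) =
    inv (#|T| - #|[set a; d]|) / inv #|T| * Pr (T :\: [set a; d]) Q.
  move=> dT; have sT : [set a; d] \subset T.
    by apply/subsetP => s; rewrite !inE => /orP[]/eqP ->.
  have mA := matching_pair a d.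
  have cA : cover [set [set a; d]] = [set a; d] by rewrite cover1.
  have := @Pr_sub_del T [set [set a; d]] Q; rewrite cA => /(_ mA sT).
  have := Pr_sub K xpredT mA sT; rewrite Pr1 mulr1 => <-.
  rewrite (eq_Pr (D := fun M => [set [set a; d]] \subset M) _ (T := T)
    (Q := fun M => ([set [set a; d]] \subset M) && true)) => [|M _]; last first.
    by rewrite andbT.
  by move=> <-; apply: eq_Pr => M _; rewrite sub1set.
have hE d : d \in T -> d != a -> h d = r * p d.
  move=> dT da; rewrite /h; have /= -> := PrE2 d (fun M => counts M == y) dT.
  by rewrite cards2 (eq_sym a d) da.
have ha : h a = r1 * p a.
  rewrite /h; have /= -> := PrE2 a (fun M => counts M == y) aT.
  by rewrite cards2 eqxx.
have p01 d : 0 <= p d <= 1 by rewrite Pr_ge0 Pr_le1.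
have d1 : `|Pr T (fun M => counts M == y) - \sum_(d in T) h d| <= c1 * delta.
  rewrite (Pr_split _ aT) -sumrB; apply: le_trans (ler_norm_sum _ _ _) _.
  apply: le_trans (_ : Pr T (hits a) <= _); last by apply: Pr_hits; lia.
  rewrite (Pr_split _ aT); apply: ler_sum => d dT; apply: Pr_dist => M mM.
  case: ([set a; d] \in M) => //=; apply: contraNT => nh.
  by rewrite counts_del.
have d2 : `|\sum_(d in T | d != a) h d - (#|T| - 1)%:R * r * p b| <=
    (#|T| - 1)%:R * r * (2 * c1 * delta).
  have -> : (#|T| - 1)%:R * r * p b = \sum_(d in T | d != a) r * p b.
    rewrite sumr_const -[RHS]mulr_natl -mulrA; congr (_%:R * _).
    by rewrite [in LHS](cardsD1 a) aT add1n subn1; apply: eq_card => d; rewrite !inE andbC.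
  rewrite -sumrB; apply: le_trans (ler_norm_sum _ _ _) _.
  have -> : (#|T| - 1)%:R * r * (2 * c1 * delta) =
      \sum_(d in T | d != a) r * (2 * c1 * delta).
    rewrite sumr_const -[RHS]mulr_natl -!mulrA; congr (_%:R * _).
    by rewrite [in LHS](cardsD1 a) aT add1n subn1; apply: eq_card => d; rewrite !inE andbC.
  apply: ler_sum => d /andP[dT da]; rewrite hE // -mulrBr normrM ger0_norm //.
  apply: ler_wpM2l => //.
  have [->|db] := eqVneq d b; last by apply: Pr_swap.
  by rewrite subrr normr0 !mulr_ge0 ?ler0n ?delta_ge0.
(* The constant 3 c1 + 1 collects c1 from deleting the block of a, 2 c1 from moving its partner to
   b, and 1 from the event that a is free. *)
have := d1; rewrite (bigD1 a) //= ha; move: d2 (p01 a) (p01 b) rr1 r1_ge0 r1_le.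
have := delta_ge0 K n; have : 0 <= c1 by rewrite ler0n.
move: r_ge0; rewrite -/(p b); set q := Pr T _; set S := \sum_(i in T | _) _.
set mm := (#|T| - 1)%:R * r; move: (p a) (p b) => pa pb r0 c0 dl0.
rewrite !ler_norml => /andP[s1 s2] /andP[a0 a1] /andP[b0 b1] rr1 r10 r1d /andP[q1 q2].
have em : mm = 1 - r1 by rewrite -rr1 addrK.
rewrite em in s1 s2.
have e1 : 0 <= r1 * pa <= r1 by rewrite mulr_ge0 //= -[leRHS]mulr1 ler_wpM2l.
have e2 : 0 <= r1 * pb <= r1 by rewrite mulr_ge0 //= -[leRHS]mulr1 ler_wpM2l.
have e3 : 0 <= r1 * (c1 * delta) by apply: mulr_ge0 => //; apply: mulr_ge0.
move: e1 e2 => /andP[e11 e12] /andP[e21 e22].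
by apply/andP; split; lra.
Qed.

Lemma Pr_remove w T U y : U \subset T -> #|U| = (2 * w)%N ->
  (n + R * k + 2 * w <= #|T|)%N ->
  `|Pr T (fun M => counts M == y) - Pr (T :\: U) (fun M => counts M == y)| <=
  w%:R * ((3 * c1 + 1) * delta).
Proof.
elim: w T U => [|w IH] T U sU cU hT.
  rewrite muln0 in cU; have -> : U = set0 by apply: cards0_eq.
  by rewrite setD0 subrr normr0 mul0r.
have [a aU] : exists a, a \in U by apply/set0Pn; rewrite -card_gt0 cU; lia.
have [b] : exists b, b \in U :\ a.
  by apply/set0Pn; rewrite -card_gt0; have := cardsD1 a U; rewrite aU cU; lia.
rewrite !inE => /andP[ba bU].
have sab : [set a; b] \subset U by apply/subsetP => s; rewrite !inE => /orP[]/eqP ->.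
have cU' : #|U :\: [set a; b]| = (2 * w)%N.
  by rewrite cardsD (setIidPr sab) cU cards2 eq_sym ba; lia.
have cT' : #|T :\: [set a; b]| = (#|T| - 2)%N.
  by rewrite cardsD (setIidPr (subset_trans sab sU)) cards2 eq_sym ba.
have -> : T :\: U = (T :\: [set a; b]) :\: (U :\: [set a; b]).
  apply/setP => s; rewrite !inE; case sU' : (s \in U) => /=; last first.
    by case: eqP => [sa|_]; [rewrite sa aU in sU'|case: eqP => // sb; rewrite sb bU in sU'].
  by case: (_ || _).
apply: le_trans (ler_distD (Pr (T :\: [set a; b]) (fun M => counts M == y)) _ _) _.
rewrite -natr1 mulrDl mul1r addrC lerD //.
  by apply: IH; [exact: setSD|exact: cU'|rewrite cT'; lia].
by apply: Pr_remove2; rewrite ?(subsetP sU) // 1?eq_sym //; lia.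
Qed.

Definition mean_count t : K := \sum_(A in Str t) Pr [set: slot] (fun M => A \subset M).

Lemma Str_cover t A : A \in Str t -> #|cover A| = (2 * v t)%N.
Proof. by move=> At; rewrite structure_card ?(Str_touched At); eauto. Qed.

(** The factors n^v and [delta] to the power 2v cancel, so only the number of shapes on a given
    vertex set remains, uniformly in n. *)
Lemma mean_count_le t : (n + 2 * k <= n * R)%N ->
  mean_count t <= (shape_bound R k)%:R.
Proof.
move=> hN; have cT : #|[set: slot]| = (n * R)%N by rewrite cardsT card_prod !card_ord.
apply: le_trans (_ : \sum_(A in Str t) delta ^+ #|cover A| <= _).
  apply: ler_sum => A At; apply: Pr_sub_le => //; rewrite cT (Str_cover At).
  by have := v_le t; lia.
apply: le_trans (sum_delta_touched K (k := k) (s := 2 * v t)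
  (Ws := [set W : {set 'I_n} | #|W| == v t]) _) _.
  move=> A At; rewrite inE (Str_touched At) (Str_cover At) eqxx; split=> //.
rewrite card_draws card_ord natrM mulrAC ler_piMl ?ler0n //.
rewrite -[leRHS](delta_pow K (v t) n_gt0) ler_wpM2r ?exprn_ge0 ?delta_ge0 //.
by rewrite -natrX ler_nat bin_le_expn.
Qed.

Lemma mean_countE t :
  mean_count t = #|Str t|%:R * (inv (n * R - 2 * v t) / inv (n * R)).
Proof.
have cT : #|[set: slot]| = (n * R)%N by rewrite cardsT card_prod !card_ord.
rewrite mulr_natl -sumr_const; apply: eq_bigr => A At.
have := Pr_sub K xpredT (Str_matching At) (subsetT _).
rewrite Pr1 mulr1 (Str_cover At) cT => <-.
by apply: eq_Pr => M _; rewrite andbT.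
Qed.

(** Exchanging the sums over A and M turns the left side into the expectation of the count of type t
    on the event Q. *)
Lemma sum_counts t (Q : pred {set {set slot}}) :
  \sum_(A in Str t) Pr [set: slot] (fun M => (A \subset M) && Q M) =
  (\sum_(M in matchings [set: slot] | Q M) (counts M t)%:R) / inv #|[set: slot]|.
Proof.
under eq_bigr do rewrite PrE.
rewrite -mulr_suml exchange_big; congr (_ / _).
rewrite [RHS]big_mkcondr; apply: eq_bigr => M _; case: (Q M) => /=; last first.
  by apply: big1 => A _; rewrite andbF.
rewrite ffunE -sum1_card natr_sum big_mkcond [RHS]big_mkcond /=.
apply: eq_bigr => A _; rewrite inE; case: (A \in Str t) => //=.
by rewrite andbT; case: (A \subset M).
Qed.

Definition overlaps M A : bool :=
  [exists B in allStr,
     [&& B \subset M, B != A & touched A :&: touched B != set0]].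

(** A structure other than A that loses a block must share a block, hence a vertex, with A. So A
    alone is lost, and it belongs to the single type t. *)
Lemma counts_sub M T t A : M \in matchings T -> A \in Str t -> A \subset M ->
  ~~ overlaps M A ->
  forall u, counts M u = (counts (M :\: A) u + (u == t))%N.
Proof.
move=> mM At sA nov u; rewrite !ffunE.
have A0 : A != set0.
  apply: contraTneq (v_gt0 t) => A0; rewrite -(Str_touched At) A0.
  by rewrite /touched /cover big_set0 imset0 cards0.
have eq1 B : B \in Str u -> B != A -> (B \subset M :\: A) = (B \subset M).
  move=> Bu BA; rewrite subsetD; case sB : (B \subset M) => //=.
  rewrite -setI_eq0; apply: contraNT nov => /set0Pn[b]; rewrite inE => /andP[bB bA].
  apply/exists_inP; exists B; first by apply/bigcupP; exists u.
  rewrite sB BA /=; have [_ _ h] := matchingsP _ _ mM.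
  have /andP[+ _] := h _ (subsetP sB _ bB); rewrite card_gt0 => /set0Pn[s sb].
  apply/set0Pn; exists s.1; rewrite inE; apply/andP; split; apply: mem_touched.
    exact: mem_cover bA sb.
  exact: mem_cover bB sb.
have nA : (A \subset M :\: A) = false.
  apply/negP; rewrite subsetD => /andP[_]; rewrite -setI_eq0 setIid.
  by rewrite (negbTE A0).
have [ut|ut] := eqVneq u t.
  rewrite ut (cardsD1 A) inE At sA addnC /=; congr (_ + _)%N.
  apply: eq_card => B; rewrite !inE; case: (eqVneq B A) => [->|BA] /=.
    by rewrite nA andbF.
  by case Bt : (B \in Str t) => //=; rewrite eq1 // ut.
rewrite addn0; apply: eq_card => B; rewrite !inE; case Bu : (B \in Str u) => //=.
rewrite eq1 //; apply: contraNneq ut => BA.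
by apply/eqP; apply: Str_inj Bu _; rewrite BA.
Qed.

Lemma card_blocks_le T C : C \in matchings T -> (#|C| <= #|cover C|)%N.
Proof.
move=> /matchingsP[_ tC h]; rewrite -(eqnP tC) -sum1_card; apply: leq_sum => b bC.
by have /andP[] := h _ bC.
Qed.

(** If A meets another structure B of M, then their union is overfull with at most 2k vertices.
    Hence the overlapping A are found among the subsets of overfull parts C of M. *)
Lemma sum_overlaps t : (n + R * (2 * k) <= n * R)%N ->
  \sum_(A in Str t) Pr [set: slot] (fun M => (A \subset M) && overlaps M A) <=
  (2 ^ (R * (2 * k)))%:R * (((2 * k).+1 * shape_bound R (2 * k))%:R * delta).
Proof.
move=> hN; have cT : #|[set: slot]| = (n * R)%N by rewrite cardsT card_prod !card_ord.
apply: le_trans (_ : (2 ^ (R * (2 * k)))%:R *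
   \sum_(C | overfull (2 * k) C) Pr [set: slot] (fun M => C \subset M) <= _); last first.
  by rewrite ler_wpM2l ?ler0n //; apply: Pr_overfull; rewrite ?cT.
under eq_bigr do rewrite PrE.
under [X in _ <= _ * X]eq_bigr do rewrite PrE.
rewrite -!mulr_suml mulrA ler_wpM2r ?invr_ge0 ?ler0n // exchange_big.
rewrite [X in _ <= _ * X]exchange_big mulr_sumr; apply: ler_sum => M mM /=.
rewrite -!natr_sum -natrM ler_nat.
apply: leq_trans (_ : \sum_(A in Str t)
  \sum_(C | overfull (2 * k) C) ((C \subset M) && (A \subset C)) <= _)%N.
  apply: leq_sum => A At; case sA: (A \subset M) => //=.
  case ov: (overlaps M A) => //; have /exists_inP[B BS /and3P[sB BA meet]] := ov.
  have [stA tA] : is_structure A /\ (#|touched A| <= k)%N.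
    by apply: allStrP; apply/bigcupP; exists t.
  have [stB tB] := allStrP BS.
  rewrite (bigD1 (A :|: B)) /=; last first.
    apply/andP; split.
      rewrite touchedU; apply: leq_trans (_ : #|touched A| + #|touched B| <= _)%N.
        by rewrite cardsU leq_subr.
      by rewrite mulSn mul1n leq_add.
    by apply: (structure_overlap mM); rewrite // 1?eq_sym.
  by rewrite subUset sA sB subsetUl.
rewrite exchange_big big_distrr; apply: leq_sum => C /andP[Ck _] /=.
case sC : (C \subset M); last by rewrite big1.
(* A given C has at most 2^|C| subsets A, and |C| is at most the number of slots at 2k vertices. *)
rewrite muln1; apply: leq_trans (_ : 2 ^ #|C| <= _)%N; last first.
  rewrite leq_exp2l //; apply: leq_trans (card_blocks_le (matching_cover mM sC)) _.
  by apply: leq_trans (card_cover_le C) _; rewrite leq_mul2l Ck orbT.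
rewrite -card_powerset -sum1_card big_mkcond [leqRHS]big_mkcond /=.
apply: leq_sum => A _; rewrite inE; case: (A \in Str t) => //=.
Qed.

Definition drop1 x t : {ffun I -> nat} := [ffun u => (x u - (u == t))%N].

Lemma drop1E x t u : drop1 x t u = (x u - (u == t))%N.
Proof. by rewrite ffunE. Qed.

(** The first summand pays for overlapping structures; the second pays for removing at most 2k
    slots, once for each expected structure. *)
Definition recursion_const : K :=
  (2 ^ (R * (2 * k)))%:R * ((2 * k).+1 * shape_bound R (2 * k))%:R +
  (shape_bound R k)%:R * (k%:R * (3 * c1 + 1)).

(** Multiplying by x_t and summing over structures A of type t, each term becomes the event that A
    occurs and the rest has counts x - e_t, up to overlaps. The rest is uniform on slightly fewer
    slots, and restoring these slots costs O([delta]). *)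
Lemma Pr_recursion t x : (0 < x t)%N ->
  (n + R * (2 * k) + 2 * k <= n * R)%N ->
  `|(x t)%:R * Pr [set: slot] (fun M => counts M == x) -
    mean_count t * Pr [set: slot] (fun M => counts M == drop1 x t)| <=
  recursion_const * delta.
Proof.
move=> xt hN; have cT : #|[set: slot]| = (n * R)%N by rewrite cardsT card_prod !card_ord.
set p := Pr _ (fun M => counts M == drop1 x t).
have -> : (x t)%:R * Pr [set: slot] (fun M => counts M == x) =
    \sum_(A in Str t) Pr [set: slot] (fun M => (A \subset M) && (counts M == x)).
  rewrite sum_counts PrE mulrA mulr_sumr [in RHS]big_mkcondr; congr (_ / _).
  apply: eq_bigr => M _; case: eqP => [->|_]; by rewrite ?mulr1 ?mulr0.
rewrite /mean_count mulr_suml -sumrB; apply: le_trans (ler_norm_sum _ _ _) _.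
apply: le_trans (_ : \sum_(A in Str t)
   (Pr [set: slot] (fun M => (A \subset M) && overlaps M A) +
    Pr [set: slot] (fun M => A \subset M) * (k%:R * ((3 * c1 + 1) * delta))) <= _).
  apply: ler_sum => A At.
  pose q := Pr [set: slot] (fun M => (A \subset M) && (counts (M :\: A) == drop1 x t)).
  apply: le_trans (ler_distD q _ _) _; apply: lerD.
    apply: Pr_dist => M mM; case sA : (A \subset M) => //=; apply: contraNT => nov.
    have cM := counts_sub mM At sA nov.
    apply/eqP; apply/eqP/eqP => [<-|/ffunP e]; apply/ffunP => u.
      by rewrite drop1E cM addnK.
    (* Here [0 < x t] is what makes the truncated subtraction in [drop1] invertible. *)
    rewrite cM e drop1E; case: eqP => [->|_]; last by rewrite subn0 addn0.
    by rewrite subn1 addn1 prednK.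
  rewrite /q (Pr_sub_del (fun M => counts M == drop1 x t) (Str_matching At) (subsetT _)) -mulrBr.
  rewrite normrM ger0_norm ?Pr_ge0 // ler_wpM2l ?Pr_ge0 // distrC.
  apply: le_trans (Pr_remove _ (subsetT _) (Str_cover At) _) _.
    by rewrite cT; have := v_le t; lia.
  rewrite ler_wpM2r ?ler_nat ?v_le // mulr_ge0 ?delta_ge0 // addr_ge0 ?ler01 //.
  by rewrite mulr_ge0 ?ler0n.
rewrite big_split /= -[X in _ + X]mulr_suml -/(mean_count t) /recursion_const [leRHS]mulrDl lerD //.
  by rewrite -[leRHS]mulrA; apply: sum_overlaps; lia.
rewrite -!mulrA ler_wpM2r //; last by apply: mean_count_le; lia.
rewrite !mulr_ge0 ?ler0n ?delta_ge0 // addr_ge0 ?ler01 //.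
by rewrite mulr_ge0 ?ler0n.
Qed.

(** Markov's inequality for the count of type t. *)
Lemma Pr_counts_tail t m : 
  m%:R * Pr [set: slot] (fun M => (m <= counts M t)%N) <= mean_count t.
Proof.
have := sum_counts t xpredT.
rewrite (eq_bigr (fun A => Pr [set: slot] (fun M => A \subset M))); last first.
  by move=> A _; apply: eq_Pr => M _; rewrite andbT.
rewrite -/(mean_count t) => ->; rewrite PrE mulrA.
rewrite ler_wpM2r ?invr_ge0 ?ler0n // mulr_sumr big_mkcondr /=; apply: ler_sum => M _.
by case: leqP => h; rewrite ?mulr1 ?mulr0 ?ler0n ?ler_nat.
Qed.

End Recursion.

(** * Copies of a pattern *)

Section Embeddings.
Variables v n R : nat.

(** The equivalence forces slots of one vertex to go to one vertex and different vertices to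
    different ones, so an embedding acts on vertices as well. *)
Definition emb : {set {ffun slot v 2 -> slot n R}} :=
  [set f : {ffun slot v 2 -> slot n R} | injectiveb f &&
     [forall x, forall y, ((f x).1 == (f y).1) == (x.1 == y.1)]].

Lemma embP (f : {ffun slot v 2 -> slot n R}) :
  reflect (injective f /\ forall x y, ((f x).1 == (f y).1) = (x.1 == y.1))
          (f \in emb).
Proof.
rewrite inE; apply: (iffP andP) => [[/injectiveP fI h]|[fI h]]; split=> //.
- by move=> x y; have /forallP/(_ x)/forallP/(_ y)/eqP := h.
- exact/injectiveP.
- by apply/forallP => x; apply/forallP => y; rewrite h.
Qed.

Definition copies (A0 : {set {set slot v 2}}) : {set {set {set slot n R}}} :=
  [set relabel f A0 | f : {ffun slot v 2 -> slot n R} in emb].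

Lemma ord2_eq (i j : 'I_2) : (i == ord0) = (j == ord0) -> i = j.
Proof. by case: i j => [[|[]] // ?] [[|[]] // ?] // _; exact: val_inj. Qed.

(** An embedding amounts to an injection of the vertices together with an ordered pair of distinct
    slots at each image vertex. *)
Lemma card_emb : #|emb| = n ^_ v * (R * R.-1) ^ v.
Proof.
pose J : {set {ffun 'I_v -> 'I_n}} :=
    [set u : {ffun 'I_v -> 'I_n} | injectiveb u].
pose D : {set 'I_R * 'I_R} := [set c | c.1 != c.2].
pose F : {set {ffun 'I_v -> 'I_R * 'I_R}} :=
    [set c : {ffun 'I_v -> 'I_R * 'I_R} in ffun_on (mem D)].
have cJ : #|J| = n ^_ v by rewrite -[v in RHS]card_ord -[n in RHS]card_ord -card_inj_ffuns.
have cD : #|D| = R * R.-1.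
  have := cardC [in [set c : 'I_R * 'I_R | c.1 == c.2]].
  have -> : #|[in [set c : 'I_R * 'I_R | c.1 == c.2]]| = R.
    rewrite -[RHS]card_ord -[RHS](card_imset _ (f := fun i : 'I_R => (i, i))).
      apply: eq_card => -[i j]; rewrite !inE /=; apply/eqP/imsetP => [->|[l _ [-> ->]] //].
      by exists j.
    by move=> i j [].
  have -> : #|[predC [in [set c : 'I_R * 'I_R | c.1 == c.2]]]| = #|D|.
    by apply: eq_card => c; rewrite !inE.
  by move: #|D| => d; rewrite card_prod !card_ord; case: (R) => [|r] /=; nia.
have cF : #|F| = (R * R.-1) ^ v by rewrite cardsE card_ffun_on cD card_ord.
rewrite -cJ -cF -cardsX.
pose g (q : {ffun 'I_v -> 'I_n} * {ffun 'I_v -> 'I_R * 'I_R}) :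
    {ffun slot v 2 -> slot n R} :=
  [ffun x => (q.1 x.1, if x.2 == ord0 then (q.2 x.1).1 else (q.2 x.1).2)].
rewrite -(card_in_imset (f := g) (D := setX J F)).
  apply: eq_card => f; apply/embP/imsetP => [[fI h]|[[u c] ucJF ->]].
    exists ([ffun i => (f (i, ord0)).1],
            [ffun i => ((f (i, ord0)).2, (f (i, ord_max)).2)]).
      rewrite !inE; apply/andP; split.
        apply/injectiveP => i j; rewrite !ffunE => /eqP; rewrite h /=.
        by move/eqP.
      apply/ffun_onP => i; rewrite !inE !ffunE /=; apply/negP => /eqP e.
      have : f (i, ord0) = f (i, ord_max).
        rewrite [LHS]surjective_pairing [RHS]surjective_pairing e; congr (_, _).
        by apply/eqP; rewrite h.
      by move/fI.
    apply/ffunP => -[i o]; rewrite !ffunE /=.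
    have [->|no] := eqVneq o ord0; first exact: surjective_pairing.
    have -> : o = ord_max by apply: ord2_eq; rewrite (negbTE no).
    rewrite [LHS]surjective_pairing; congr (_, _).
    by apply/eqP; rewrite h.
  move: ucJF; rewrite !inE /= => /andP[/injectiveP uI /ffun_onP cN]; split.
    move=> [i o] [j o']; rewrite !ffunE /= => -[/uI <-] e; congr (_, _).
    have := cN i; rewrite inE => nc; apply: ord2_eq.
    move: e; case: (o == ord0); case: (o' == ord0) => // e.
      by rewrite e eqxx in nc.
    by rewrite e eqxx in nc.
  by move=> [i o] [j o']; rewrite !ffunE /= (inj_eq uI).
move=> [u c] [u' c'] _ _ /ffunP e; congr (_, _); apply/ffunP => i.
  by have := e (i, ord0); rewrite !ffunE /= => -[].
have := e (i, ord0); have := e (i, ord_max); rewrite !ffunE /= => -[_ e1] [_ e2].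
by rewrite [LHS]surjective_pairing [RHS]surjective_pairing e1 e2.
Qed.

End Embeddings.

Section Copies.
Variables (v : nat) (A0 : {set {set slot v 2}}).
Hypothesis A0_matching : A0 \in matchings [set: slot v 2].
Hypothesis A0_connected : forall W : {set 'I_v}, W != set0 ->
  (forall b x y, b \in A0 -> x \in b -> y \in b -> x.1 \in W -> y.1 \in W) ->
  W = setT.

Let cover_A0 : cover A0 = setT.
Proof. by case/matchingsP: A0_matching. Qed.

Definition aut : {set {ffun slot v 2 -> slot v 2}} :=
  [set g in emb v v 2 | relabel g A0 == A0].

Lemma aut_gt0 : 0 < #|aut|.
Proof.
rewrite card_gt0; apply/set0Pn; exists [ffun x => x].
apply/setIdP; split; first by apply/embP; split=> [x y|x y]; rewrite !ffunE.
by rewrite relabel_fix // => x _; rewrite ffunE.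
Qed.

Section Host.
Variables n R : nat.

(** Embeddings with the same image as f0 are the f0 composed with an automorphism, uniquely: as A0
    covers all slots of the pattern, the slots hit by both embeddings coincide and f0 can be
    inverted on them. *)
Lemma card_copies : #|copies n R A0| * #|aut| = n ^_ v * (R * R.-1) ^ v.
Proof.
rewrite -card_emb -[RHS]sum1_card.
rewrite (partition_big_imset (fun f : {ffun slot v 2 -> slot n R} => relabel f A0)) /=.
rewrite -sum_nat_const; apply: eq_bigr => _ /imsetP[f0 f0E ->].
have [f0I f0h] := embP _ f0E.
pose comp (g : {ffun slot v 2 -> slot v 2}) : {ffun slot v 2 -> slot n R} :=
  [ffun x => f0 (g x)].
have relc g : relabel (comp g) A0 = relabel f0 (relabel g A0).
  rewrite relabel_comp; apply: eq_relabel => x; by rewrite ffunE.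
rewrite sum1dep_card -(card_in_imset (f := comp) (D := aut)).
  apply: eq_card => f; apply/imsetP/idP => [[g /setIdP[/embP[gI gh] /eqP gA] ->]|].
    rewrite inE relc gA eqxx andbT; apply/embP; split.
      by move=> x y; rewrite !ffunE => /f0I /gI.
    by move=> x y; rewrite !ffunE f0h gh.
  rewrite inE => /andP[/embP[fI fh] /eqP fA].
  have im x : exists y, f0 y == f x.
    have : f x \in cover (relabel f A0) by rewrite cover_relabel cover_A0 imset_f.
    rewrite fA cover_relabel => /imsetP[y _ ->]; by exists y.
  pose g : {ffun slot v 2 -> slot v 2} := [ffun x => xchoose (im x)].
  have gE x : f0 (g x) = f x by rewrite ffunE; exact/eqP/(xchooseP (im x)).
  exists g; last by apply/ffunP => x; rewrite ffunE gE.
  apply/setIdP; split.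
    apply/embP; split=> [x y e|x y]; last by rewrite -f0h !gE fh.
    by apply: fI; rewrite -!gE e.
  apply/eqP/(relabel_inj f0I); rewrite -fA -relc.
  by apply: eq_relabel => x; rewrite ffunE gE.
move=> g g' _ _ /ffunP e; apply/ffunP => x; apply: f0I.
by have := e x; rewrite !ffunE.
Qed.

Lemma copies_matching A : A \in copies n R A0 -> A \in matchings (cover A).
Proof.
move=> /imsetP[f /embP[fI _] ->]; rewrite cover_relabel cover_A0.
exact: relabel_matching.
Qed.

Lemma copies_touched A : A \in copies n R A0 -> #|touched A| = v.
Proof.
move=> /imsetP[f /embP[fI fh] ->]; rewrite /touched cover_relabel cover_A0.
rewrite -[RHS]card_ord -[RHS](card_imset _ (f := fun i => (f (i, ord0)).1)).
  apply: eq_card => u; apply/imsetP/imsetP => [[_ /imsetP[[i o] _ ->] ->]|[i _ ->]].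
    by exists i => //; apply/eqP; rewrite fh.
  by exists (f (i, ord0)) => //; exact: imset_f.
by move=> i j /eqP; rewrite fh => /eqP.
Qed.

Lemma copies_structure A : A \in copies n R A0 -> is_structure A.
Proof.
move=> /imsetP[f /embP[fI fh] ->]; split.
  move=> u; rewrite /touched cover_relabel cover_A0.
  move=> /imsetP[_ /imsetP[[i o] _ ->] ->].
  transitivity #|setX [set i] [set: 'I_2]|; last by rewrite cardsX cards1 cardsT card_ord.
  rewrite -[RHS](card_imset _ fI); apply: eq_card => s; rewrite inE.
  apply/andP/imsetP => [[/imsetP[[j o'] _ ->]]|[[j o'] jo ->]].
    by rewrite fh /= => /eqP ->; exists (i, o') => //; rewrite !inE eqxx.
  move: jo; rewrite !inE andbT => /eqP /= ->.
  by rewrite fh eqxx imset_f.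
move=> W /set0Pn[u uW] sW clW.
have touch x : (f x).1 \in touched (relabel f A0).
  by apply: mem_touched; rewrite cover_relabel cover_A0 imset_f.
pose W0 := [set i | (f (i, ord0)).1 \in W].
have W0E x : (x.1 \in W0) = ((f x).1 \in W).
  have -> : (f x).1 = (f (x.1, ord0)).1 by apply/eqP; rewrite fh.
  by rewrite inE.
have W0T : W0 = setT.
  apply: A0_connected.
    have /imsetP[s + us] := subsetP sW _ uW.
    rewrite cover_relabel => /imsetP[x _ sx]; apply/set0Pn; exists x.1.
    by rewrite W0E -sx -us.
  move=> b x y bA xb yb; rewrite !W0E; apply: (clW (f @: b)); exact: imset_f.
apply/eqP; rewrite eqEsubset sW; apply/subsetP => w /imsetP[s].
rewrite cover_relabel => /imsetP[x _ ->] ->.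
by rewrite -W0E W0T inE.
Qed.

End Host.
End Copies.

(** * Chains as explicit patterns *)

Section Chains.
Variables (o : bool) (p : nat).

(* The vertices 0, ..., p with two slots each, the right slot (i, 1) of i being
   matched with the left slot (i + 1, 0) of i + 1 modulo p + 1.  For o = true the
   block that joins p to 0 is replaced by two free slots.  Degenerate cases: a
   loop (o = false, p = 0), a double edge (o = false, p = 1), and a vertex with
   two free slots (o = true, p = 0). *)
Definition chain_partner (x : slot p.+1 2) : slot p.+1 2 :=
  if x.2 == ord0 then
    if o && (x.1 == ord0) then x else (ord_pred x.1, ord_max)
  else if o && (x.1 == ord_max) then x else (ordS x.1, ord0).

Lemma ordS_eq0 (i : 'I_p.+1) : (ordS i == ord0) = (i == ord_max).
Proof.
rewrite -!val_eqE /=; have := ltn_ord i; rewrite ltnS leq_eqVlt => /orP[/eqP ->|h].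
  by rewrite modnn !eqxx.
by rewrite modn_small // (ltn_eqF h).
Qed.

Lemma ord_pred_eq_max (i : 'I_p.+1) : (ord_pred i == ord_max) = (i == ord0).
Proof. by rewrite -ordS_eq0 ord_predK. Qed.

Lemma chain_partnerK : involutive chain_partner.
Proof.
move=> [i e]; rewrite {2}/chain_partner /=.
case: eqVneq => [->|e0]; case: ifP => h; rewrite /chain_partner /= ?eqxx /= ?h //.
- by rewrite ord_pred_eq_max h ord_predK.
- by rewrite (negbTE e0).
- rewrite ordS_eq0 h ordSK; congr (_, _).
  by apply: ord2_eq; rewrite (negbTE e0).
Qed.

Definition chain : {set {set slot p.+1 2}} :=
  [set [set x; chain_partner x] | x in [set: slot p.+1 2]].

Lemma chain_matching : chain \in matchings [set: slot p.+1 2].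
Proof. exact: matching_of_involution chain_partnerK. Qed.

Lemma chain_connected (W : {set 'I_p.+1}) : W != set0 ->
  (forall b x y, b \in chain -> x \in b -> y \in b -> x.1 \in W -> y.1 \in W) ->
  W = setT.
Proof.
move=> /set0Pn[i0 i0W] cl.
have step x : x.1 \in W -> (chain_partner x).1 \in W.
  apply: (cl [set x; chain_partner x]); first exact: imset_f.
    by rewrite !inE eqxx.
  by rewrite !inE eqxx orbT.
have up m : m <= p -> i0 <= m -> inord m \in W.
  elim: m => [|m IH] mp im.
    by move: im; rewrite leqn0 => /eqP <-; rewrite inord_val.
  move: im; rewrite leq_eqVlt => /orP[/eqP <-|]; first by rewrite inord_val.
  rewrite ltnS => im; have := step (inord m, ord_max) (IH (ltnW mp) im).
  rewrite /chain_partner /= -val_eqE /= inordK ?ltnS ?(ltnW mp) // (ltn_eqF mp) andbF.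
  suff -> : ordS (inord m) = inord m.+1 :> 'I_p.+1 by [].
  by apply: val_inj; rewrite /= !inordK ?modn_small // ?ltnS // ltnW.
have down m : m <= p -> inord (p - m) \in W.
  elim: m => [|m IH] mp; first by apply: up; rewrite ?subn0 // -ltnS.
  have := step (inord (p - m), ord0) (IH (ltnW mp)).
  rewrite /chain_partner /= -val_eqE /= inordK ?ltnS ?leq_subr // subn_eq0 leqNgt mp andbF.
  suff -> : ord_pred (inord (p - m)) = inord (p - m.+1) :> 'I_p.+1 by [].
  apply: val_inj; rewrite /= !inordK ?ltnS ?leq_subr //.
  have -> : (p - m + p.+1).-1 = p - m.+1 + p.+1 by lia.
  by rewrite modnDr modn_small // ltnS leq_subr.
apply/setP => i; rewrite inE; have := down (p - i) (leq_subr _ _).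
by rewrite subKn ?inord_val // -ltnS.
Qed.

End Chains.

(** Open chains are the ones with a free slot; with the number of touched vertices this recovers the
    type from a copy, so different types never share a copy. *)
Lemma card_block_chain (o : bool) (p n R : nat) (A : {set {set slot n R}}) :
  A \in copies n R (chain o p) -> o = [exists b in A, #|b| == 1].
Proof.
move=> /imsetP[f /embP[fI _] ->]; apply/idP/exists_inP.
  move=> ot; exists (f @: [set (ord0, ord0)]); last by rewrite imset_set1 cards1.
  rewrite mem_relabel //; apply/imsetP; exists (ord0, ord0) => //.
  by rewrite /chain_partner /= ot /= setUid.
move=> [_ /imsetP[_ /imsetP[x _ ->] ->]]; rewrite card_imset // cards2.
have [xe _|//] := eqVneq x (chain_partner o x).
case: (o) xe => //; rewrite /chain_partner /=; case: x => i e /=.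
by have [->|e0] := eqVneq e ord0 => -[_] // ee; rewrite ee in e0.
Qed.

Lemma copies_chain_inj o p o' p' n R (A : {set {set slot n R}}) :
  A \in copies n R (chain o p) -> A \in copies n R (chain o' p') ->
  (o, p) = (o', p').
Proof.
move=> A1 A2; congr (_, _).
  by rewrite (card_block_chain A1) (card_block_chain A2).
have t1 := copies_touched (chain_matching o p) A1.
by have := copies_touched (chain_matching o' p') A2; rewrite t1 => -[].
Qed.

(** * Deterministic consequences of sparseness *)

(* [lia] only identifies syntactically equal cardinals; convertible ones are
   generalized together first. *)
Ltac lia_card :=
  repeat match goal with H : context [card _] |- _ => revert H end;
  repeat match goal with |- context [card ?A] => move: (card A) => ? end;
  lia.

Section InnerEdges.
Variable n : nat.
Implicit Types (E : {set {set 'I_n}}) (W : {set 'I_n}).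

Definition inner E W : {set {set 'I_n}} := [set e in E | e \subset W].

Definition edge_rel E : rel 'I_n := fun x y => [set x; y] \in E.

Lemma edge_rel_sym E : symmetric (edge_rel E).
Proof. by move=> x y; rewrite /edge_rel setUC. Qed.

Lemma innerS E W W' : W \subset W' -> inner E W \subset inner E W'.
Proof.
move=> sW; apply/subsetP => e; rewrite !inE => /andP[-> /=] eW.
exact: subset_trans eW sW.
Qed.

Lemma inner_add_vertex E W x y : y \in W -> x \notin W -> edge_rel E y x ->
  #|inner E W| < #|inner E (x |: W)|.
Proof.
move=> yW xW yx; apply: proper_card; apply/properP; split.
  exact/innerS/subsetUr.
exists [set y; x]; rewrite inE.
  by rewrite (yx : [set y; x] \in E); apply/subsetP => z;
     rewrite !inE => /orP[]/eqP ->; rewrite ?eqxx ?yW ?orbT.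
by apply/negP => /andP[_ /subsetP/(_ x)]; rewrite !inE eqxx orbT (negbTE xW) => /(_ isT).
Qed.

(** Each new vertex on the path brings the edge by which it is reached, so edges minus vertices
    cannot drop. The additive form avoids truncated subtraction. *)
Lemma inner_add_path E W v s : path (edge_rel E) v s -> v \in W ->
  #|inner E W| + #|W :|: [set z in s]| <= #|inner E (W :|: [set z in s])| + #|W|.
Proof.
elim: s v W => [|x s IH] v W /=.
  by move=> _ _; rewrite [X in W :|: X](_ : _ = set0) ?setU0 //; apply/setP=> z; rewrite !inE.
move=> /andP[vx xs] vW.
have -> : W :|: [set z in x :: s] = (x |: W) :|: [set z in s].
  by apply/setP => z; rewrite !inE; case: (z == x); case: (z \in W); case: (z \in s).
have := IH x (x |: W) xs (setU11 _ _).
have [xW|xW] := boolP (x \in W); first by rewrite (setUidPr _) ?sub1set.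
have := inner_add_vertex vW xW vx; rewrite cardsU1 xW /=.
move: #|inner E W| #|inner E (x |: W)| #|x |: W :|: _| #|W| => a b c d.
by move: #|inner _ _| => e; lia.
Qed.

Lemma path_rev E v s : path (edge_rel E) v s ->
  path (edge_rel E) (last v s) (rev (belast v s)).
Proof.
rewrite rev_path; congr (is_true _); apply: eq_path => x y; exact: edge_rel_sym.
Qed.

Lemma last_rev_belast (v : 'I_n) s : last (last v s) (rev (belast v s)) = v.
Proof. by case: s => //= x s; rewrite rev_cons last_rcons. Qed.

Lemma mem_rev_belast (v : 'I_n) s z :
  z \in rev (belast v s) -> z \in v :: s.
Proof. by rewrite mem_rev => /mem_belast. Qed.

Lemma start_mem_rev (v : 'I_n) s : v \in last v s :: rev (belast v s).
Proof. by rewrite -{1}(last_rev_belast v s) mem_last. Qed.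

Lemma card_set_seq_le (s : seq 'I_n) : #|[set z in s]| <= size s.
Proof. by rewrite cardsE card_size. Qed.

End InnerEdges.

Section CycleIndices.
Variables n p : nat.
Implicit Types c : p.+1.-tuple 'I_n.

Lemma nth_cycle c x0 (i : 'I_p.+1) :
  nth x0 (thead c :: rcons (behead c) (thead c)) i = tnth c i /\
  nth x0 (rcons (behead c) (thead c)) i = tnth c (ordS i).
Proof.
case/tupleP: c => x s; rewrite theadE /=.
have sz : size s = p by rewrite size_tuple.
split.
  rewrite (tnth_nth x0) -rcons_cons nth_rcons /= sz ltn_ord //.
rewrite (tnth_nth x0) /= nth_rcons sz.
have := ltn_ord i; rewrite ltnS leq_eqVlt => /orP[/eqP ->|h].
  by rewrite ltnn eqxx modnn.
by rewrite h modn_small.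
Qed.

Lemma cycle_edgesE c :
  cycle_edges c = [set [set tnth c i; tnth c (ordS i)] | i : 'I_p.+1].
Proof.
have -> : cycle_edges c = path_edges (thead c) (rcons (behead c) (thead c)).
  by case/tupleP: c => x s.
have sz : size (rcons (behead c) (thead c)) = p.+1.
  by rewrite size_rcons size_behead size_tuple.
apply/setP => e; rewrite inE; apply/(nthP set0)/imsetP.
  rewrite size_pairmap sz => -[i ip <-]; exists (Ordinal ip) => //.
  rewrite (nth_pairmap (thead c)) ?sz //.
  by have [/= -> ->] := nth_cycle c (thead c) (Ordinal ip).
move=> [i _ ->]; exists i; rewrite ?size_pairmap ?sz //.
rewrite (nth_pairmap (thead c)) ?sz //.
by have [-> ->] := nth_cycle c (thead c) i.
Qed.

Lemma cycle_tnth (e : rel 'I_n) c :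
  reflect (forall i, e (tnth c i) (tnth c (ordS i))) (cycle e c).
Proof.
have -> : cycle e c = path e (thead c) (rcons (behead c) (thead c)).
  by case/tupleP: c => x s.
have sz : size (rcons (behead c) (thead c)) = p.+1.
  by rewrite size_rcons size_behead size_tuple.
apply: (iffP (pathP (thead c))) => h i.
  have := h i; rewrite sz; have [-> ->] := nth_cycle c (thead c) i; exact.
rewrite sz => ip; have := h (Ordinal ip).
by have [/= <- <-] := nth_cycle c (thead c) (Ordinal ip).
Qed.

Lemma ordSS_neq (i : 'I_p.+1) : 1 < p -> ordS (ordS i) != i.
Proof.
move=> p1; rewrite -val_eqE /=; have := ltn_ord i.
rewrite ltnS leq_eqVlt => /orP[/eqP ->|h].
  by rewrite modnn modn_small //; lia.
rewrite (modn_small (m := i.+1)) //.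
move: h; rewrite leq_eqVlt => /orP[/eqP h|h]; first by rewrite h modnn eq_sym -lt0n; lia.
by rewrite modn_small; lia.
Qed.

(** At least three vertices are required: with two, both indices give the same edge. *)
Lemma cycle_edges_inj (u : 'I_p.+1 -> 'I_n) : 1 < p -> injective u ->
  injective (fun i => [set u i; u (ordS i)]).
Proof.
move=> p1 uI i j e; have : u i \in [set u j; u (ordS j)] by rewrite -e !inE eqxx.
rewrite !inE !(inj_eq uI) => /orP[/eqP //|/eqP ij].
have : u (ordS i) \in [set u j; u (ordS j)] by rewrite -e !inE eqxx orbT.
rewrite !inE !(inj_eq uI) => /orP[/eqP|/eqP /ordS_inj //].
by rewrite ij => /eqP; rewrite (negbTE (ordSS_neq j p1)).
Qed.

Lemma cover_cycle_edges c : cover (cycle_edges c) = [set z in c].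
Proof.
rewrite cycle_edgesE; apply/setP => z; rewrite inE; apply/bigcupP/idP.
  move=> [_ /imsetP[i _ ->]]; rewrite !inE => /orP[]/eqP ->; exact: mem_tnth.
move=> /tnthP[i ->]; exists [set tnth c i; tnth c (ordS i)]; first exact: imset_f.
by rewrite !inE eqxx.
Qed.

End CycleIndices.

Section GraphFacts.
Variables (n : nat) (G : graph n).
Implicit Types W U : {set 'I_n}.

Lemma card_edge e : e \in edges G -> #|e| = 2.
Proof. by case: G => E /= /forall_inP h /h /eqP. Qed.

Lemma adj_irr x : ~~ adj G x x.
Proof. by apply/negP => /card_edge; rewrite setUid cards1. Qed.

Lemma adj_neq x y : adj G x y -> x != y.
Proof. by apply: contraTneq => ->; exact: adj_irr. Qed.

Lemma adj_sym x y : adj G x y = adj G y x.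
Proof. by rewrite /adj setUC. Qed.

Definition deg_in W v : nat := #|[set w in W | adj G v w]|.

Lemma deg_in_edges W v : v \in W -> deg_in W v = #|[set e in inner (edges G) W | v \in e]|.
Proof.
move=> vW; rewrite /deg_in -(card_imset _ (f := fun w => [set v; w]) (@pair_inj _ v)).
apply: eq_card => e; apply/imsetP/idP => [[w]|].
  rewrite inE => /andP[wW vw] ->; rewrite !inE eqxx (vw : [set v; w] \in _) /=.
  by rewrite andbT; apply/subsetP => z; rewrite !inE => /orP[]/eqP ->.
rewrite !inE => /andP[/andP[eE eW] ve].
have /eqP/cards2P[x [y [xy exy]]] := card_edge eE.
have [w ew] : exists w, e = [set v; w].
  move: ve; rewrite exy !inE => /orP[/eqP ->|/eqP ->]; first by exists y.
  by exists x; rewrite setUC.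
exists w => //; rewrite inE (subsetP eW) ?ew ?inE ?eqxx ?orbT //=.
by rewrite /adj -ew.
Qed.

Lemma sum_deg_in W : \sum_(v in W) deg_in W v = 2 * #|inner (edges G) W|.
Proof.
rewrite (eq_bigr (fun v => \sum_(e in inner (edges G) W) (v \in e : nat))); last first.
  move=> v vW; rewrite deg_in_edges // -sum1_card big_mkcond [RHS]big_mkcond /=.
  by apply: eq_bigr => e _; rewrite inE; case: (e \in inner _ _); case: (v \in e).
rewrite exchange_big mulnC -sum_nat_const; apply: eq_bigr => e.
rewrite inE => /andP[eE eW]; rewrite -(card_edge eE) -sum1_card big_mkcond /=.
rewrite [RHS]big_mkcond /=; apply: eq_bigr => v _.
by case ve: (v \in e); case vW: (v \in W) => //; rewrite (subsetP eW _ ve) in vW.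
Qed.

Lemma card_cycle_edges p c : is_cycle G p c -> #|cycle_edges c| = p.
Proof.
move=> /and4P[p2 /eqP sz cyc uc]; case: p p2 sz => // p p2 sz.
pose t : p.+1.-tuple 'I_n := tcast sz (in_tuple c).
have -> : c = t by rewrite val_tcast.
rewrite cycle_edgesE card_imset ?card_ord //.
apply: (@cycle_edges_inj n p (tnth t)); first by rewrite -ltnS.
by apply/tuple_uniqP; rewrite val_tcast.
Qed.

Lemma cycle_edges_sub p c : is_cycle G p c -> cycle_edges c \subset edges G.
Proof.
move=> /and4P[p2 /eqP sz cyc uc]; case: p p2 sz => // p p2 sz.
pose t : p.+1.-tuple 'I_n := tcast sz (in_tuple c).
have ct : c = t by rewrite val_tcast.
rewrite ct cycle_edgesE; apply/subsetP => _ /imsetP[i _ ->].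
by move: i; apply/(cycle_tnth (adj G)); rewrite -ct.
Qed.

Lemma cyclesP p C : C \in cycles G p ->
  exists2 c, is_cycle G p c & C = cycle_edges c /\ cover C = [set z in c].
Proof.
move=> /imsetP[c + ->]; rewrite inE => cP; exists c => //; split=> //.
by case: p c cP => [|p] c // _; rewrite cover_cycle_edges.
Qed.

Lemma card_cycle p c : is_cycle G p c -> #|[set z in c]| = p.
Proof. by move=> /and4P[_ /eqP <- _ uc]; rewrite cardsE; apply/card_uniqP. Qed.

Lemma cover_cycle p c : is_cycle G p c -> cover (cycle_edges c) = [set z in c].
Proof.
move=> /and4P[p2 /eqP sz _ _]; case: p p2 sz => // p _ sz.
pose t : p.+1.-tuple 'I_n := tcast sz (in_tuple c).
have ct : c = t by rewrite val_tcast.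
by rewrite ct cover_cycle_edges; apply/setP => z; rewrite !inE.
Qed.

Lemma inner_cycle p c W : is_cycle G p c -> [set z in c] \subset W ->
  cycle_edges c \subset inner (edges G) W.
Proof.
move=> cP sW; apply/subsetP => e ec; rewrite inE (subsetP (cycle_edges_sub cP)) //=.
apply: subset_trans sW; rewrite -(cover_cycle cP).
exact: bigcup_sup.
Qed.

End GraphFacts.

Section Sparse.
Variables (n R : nat) (G : graph n).
Implicit Types W U : {set 'I_n}.

Definition sparse (K : nat) : bool :=
  [forall W : {set 'I_n}, (#|W| <= K) ==>
     (2 * #|inner (edges G) W| + \sum_(v in W) (R - deg G v) <= 2 * #|W|)].

Lemma sparseP K : reflect (forall W, #|W| <= K ->
     2 * #|inner (edges G) W| + \sum_(v in W) (R - deg G v) <= 2 * #|W|) (sparse K).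
Proof. by apply: (iffP forallP) => h W; apply/implyP; exact: h. Qed.

Lemma sparse_no_dense_subgraph k : sparse k -> no_dense_subgraph G k.
Proof.
move=> /sparseP sp p pk [U [F [/andP[FE /forall_inP FU] cU cF]]].
have := sp U; rewrite cU => /(_ pk).
have : #|F| <= #|inner (edges G) U|.
  by apply: subset_leq_card; apply/subsetP => e eF; rewrite inE (subsetP FE) // FU.
lia_card.
Qed.

(** A cycle with a path attached has at least as many edges as vertices, so the free slot at v
    exceeds the bound. Cycle and path contribute at most k vertices each. *)
Lemma sparse_near_cycle k : sparse (2 * k) -> no_deficient_near_cycle G R k.
Proof.
move=> /sparseP sp p q pk qk [v [w [C [dv [s /and4P[_ /eqP sz ps _] lw]]]]].
move=> /cyclesP[c cP [_ ->]]; rewrite inE => wc.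
have cq := card_cycle cP.
(* The path is reversed so that it starts on the cycle. *)
have := inner_add_path (path_rev ps) (W := [set z in c]).
rewrite inE lw wc => /(_ isT); set W := _ :|: _ => hW.
have := sp W; have : #|W| <= 2 * k.
  apply: leq_trans (_ : #|[set z in c]| + #|[set z in rev (belast v s)]| <= _).
    by rewrite cardsU leq_subr.
  rewrite cq mul2n -addnn leq_add //.
  by apply: leq_trans (card_set_seq_le _) _; rewrite size_rev size_belast sz.
have ce := card_cycle_edges cP.
have := subset_leq_card (inner_cycle cP (subxx _)); rewrite ce.
have vW : v \in W.
  have := start_mem_rev v s; rewrite lw !inE => /orP[/eqP ->|->]; by rewrite ?wc ?orbT.
rewrite (bigD1 v vW) /=; move=> h1 h2 /(_ h2); lia_card.
Qed.

Lemma path_at_mostP k v w : path_at_most G k v w ->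
  exists s, [/\ size s <= k, path (adj G) v s & last v s = w].
Proof.
move=> [p pk [s /and4P[_ /eqP sz ps _] lw]]; exists s; split=> //.
by rewrite sz.
Qed.

(** The path has at least |W| - 1 inner edges, and the two ends have at least 1 + 2 free slots, one
    more than allowed. *)
Lemma sparse_close_pair k :
  2 <= R -> sparse (2 * k + 1) -> no_close_deficient_pair G R k.
Proof.
move=> R2 /sparseP sp [v [w [vw dv dw /path_at_mostP[s [sz ps lw]]]]].
have := inner_add_path ps (set11 v); rewrite cards1; set W := _ :|: _ => hW.
have := sp W; have : #|W| <= 2 * k + 1.
  apply: leq_trans (_ : #|[set v]| + #|[set z in s]| <= _).
    by rewrite cardsU leq_subr.
  rewrite cards1; have := card_set_seq_le s; lia_card.
have vW : v \in W by rewrite !inE eqxx.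
have wW : w \in W.
  by have := mem_last v s; rewrite lw !inE.
rewrite (bigD1 v vW) /= (bigD1 w) /=; last first.
  by apply/andP; split; [exact: wW|rewrite eq_sym; exact/eqP].
move=> h2 /(_ h2); lia_card.
Qed.

(** Two paths from the first vertex suffice: their union has at least |W| - 1 edges and at most 2k +
    1 vertices, and three deficient vertices are one too many. *)
Lemma sparse_close_triple k :
  2 <= R -> sparse (2 * k + 1) -> no_close_deficient_triple G R k.
Proof.
move=> R2 /sparseP sp [v [vI dv /= hv]].
pose i0 : 'I_3 := ord0; pose i1 : 'I_3 := Ordinal (isT : 1 < 3).
pose i2 : 'I_3 := Ordinal (isT : 2 < 3).
have /path_at_mostP[s [sz ps lw]] := hv i0 i1 (fun e => ltac:(by [])).
have /path_at_mostP[t [tz pt lt]] := hv i0 i2 (fun e => ltac:(by [])).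
have := inner_add_path ps (set11 (v i0)); rewrite cards1; set W1 := _ :|: _ => hW1.
have v0W : v i0 \in W1 by rewrite !inE eqxx.
have := inner_add_path pt v0W; set W := _ :|: _ => hW.
have := sp W; have : #|W| <= 2 * k + 1.
  apply: leq_trans (_ : #|[set v i0]| + #|[set z in s]| + #|[set z in t]| <= _).
    apply: leq_trans (_ : #|W1| + #|[set z in t]| <= _).
      by rewrite cardsU leq_subr.
    by rewrite leq_add2r cardsU leq_subr.
  rewrite cards1; have := card_set_seq_le s; have := card_set_seq_le t; lia_card.
have v0 : v i0 \in W by rewrite !inE eqxx.
have v1 : v i1 \in W.
  by have := mem_last (v i0) s; rewrite lw !inE => ->.
have v2 : v i2 \in W.
  by have := mem_last (v i0) t; rewrite lt !inE => /orP[->|->]; rewrite ?orbT.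
rewrite (bigD1 (v i0)) //= (bigD1 (v i1)) /=; last first.
  by apply/andP; split; [exact: v1|rewrite (inj_eq vI)].
rewrite (bigD1 (v i2)) /=; last first.
  by rewrite !(inj_eq vI) !andbT; exact: v2.
have := dv i0; have := dv i1; have := dv i2.
move=> ? ? ? h2 /(_ h2); lia_card.
Qed.

(** All edges at a vertex of a component are inner, so inner and missing degree add up to R there,
    and R > 2 contradicts sparseness. *)
Lemma sparse_small_component k :
  2 < R -> sparse k -> (forall v, deg G v <= R) -> ~ has_small_component G k.
Proof.
move=> R3 /sparseP sp dR [v cv].
have := sp _ cv; rewrite -sum_deg_in -big_split /=.
have v_in : v \in component G v by rewrite inE connect0.
rewrite (eq_bigr (fun _ => R)); last first.
  move=> w; rewrite inE => vw; suff -> : deg_in G (component G v) w = deg G w.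
    by rewrite subnKC.
  apply: eq_card => u; rewrite !inE; case wu: (adj G w u); rewrite ?andbF // andbT.
  exact: connect_trans vw (connect1 wu).
rewrite sum_nat_const leqNgt mulnC ltn_pmul2l //.
  by rewrite R3.
by rewrite card_gt0; apply/set0Pn; exists v.
Qed.

End Sparse.

(** * Two short cycles near each other *)

Section CloseCycles.
Variables (n : nat) (G : graph n).

(** Stop at the first vertex in Y: every edge used before starts outside Y. *)
Lemma path_to_set E (Y : {set 'I_n}) v s : path (edge_rel E) v s ->
  last v s \in Y ->
  exists s', [/\ path (edge_rel (E :\: [set e : {set 'I_n} | e \subset Y])) v s',
                 last v s' \in Y & size s' <= size s].
Proof.
elim: s v => [|x s IH] v /=; first by exists [::].
move=> /andP[vx xs] lY; have [vY|vY] := boolP (v \in Y); first by exists [::].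
have [s' [ps' ls' ss']] := IH x xs lY; exists (x :: s'); split=> //=.
rewrite ps' andbT /edge_rel inE (vx : [set v; x] \in E) andbT inE.
by apply: contra vY => /subsetP; apply; rewrite !inE eqxx.
Qed.

Lemma iter_ordS p (i : 'I_p.+1) m : iter m (@ordS _) i = (i + m) %% p.+1 :> nat.
Proof.
elim: m => [|m IH] /=; first by rewrite addn0 modn_small.
by rewrite IH -addn1 modnDml addn1 addnS.
Qed.

Lemma iter_ordS_onto p (i j : 'I_p.+1) : exists2 m, m <= p & iter m (@ordS _) i = j.
Proof.
exists ((j + (p.+1 - i)) %% p.+1); first by rewrite -ltnS ltn_mod.
apply: val_inj; rewrite /= iter_ordS modnDmr addnCA subnKC; last exact: ltnW.
by rewrite modnDr modn_small.
Qed.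

Lemma cycle_minus_edge p c e : is_cycle G p c -> e \in cycle_edges c ->
  exists y t, path (edge_rel (edges G :\ e)) y t /\ y :: t =i c.
Proof.
move=> cP; have := cycle_edges_sub cP.
move: cP => /and4P[p2 /eqP sz cyc uc]; case: p p2 sz => // p p2 sz.
pose t : p.+1.-tuple 'I_n := tcast sz (in_tuple c).
have ct : c = t by rewrite val_tcast.
have tI : injective (tnth t) by apply/tuple_uniqP; rewrite -ct.
rewrite ct cycle_edgesE => sE /imsetP[i _ ei].
pose y m := tnth t (iter m (@ordS _) (ordS i)).
exists (y 0), (mkseq (fun m => y m.+1) p); split; last first.
  move=> z; apply/idP/tnthP => [|[j ->]].
    by rewrite in_cons => /orP[/eqP ->|/mapP[m _ ->]]; eexists.
  have [[|m] mp <-] := iter_ordS_onto (ordS i) j; first by rewrite mem_head.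
  by rewrite in_cons; apply/orP; right; apply/mapP; exists m; rewrite ?mem_iota.
have yE m : [set y m; y m.+1] =
    (fun j => [set tnth t j; tnth t (ordS j)]) (iter m (@ordS _) (ordS i)) by [].
apply/(pathP (y 0)) => m; rewrite size_mkseq => mp.
have -> : nth (y 0) (y 0 :: mkseq (fun m => y m.+1) p) m = y m.
  by case: m mp => // m mp; rewrite /= nth_mkseq // ltnW.
rewrite nth_mkseq // /edge_rel yE !inE ei; apply/andP; split; last first.
  by apply: (subsetP sE); apply/imsetP; eexists.
(* The walk starts just after the deleted edge; meeting it again would require m + 1 to be divisible
   by p + 1, but m < p. *)
rewrite (inj_eq (cycle_edges_inj (u := tnth t) p2 tI)) -val_eqE /= iter_ordS /=.
rewrite modnDml; apply/negP => /eqP e0.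
have := e0; rewrite -[RHS in _ = RHS](modn_small (ltn_ord i)) addSnnS.
move/eqP; rewrite -[X in _ == X %[mod _]]addn0 eqn_modDl mod0n modn_small //.
Qed.

(** Without e, start from the cycle c, which has as many edges as vertices, and attach the
    connecting path and then the opened cycle d. Edges still number at least as many as vertices;
    putting e back makes them more. *)
Lemma close_cycles_many_edges p1 p2 p3 k c d v s e :
  is_cycle G p1 c -> is_cycle G p2 d -> e \in cycle_edges d ->
  e \notin cycle_edges c -> path (adj G) v s -> size s = p3 ->
  v \in c -> last v s \in d -> p1 + p2 + p3 <= k ->
  ~ no_dense_subgraph G k.
Proof.
move=> cP dP ed ec ps sz vc wd le_k nd.
have ls : last v s \in [set z in d] by rewrite inE.
have [s1 [ps1 ls1 ss1]] := path_to_set ps ls.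
set E' := edges G :\ e.
have eE : e \in edges G by apply: (subsetP (cycle_edges_sub dP)).
have ed' : e \subset [set z in d] by rewrite -(cover_cycle dP); exact: bigcup_sup.
have ps1' : path (edge_rel E') v s1.
  apply: sub_path ps1 => x y; rewrite /edge_rel !inE => /andP[+ ->]; rewrite andbT.
  by apply: contra => /eqP ->.
have [y [t [pt yt]]] := cycle_minus_edge dP ed.
pose C := [set z in c]; have vC : v \in C by rewrite inE.
have := inner_add_path ps1' vC; set W1 := _ :|: _ => h1.
have wW1 : last v s1 \in W1 by have := mem_last v s1; rewrite !inE => /orP[/eqP ->|->]; rewrite ?vc ?orbT.
have : last v s1 \in y :: t by rewrite yt; move: ls1; rewrite inE.
(* The connecting path may arrive in the middle of the opened cycle, which is therefore attached as
   two paths leaving the arrival vertex. *)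
move=> yin; case/splitPl: t / yin pt yt => t1 t2 lt1.
rewrite cat_path lt1 => /andP[pt1 pt2] yt.
have := inner_add_path (path_rev pt1); rewrite lt1 => /(_ _ wW1).
set W2 := _ :|: _ => h2.
have wW2 : last v s1 \in W2 by rewrite inE wW1.
have := inner_add_path pt2 wW2; set W := _ :|: _ => h3.
have dW : [set z in d] \subset W.
  apply/subsetP => z; rewrite inE -yt -cat_cons mem_cat => /orP[zt|zt].
    have : z \in last v s1 :: rev (belast y t1).
      by rewrite -lt1 in_cons mem_rev -in_cons -mem_rcons -lastI.
    rewrite in_cons => /orP[/eqP ->|zr]; first by rewrite inE wW2.
    by rewrite !inE zr !orbT.
  by rewrite !inE zt !orbT.
have WU : W \subset C :|: [set z in s1] :|: [set z in d].
  apply/subsetP => z; rewrite !inE -yt -cat_cons mem_cat.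
  move=> /orP[/orP[->//|]|->]; rewrite ?orbT //.
  by move=> /mem_rev_belast ->; rewrite !orbT.
have cW : #|W| <= k.
  apply: leq_trans (subset_leq_card WU) _.
  apply: leq_trans (leq_card_setU _ _) _.
  apply: leq_trans (leq_add (leq_card_setU _ _) (leqnn _)) _.
  rewrite (card_cycle cP) (card_cycle dP); apply: leq_trans le_k.
  rewrite [leqRHS]addnAC leq_add2r leq_add2l -sz.
  exact: leq_trans (card_set_seq_le _) ss1.
have CE : #|C| <= #|inner E' C|.
  rewrite (card_cycle cP) -(card_cycle_edges cP); apply: subset_leq_card.
  apply/subsetP => f fc; have := subsetP (inner_cycle cP (subxx _)) f fc.
  rewrite !inE => /andP[-> ->]; rewrite !andbT.
  by apply: contraNneq ec => <-.
apply: (nd #|W| cW); exists W, (inner (edges G) W); split=> //.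
  apply/andP; split; first by apply/subsetP => f; rewrite inE => /andP[].
  by apply/forall_inP => f; rewrite inE => /andP[].
rewrite (cardsD1 e) inE eE (subset_trans ed' dW) /=.
have -> : inner (edges G) W :\ e = inner E' W.
  by apply/setP => f; rewrite !inE andbA.
move: CE h1 h2 h3; clearbody W W2 W1 C; clear; lia_card.
Qed.

(** Of two different cycles one has an edge outside the other; if it is the first cycle, the roles
    are exchanged and the path is reversed. *)
Lemma no_dense_no_close_cycles k : no_dense_subgraph G k -> no_close_cycles G k.
Proof.
move=> nd p1 p2 p3 _ _ le_k [C [D [/cyclesP[c cP [eC cC]] /cyclesP[d dP [eD cD]] CD]]].
move=> [v [w [vC wD [s /and4P[_ /eqP sz ps _] lw]]]].
rewrite cC inE in vC; rewrite cD inE in wD.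
have [DC|/subsetPn[e eD' eC']] := boolP (D \subset C); last first.
  apply: (close_cycles_many_edges cP dP _ _ ps sz vC _ le_k nd (e := e)).
  - by rewrite -eD.
  - by rewrite -eC.
  - by rewrite lw.
have [CD'|/subsetPn[e eC' eD']] := boolP (C \subset D).
  by case: CD; apply/eqP; rewrite eqEsubset CD'.
apply: (close_cycles_many_edges dP cP _ _ (path_rev ps) (e := e) (k := k) (p3 := p3)) nd.
- by rewrite -eC.
- by rewrite -eD.
- by rewrite size_rev size_belast.
- by rewrite lw.
- by rewrite last_rev_belast.
- by rewrite addnAC addnC addnA addnAC -addnA addnC; lia.
Qed.

(** The edge from v to its successor on the cycle is a 1-path to a vertex of the cycle. *)
Lemma near_cycle_on_cycle R k : 0 < k ->
  no_deficient_near_cycle G R k -> no_deficient_on_cycle G R k.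
Proof.
move=> k0 near q qk [v [C [dv CP vC]]]; apply: (near 1 q k0 qk).
have [c cP [_ cC]] := cyclesP CP.
case/and4P: (cP) => _ _ cyc uc.
have vc : v \in c by rewrite cC inE in vC.
have av : adj G v (next c v) by apply: next_cycle.
exists v, (next c v), C; split=> //; last by rewrite cC inE mem_next.
exists [:: next c v] => //.
by rewrite /is_path /= av inE (adj_neq av).
Qed.

End CloseCycles.

(** * From matchings to graphs *)

Section Partner.
Variable P : finType.
Implicit Types (M : {set {set P}}) (x y : P).

Definition partner M x : P := odflt x [pick d | [set x; d] \in M].

Variable M : {set {set P}}.
Hypothesis mM : M \in matchings [set: P].

Lemma mem_partner x : [set x; partner M x] \in M.
Proof.
rewrite /partner; case: pickP => [d //|no].
by have [d _] := matching_block mM (in_setT x); rewrite no.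
Qed.

Lemma partnerE x d : [set x; d] \in M -> partner M x = d.
Proof.
move=> xd; have [_ tM _] := matchingsP _ _ mM.
apply: (@pair_inj _ x); apply: (trivIset_eq tM (mem_partner x) xd (x := x));
by rewrite !inE eqxx.
Qed.

Lemma partnerK : involutive (partner M).
Proof. by move=> x; apply: partnerE; rewrite setUC mem_partner. Qed.

Lemma block_partner b x : b \in M -> x \in b -> b = [set x; partner M x].
Proof.
move=> bM xb; have [_ tM _] := matchingsP _ _ mM.
by apply: (trivIset_eq tM bM (mem_partner x) xb); rewrite !inE eqxx.
Qed.

Lemma block_nonempty b : b \in M -> exists x, x \in b.
Proof.
have [_ _ h] := matchingsP _ _ mM.
by move=> /h/andP[+ _]; rewrite card_gt0 => /set0Pn.
Qed.

Lemma free_block x : ([set x] \in M) = (partner M x == x).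
Proof.
apply/idP/eqP => [xM|px]; first by apply: partnerE; rewrite setUid.
by have := mem_partner x; rewrite px setUid.
Qed.

End Partner.

Lemma partner_involution (P : finType) (phi : P -> P) (phiK : involutive phi) :
  partner [set [set x; phi x] | x in [set: P]] =1 phi.
Proof.
move=> x; apply: partnerE; first exact: matching_of_involution.
exact: imset_f.
Qed.

Lemma matching_ext (P : finType) (M M' : {set {set P}}) :
  M \in matchings [set: P] -> M' \in matchings [set: P] ->
  partner M =1 partner M' -> M = M'.
Proof.
move=> mM mM' e; apply/setP => b; apply/idP/idP => bM.
  have [x xb] := block_nonempty mM bM.
  by rewrite (block_partner mM bM xb) e mem_partner.
have [x xb] := block_nonempty mM' bM.
by rewrite (block_partner mM' bM xb) -e mem_partner.
Qed.

Lemma graph_eq n (G G' : graph n) : adj G =2 adj G' -> G = G'.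
Proof.
move=> e; apply/val_inj/setP => f /=; apply/idP/idP => fG.
  have /eqP/cards2P[x [y [_ xy]]] := card_edge fG.
  by move: fG; rewrite xy -[_ \in _]/(adj G x y) e.
have /eqP/cards2P[x [y [_ xy]]] := card_edge fG.
by move: fG; rewrite xy -[_ \in _]/(adj G' x y) -e.
Qed.

Section Projection.
Variables n R : nat.
Local Notation slot := (slot n R).
Implicit Types (M : {set {set slot}}).

Definition graph_edges M : {set {set 'I_n}} :=
  [set e in [set [set x.1 | x in (b : {set slot})] | b in M] | #|e| == 2].

Lemma graph_edgesP M : [forall e in graph_edges M, #|e| == 2].
Proof. by apply/forall_inP => e; rewrite inE => /andP[]. Qed.

Definition graph_of M : graph n := Graph (graph_edgesP M).

Definition free M (v : 'I_n) : nat :=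
  #|[set x : slot | (x.1 == v) && (partner M x == x)]|.

(** The first clause excludes loops, the second multiple edges; a free slot is its own partner and
    is compatible with both. *)
Definition simple M : bool :=
  [forall x : slot, ((partner M x).1 == x.1) ==> (partner M x == x)] &&
  [forall x : slot, forall y : slot,
    [&& x.1 == y.1, (partner M x).1 == (partner M y).1 & (partner M x).1 != x.1]
      ==> (x == y)].

Definition weight M : nat := \prod_(v < n) (free M v)`!.

Section Fixed.
Variable M : {set {set slot}}.
Hypothesis mM : M \in matchings [set: slot].

Lemma simpleP : reflect
  ((forall x : slot, (partner M x).1 = x.1 -> partner M x = x) /\
   (forall x y : slot, x.1 = y.1 -> (partner M x).1 = (partner M y).1 ->
      (partner M x).1 <> x.1 -> x = y)) (simple M).
Proof.
apply: (iffP andP) => -[h1 h2]; split.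
- by move=> x e; apply/eqP; have /forallP/(_ x)/implyP := h1; apply; apply/eqP.
- move=> x y xy pxy px; apply/eqP.
  have /forallP/(_ x)/forallP/(_ y)/implyP := h2; apply.
  by rewrite xy pxy !eqxx /= -xy -pxy; apply/eqP.
- by apply/forallP => x; apply/implyP => /eqP /h1 ->.
- apply/forallP => x; apply/forallP => y; apply/implyP.
  by move=> /and3P[/eqP xy /eqP pxy /eqP px]; apply/eqP; exact: h2.
Qed.

Lemma adj_graph_of v w : reflect
  (v != w /\ exists2 x : slot, x.1 = v & (partner M x).1 = w)
  (adj (graph_of M) v w).
Proof.
rewrite /adj inE; apply: (iffP andP).
  move=> [/imsetP[b bM e]]; rewrite cards2; case: (eqVneq v w) => // vw _; split=> //.
  have : v \in [set v; w] by rewrite !inE eqxx.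
  rewrite e => /imsetP[x xb vx]; exists x => //.
  have : w \in [set v; w] by rewrite !inE eqxx orbT.
  rewrite e => /imsetP[y yb wy].
  move: yb; rewrite (block_partner mM bM xb) !inE => /orP[/eqP yx|/eqP <- //].
  by move: vw; rewrite vx wy yx eqxx.
move=> [vw [x xv pw]]; rewrite cards2 vw; split=> //.
apply/imsetP; exists [set x; partner M x]; first exact: mem_partner.
by rewrite imsetU !imset_set1 xv pw.
Qed.

(** The matched slots correspond to the neighbours in W because there are no loops or multiple
    edges; the free ones count because they are their own partners and v lies in W. *)
Lemma card_slots_into (W : {set 'I_n}) v : simple M -> v \in W ->
  #|[set x : slot | (x.1 == v) && ((partner M x).1 \in W)]| =
  deg_in (graph_of M) W v + free M v.
Proof.
move=> /simpleP[s1 s2] vW.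
rewrite -(cardsID [set x : slot | partner M x == x]) addnC; congr (_ + _).
  rewrite /deg_in -(card_in_imset (f := fun x : slot => (partner M x).1)).
    apply: eq_card => w; apply/imsetP/idP => [[x]|].
      rewrite !inE => /andP[px /andP[/eqP xv pW]] ->; rewrite pW /=.
      apply/adj_graph_of; split; last by exists x.
      by apply: contraNneq px => e; apply/eqP; apply: s1; rewrite -e xv.
    rewrite inE => /andP[wW /adj_graph_of[vw [x xv pw]]]; exists x => //.
    rewrite !inE xv eqxx pw wW !andbT.
    by apply: contraNneq vw => px; rewrite -xv -pw px.
  move=> x y; rewrite !inE => /andP[px /andP[/eqP xv _]] /andP[_ /andP[/eqP yv _]] e.
  apply: s2 => //; first by rewrite xv yv.
  by move=> /s1 /eqP; rewrite (negbTE px).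
apply: eq_card => x; rewrite !inE.
have [->|_] := eqVneq (partner M x) x; rewrite ?andbF ?andbT //.
by case: (eqVneq x.1 v) => //= ->; rewrite vW.
Qed.

Lemma card_slots_vertex (v : 'I_n) : #|[set x : slot | x.1 == v]| = R.
Proof.
transitivity #|setX [set v] [set: 'I_R]|.
  by apply: eq_card => -[w i]; rewrite !inE andbT.
by rewrite cardsX cards1 cardsT card_ord mul1n.
Qed.

Lemma deg_free v : simple M -> deg (graph_of M) v + free M v = R.
Proof.
move=> sM; rewrite -[RHS](card_slots_vertex v).
transitivity (deg_in (graph_of M) setT v + free M v).
  by congr (_ + _); apply: eq_card => w; rewrite !inE.
rewrite -card_slots_into ?inE //.
by apply: eq_card => x; rewrite !inE andbT.
Qed.

Lemma graph_of_bounded : simple M -> graph_of M \in bounded_graphs n R.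
Proof.
by move=> sM; rewrite inE; apply/forallP => v; rewrite -[X in _ <= X](deg_free v sM) leq_addr.
Qed.

(** If W violates sparseness, then the blocks lying over W cover exactly as many slots as the left
    side of the inequality counts, so they form an overfull set. *)
Lemma sparse_graph_of K : simple M ->
  ~~ [exists A : {set {set slot}}, overfull K A && (A \subset M)] ->
  sparse R (graph_of M) K.
Proof.
move=> sM nd; apply/sparseP => W cW; rewrite leqNgt; apply: contra nd => lt2.
pose C := [set b in M | [set x.1 | x in (b : {set slot})] \subset W].
have tC : touched C \subset W.
  apply/subsetP => v /imsetP[x /bigcupP[b]]; rewrite inE => /andP[_ /subsetP bW] xb ->.
  by apply: bW; exact: imset_f.
have CM : C \subset M by apply/subsetP => b; rewrite inE => /andP[].
have coverC : cover C = [set x : slot | (x.1 \in W) && ((partner M x).1 \in W)].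
  apply/setP => x; rewrite inE; apply/bigcupP/andP.
    move=> [b]; rewrite inE => /andP[bM /subsetP bW] xb.
    split; apply: bW; apply: imset_f => //.
    by rewrite (block_partner mM bM xb) !inE eqxx orbT.
  move=> [xW pW]; exists [set x; partner M x]; last by rewrite !inE eqxx.
  rewrite inE mem_partner //=; apply/subsetP => v /imsetP[y].
  by rewrite !inE => /orP[]/eqP -> ->.
have cC : #|cover C| =
    2 * #|inner (edges (graph_of M)) W| + \sum_(v in W) (R - deg (graph_of M) v).
  rewrite -sum_deg_in -big_split /= coverC -sum1_card.
  rewrite (partition_big (fun x : slot => x.1) [in W]) /=; last first.
    by move=> x; rewrite inE => /andP[].
  apply: eq_bigr => v vW; rewrite sum1dep_card.
  have -> : R - deg (graph_of M) v = free M v.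
    by rewrite -[X in X - _](deg_free v sM) addKn.
  rewrite -card_slots_into //; apply: eq_card => x; rewrite !inE.
  by case: (eqVneq x.1 v) => [->|]; rewrite ?andbF // vW andbT.
apply/existsP; exists C; rewrite CM andbT /overfull.
rewrite (leq_trans (subset_leq_card tC) cW) /= cC.
by apply: leq_ltn_trans lt2; rewrite leq_mul2l subset_leq_card.
Qed.

End Fixed.

Lemma card_slot_injections (T : finType) (B : {set T}) (r0 : 'I_R) :
  #|[set h : {ffun T -> 'I_R} |
      [forall w, (w \notin B) ==> (h w == r0)] && dinjectiveb h B]| = R ^_ #|B|.
Proof.
pose D := {w : T | w \in B}.
have <- : #|[set h : {ffun D -> 'I_R} | injectiveb h]| = R ^_ #|B|.
  by rewrite card_inj_ffuns card_ord card_sig.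
rewrite -[LHS](card_in_imset (f := fun h : {ffun T -> 'I_R} => [ffun z : D => h (val z)])).
  apply: eq_card => g; apply/imsetP/idP => [[h]|].
    rewrite !inE => /andP[_ /dinjectiveP hI] ->; apply/injectiveP => x y.
    by rewrite !ffunE => /hI e; apply/val_inj/e; apply: valP.
  rewrite inE => /injectiveP gI.
  pose h : {ffun T -> 'I_R} :=
    [ffun w => if insub w is Some z then g z else r0].
  exists h; last first.
    by apply/ffunP => z; rewrite !ffunE valK.
  rewrite inE; apply/andP; split.
    by apply/forallP => w; apply/implyP => wB; rewrite ffunE insubN.
  apply/dinjectiveP => x y xB yB; rewrite !ffunE !insubT /= => /gI.
  by case.
move=> h h'; rewrite !inE => /andP[/forallP h0 _] /andP[/forallP h0' _] /ffunP e.
apply/ffunP => w; have [wB|wB] := boolP (w \in B).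
  by have := e (Sub w wB); rewrite !ffunE.
have /implyP/(_ wB)/eqP -> := h0 w.
by have /implyP/(_ wB)/eqP -> := h0' w.
Qed.

(** * Matchings that project to a given graph *)

Section Fiber.
Variable G : graph n.
Variable r0 : 'I_R.
Implicit Type s : {ffun 'I_n -> {ffun 'I_n -> 'I_R}}.

(* [s v w] is the slot of v that the edge vw uses (r0 if vw is not an edge). *)
Definition slottings : {set {ffun 'I_n -> {ffun 'I_n -> 'I_R}}} :=
  [set s : {ffun 'I_n -> {ffun 'I_n -> 'I_R}} in family (fun v => [set h : {ffun 'I_n -> 'I_R} |
      [forall w, (w \notin [set w | adj G v w]) ==> (h w == r0)] &&
      dinjectiveb h [set w | adj G v w]])].

Lemma card_slottings : #|slottings| = \prod_v R ^_ deg G v.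
Proof.
rewrite cardsE card_family foldrE big_map big_enum /=; apply: eq_bigr => v _.
exact: card_slot_injections.
Qed.

Lemma slottingsP s : s \in slottings ->
  (forall v w, ~~ adj G v w -> s v w = r0) /\
  (forall v w w', adj G v w -> adj G v w' -> s v w = s v w' -> w = w').
Proof.
rewrite inE => /familyP h; split=> v w.
  move=> vw; have := h v; rewrite inE => /andP[/forallP/(_ w)/implyP + _].
  by rewrite inE => /(_ vw) /eqP.
move=> w' vw vw'; have := h v; rewrite inE => /andP[_ /dinjectiveP].
by apply; rewrite inE.
Qed.

Definition slot_partner s (x : slot) : slot :=
  if [pick w | adj G x.1 w && (s x.1 w == x.2)] is Some w then (w, s w x.1) else x.

Variant slot_partner_spec s (x : slot) : slot -> Prop :=
  | SlotUsed w of adj G x.1 w & s x.1 w = x.2 : slot_partner_spec s x (w, s w x.1)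
  | SlotFree of (forall w, adj G x.1 w -> s x.1 w <> x.2) : slot_partner_spec s x x.

Lemma slot_partnerP s x : slot_partner_spec s x (slot_partner s x).
Proof.
rewrite /slot_partner; case: pickP => [w /andP[xw /eqP sx]|no]; first exact: SlotUsed.
by apply: SlotFree => w xw sx; have := no w; rewrite xw sx eqxx.
Qed.

Lemma slot_partner_used s v w : s \in slottings -> adj G v w ->
  slot_partner s (v, s v w) = (w, s w v).
Proof.
move=> /slottingsP[_ sI] vw; case: slot_partnerP => /= [w' vw' /sI -> //|].
by move=> /(_ w vw).
Qed.

Lemma slot_partnerK s : s \in slottings -> involutive (slot_partner s).
Proof.
move=> sS x; case: (slot_partnerP s x) => [w xw sx|no].
  rewrite slot_partner_used 1?adj_sym // sx; exact/esym/surjective_pairing.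
by case: slot_partnerP => // w xw sx; case: (no w xw).
Qed.

Definition slot_matching s : {set {set slot}} :=
  [set [set x; slot_partner s x] | x in [set: slot]].

Definition fiber : {set {set {set slot}}} :=
  [set M in matchings [set: slot] | simple M && (graph_of M == G)].

Lemma slot_matching_fiber s : s \in slottings -> slot_matching s \in fiber.
Proof.
move=> sS; have pE := partner_involution (slot_partnerK sS).
have mM : slot_matching s \in matchings [set: slot].
  exact/matching_of_involution/slot_partnerK.
rewrite inE mM /=; apply/andP; split.
  apply/simpleP; split=> [x|x y]; rewrite !pE.
    case: slot_partnerP => //= w xw _ e; have := adj_irr G x.1.
    by rewrite -{2}e xw.
  move=> xy; case: slot_partnerP => //= w xw sx.
  case: slot_partnerP => /= [w' yw' sy e _|_ e].
    rewrite [x]surjective_pairing [y]surjective_pairing -sx -sy xy e //.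
  by rewrite e xy.
apply/eqP/graph_eq => v w; apply/(adj_graph_of mM)/idP.
  move=> [vw [x xv]]; rewrite pE; case: slot_partnerP => /= [w' + _ <-|_ xw].
    by rewrite xv.
  by rewrite -xv xw eqxx in vw.
move=> vw; split; first exact: adj_neq vw.
by exists (v, s v w); rewrite // pE slot_partner_used.
Qed.

Lemma slot_matching_inj : {in slottings &, injective slot_matching}.
Proof.
move=> s s' sS sS' e; apply/ffunP => v; apply/ffunP => w.
have pE x : slot_partner s x = slot_partner s' x.
  rewrite -(partner_involution (slot_partnerK sS)).
  by rewrite -(partner_involution (slot_partnerK sS')) -/(slot_matching s) e.
have [vw|vw] := boolP (adj G v w); last first.
  by rewrite (slottingsP sS).1 // (slottingsP sS').1.
have := pE (v, s v w); rewrite slot_partner_used //.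
case: slot_partnerP => /= [w' vw' sv [ww _]|no [wv _]]; first by rewrite -sv ww.
by have := adj_irr G v; rewrite -{2}wv vw.
Qed.

(** The slotting is read off from M: for an edge vw take the slot of v whose partner lies at w,
    which is unique because M is simple. *)
Lemma slot_matching_onto M : M \in fiber -> exists2 s, s \in slottings & M = slot_matching s.
Proof.
move=> /setIdP[mM /andP[/simpleP[s1 s2] /eqP gM]].
pose s : {ffun 'I_n -> {ffun 'I_n -> 'I_R}} := [ffun v => [ffun w =>
  if adj G v w then odflt r0 [pick i | (partner M (v, i)).1 == w] else r0]].
have sE v w : adj G v w -> (partner M (v, s v w)).1 = w.
  move=> vw; rewrite !ffunE vw; case: pickP => [i /eqP //|no].
  move: vw; rewrite -gM => /(adj_graph_of mM)[_ [[v' i] /= -> pw]].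
  by have := no i; rewrite pw eqxx.
have sS : s \in slottings.
  rewrite inE; apply/familyP => v; rewrite inE; apply/andP; split.
    apply/forallP => w; apply/implyP; rewrite inE => vw.
    by rewrite !ffunE (negbTE vw).
  apply/dinjectiveP => w w'; rewrite !inE => vw vw' e.
  by rewrite -(sE v w vw) e (sE v w' vw').
exists s => //; apply: matching_ext => //.
  exact/matching_of_involution/slot_partnerK.
move=> x; rewrite partner_involution; last exact: slot_partnerK.
have key v i w : v != w -> (partner M (v, i)).1 = w -> adj G v w /\ s v w = i.
  move=> vw pw; have avw : adj G v w.
    by rewrite -gM; apply/(adj_graph_of mM); split=> //; exists (v, i).
  split=> //; suff : (v, s v w) = (v, i) by case.
  apply: s2 => //=; first by rewrite sE.
  by rewrite sE // => e; rewrite e eqxx in vw.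
case: slot_partnerP => [w xw sx|no].
  have pw : (partner M x).1 = w by rewrite [x]surjective_pairing -sx sE.
  rewrite [LHS]surjective_pairing pw; congr (_, _).
  have [] := key w (partner M x).2 x.1 _ _; rewrite ?(eq_sym w) ?(adj_neq xw) //.
  by rewrite -pw -surjective_pairing partnerK.
apply/eqP; apply: contraT => px.
have xp : x.1 != (partner M x).1.
  by apply: contraNneq px => /esym /s1 ->.
have [] := key x.1 x.2 (partner M x).1 xp; first by rewrite -surjective_pairing.
by move=> a /(no _ a).
Qed.

Lemma card_fiber : #|fiber| = \prod_v R ^_ deg G v.
Proof.
rewrite -card_slottings -(card_in_imset slot_matching_inj); apply: eq_card => M.
apply/idP/imsetP => [/slot_matching_onto[s] |[s sS ->]]; first by exists s.
exact: slot_matching_fiber.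
Qed.

End Fiber.

(** The falling factorials counting the fiber and the factorials in the weight multiply to R! at
    every vertex, so each graph receives the same total weight. *)
Lemma sum_weight (Q : pred (graph n)) : 0 < R ->
  \sum_(M in matchings [set: slot] | simple M && Q (graph_of M)) weight M =
  #|[set G in bounded_graphs n R | Q G]| * R`! ^ n.
Proof.
move=> R0; rewrite (partition_big graph_of [in [set G in bounded_graphs n R | Q G]]) /=; last first.
  by move=> M /and3P[mM sM QM]; rewrite inE QM andbT graph_of_bounded.
rewrite -sum_nat_const; apply: eq_bigr => G /setIdP[bG QG].
have dG v : deg G v <= R by move: bG; rewrite inE => /forallP.
rewrite (eq_bigl [in fiber G]); last first.
  move=> M; rewrite [RHS]inE -!andbA; case: (M \in matchings _) => //=.
  by case: (simple M) => //=; case: eqP => [->|]; rewrite ?QG ?andbF.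
rewrite (eq_bigr (fun _ => \prod_v (R - deg G v)`!)); last first.
  move=> M /setIdP[mM /andP[sM /eqP <-]]; apply: eq_bigr => v _.
  by rewrite -[X in X - _](deg_free mM v sM) addKn.
rewrite sum_nat_const (card_fiber G (Ordinal R0)) -big_split /=.
under eq_bigr do rewrite ffact_fact //.
by rewrite prod_nat_const card_ord.
Qed.

End Projection.

(** * Short cycles and paths as copies of chains *)

Section PathIndices.
Variables (n p : nat) (v : 'I_n) (s : p.-tuple 'I_n).
Let w : 'I_p.+1 -> 'I_n := tnth [tuple of v :: s].

Lemma nth_path (i : 'I_p.+1) : i != ord_max ->
  nth v (v :: s) i = w i /\ nth v s i = w (ordS i).
Proof.
rewrite -val_eqE /= => im; have ip : i < p by have := ltn_ord i; lia.
by rewrite /w !(tnth_nth v) /= modn_small.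
Qed.

Lemma path_edgesE :
  path_edges v s = [set [set w i; w (ordS i)] | i in [set~ ord_max]].
Proof.
apply/setP => e; rewrite inE; apply/(nthP set0)/imsetP.
  rewrite size_pairmap size_tuple => -[i ip <-].
  have im : (Ordinal (ltnW (ip : i.+1 <= p) : i < p.+1)) != ord_max.
    by rewrite -val_eqE /= (ltn_eqF ip).
  exists (Ordinal (ltnW (ip : i.+1 <= p) : i < p.+1)); first by rewrite !inE.
  rewrite (nth_pairmap v) ?size_tuple //.
  by have [/= -> ->] := nth_path im.
move=> [i]; rewrite !inE => im ->.
have ip : i < p by move: im; rewrite -val_eqE /=; have := ltn_ord i; lia.
exists i; rewrite ?size_pairmap ?size_tuple // (nth_pairmap v) ?size_tuple //.
by have [-> ->] := nth_path im.
Qed.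

Lemma path_tnth (e : rel 'I_n) :
  reflect (forall i : 'I_p.+1, i != ord_max -> e (w i) (w (ordS i))) (path e v s).
Proof.
apply: (iffP (pathP v)) => h i.
  move=> im; have ip : i < p by move: im; rewrite -val_eqE /=; have := ltn_ord i; lia.
  have := h i; rewrite size_tuple => /(_ ip).
  by have [-> ->] := nth_path im.
rewrite size_tuple => ip.
have im : (Ordinal (ltnW (ip : i.+1 <= p) : i < p.+1)) != ord_max.
  by rewrite -val_eqE /= (ltn_eqF ip).
by have := h _ im; have [/= <- <-] := nth_path im.
Qed.

Lemma last_tnth : last v s = w ord_max.
Proof. by rewrite /w (tnth_nth v) (last_nth v) size_tuple. Qed.

End PathIndices.

Section Correspondence.
Variables (n R : nat).
Local Notation pts := (slot n R).
Variable M : {set {set pts}}.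
Hypothesis mM : M \in matchings [set: pts].
Local Notation pt := (partner M).
Local Notation G := (graph_of M).
Implicit Types (A : {set {set pts}}) (b : {set pts}).

Definition copies_in (o : bool) (p : nat) : {set {set {set pts}}} :=
  [set A in copies n R (chain o p) | A \subset M].

Definition verts b : {set 'I_n} := [set x.1 | x in b].


Lemma copy_subP o p (f : {ffun slot p.+1 2 -> pts}) :
  reflect (forall x : slot p.+1 2, pt (f x) = f (chain_partner o x)) (relabel f (chain o p) \subset M).
Proof.
apply: (iffP subsetP) => h.
  move=> x; apply: (partnerE mM); apply: h; apply/imsetP.
  by exists [set x; chain_partner o x]; [exact: imset_f|rewrite imsetU !imset_set1].
move=> _ /imsetP[_ /imsetP[x _ ->] ->].
by rewrite imsetU !imset_set1 -h mem_partner.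
Qed.

(** Coordinates of a copy: [a i] and [b i] are the left and right slots of its i-th vertex. In the
    open case the block at [ord_max] degenerates to the free slot [b ord_max], and only the free
    slot [a ord0] has to be added. *)
Variant copy_spec o p A : Prop :=
  CopySpec (a b : 'I_p.+1 -> pts) of
    (forall i, (a i).1 = (b i).1) & injective (fun i => (a i).1) &
    (forall i, a i <> b i) &
    (forall i, ~~ (o && (i == ord_max)) -> pt (b i) = a (ordS i)) &
    (o -> pt (b ord_max) = b ord_max /\ pt (a ord0) = a ord0) &
    A = [set [set b i; pt (b i)] | i : 'I_p.+1] :|:
        (if o then [set [set a ord0]] else set0).

Lemma copies_inP o p A : reflect (copy_spec o p A) (A \in copies_in o p).
Proof.
apply: (iffP setIdP).
  move=> [/imsetP[f /embP[fI fh] ->] /copy_subP h].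
  exists (fun i => f (i, ord0)) (fun i => f (i, ord_max)).
  - by move=> i; apply/eqP; rewrite fh.
  - by move=> i j /eqP; rewrite fh => /eqP.
  - by move=> i /fI.
  - by move=> i oi; rewrite h /chain_partner /= (negbTE oi).
  - by move=> ot; rewrite !h /chain_partner /= ot !eqxx.
  apply/setP => c; rewrite inE; apply/imsetP/orP.
    move=> [_ /imsetP[[i e] _ ->] ->]; rewrite imsetU !imset_set1 -h.
    have [->|e0] := eqVneq e ord0; last first.
      left; apply/imsetP; exists i => //.
      by have -> : e = ord_max by apply: ord2_eq; rewrite (negbTE e0).
    have [/andP[ot /eqP i0]|oi] := boolP (o && (i == ord0)).
      right; rewrite ot i0 h /chain_partner /= ot eqxx setUid inE //.
    left; apply/imsetP; exists (ord_pred i) => //.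
    by rewrite !h /chain_partner /= (negbTE oi) ord_pred_eq_max (negbTE oi) ord_predK setUC.
  move=> [/imsetP[i _ ->]|].
    exists [set (i, ord_max); chain_partner o (i, ord_max)]; first exact: imset_f.
    by rewrite imsetU !imset_set1 h.
  case: ifP => [ot|]; rewrite inE // => /eqP ->.
  exists [set (ord0, ord0); chain_partner true (ord0, ord0)]; first exact: imset_f.
  by rewrite /chain_partner /= setUid imset_set1.
move=> [a b ab aI nab bn bo eA].
pose f : {ffun slot p.+1 2 -> pts} :=
  [ffun x => if x.2 == ord0 then a x.1 else b x.1].
have h x : pt (f x) = f (chain_partner o x).
  case: x => i e; rewrite !ffunE /chain_partner /=.
  have [->|e0] := eqVneq e ord0.
    have [/andP[ot /eqP ->]|oi] := boolP (o && (i == ord0)); rewrite /= ?eqxx.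
      by have [] := bo ot.
    rewrite -(partnerK mM (b (ord_pred i))) bn ?ord_predK //.
    by rewrite ord_pred_eq_max.
  have [/andP[ot /eqP ->]|oi] := boolP (o && (i == ord_max)); rewrite /= ?(negbTE e0).
    by have [] := bo ot.
  exact: bn.
have fE : f \in emb p.+1 n R.
  have f1 x : (f x).1 = (a x.1).1 by rewrite ffunE; case: ifP; rewrite ?ab.
  apply/embP; split=> [x y e|x y]; last by rewrite !f1 (inj_eq aI).
  have xy : x.1 = y.1 by apply: aI; rewrite -!f1 e.
  case: x y xy e => i e1 [j e2] /= <-; rewrite !ffunE /=.
  case: (eqVneq e1 ord0) => [->|n1]; case: (eqVneq e2 ord0) => [->|n2] //.
  - by move/nab.
  - by move/esym/nab.
  - by move=> _; congr (_, _); apply: ord2_eq; rewrite (negbTE n1) (negbTE n2).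
suff eR : A = relabel f (chain o p).
  by rewrite eR; split; [apply/imsetP; exists f|exact/copy_subP].
rewrite eA; apply/setP => c; rewrite inE; apply/orP/imsetP.
  move=> [/imsetP[i _ ->]|].
    exists [set (i, ord_max); chain_partner o (i, ord_max)]; first exact: imset_f.
    by rewrite imsetU !imset_set1 -h !ffunE.
  case: ifP => [ot|]; rewrite inE // => /eqP ->.
  exists [set (ord0, ord0); chain_partner true (ord0, ord0)]; first exact: imset_f.
  by rewrite /chain_partner /= setUid imset_set1 ffunE.
move=> [_ /imsetP[[i e] _ ->] ->]; rewrite imsetU !imset_set1 -h.
have [->|e0] := eqVneq e ord0; last first.
  by left; apply/imsetP; exists i => //; rewrite !ffunE /= (negbTE e0).
have [/andP[ot /eqP i0]|oi] := boolP (o && (i == ord0)).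
  by right; rewrite ot i0 !ffunE /=; have [_ ->] := bo ot; rewrite setUid inE.
left; apply/imsetP; exists (ord_pred i) => //.
have -> : b (ord_pred i) = pt (a i).
  by rewrite -[i in RHS]ord_predK -bn ?(partnerK mM) // ord_pred_eq_max.
by rewrite !ffunE /= (partnerK mM) setUC.
Qed.

(** Loops and double edges are the closed chains on one and two vertices, so simplicity becomes the
    vanishing of two of the counts in the Poisson limit. *)
Lemma simple_copies :
  simple M = (copies_in false 0 == set0) && (copies_in false 1 == set0).
Proof.
apply/(simpleP M)/andP => [[s1 s2]|[/eqP c0 /eqP c1]].
  split; apply/eqP/setP => A; rewrite in_set0; apply/negP.
    move=> /copies_inP[a b ab aI nab bn _ _].
    have e := bn ord0 isT; have e0 : ordS ord0 = ord0 :> 'I_1 by apply: val_inj.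
    rewrite e0 in e; case: (nab ord0); rewrite -e; apply: s1.
    by rewrite e ab.
  move=> /copies_inP[a b ab aI nab bn _ _].
  have e0 := bn ord0 isT; have e1 := bn (ordS ord0) isT.
  have oo : ordS (ordS ord0) = ord0 :> 'I_2 by apply: val_inj.
  rewrite oo in e1.
  have pa : pt (a ord0) = b (ordS ord0) by rewrite -e1 (partnerK mM).
  have := s2 (a ord0) (b ord0) (ab _); rewrite pa e0 -ab => /(_ erefl) h.
  by apply: (nab ord0); apply: h => /aI.
split=> [x px|x y xy pxy px].
  apply/eqP; apply: contraT => npx; suff : set0 != copies_in false 0 by rewrite c0 eqxx.
  rewrite eq_sym; apply/set0Pn.
  eexists; apply/copies_inP; exists (fun _ => pt x) (fun _ => x).
  - by [].
  - by move=> i j _; apply: val_inj; case: i j => [[] // ?] [[] // ?].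
  - by move=> i e; rewrite e eqxx in npx.
  - by [].
  - by [].
  - reflexivity.
apply/eqP; apply: contraT => nxy; suff : set0 != copies_in false 1 by rewrite c1 eqxx.
rewrite eq_sym; apply/set0Pn.
have oo : ordS (ord0 : 'I_2) != ord0 by [].
eexists; apply/copies_inP.
exists (fun i : 'I_2 => if i == ord0 then y else pt x)
       (fun i : 'I_2 => if i == ord0 then x else pt y).
- by move=> i; case: ifP.
- move=> i j; case: (eqVneq i ord0) => [->|ni]; case: (eqVneq j ord0) => [->|nj] //.
  + by rewrite -xy => e; case: px.
  + by rewrite -xy => e; case: px.
  + by move=> _; apply: ord2_eq; rewrite (negbTE ni) (negbTE nj).
- move=> i; case: ifP => _ e; first by rewrite e eqxx in nxy.
  by move/(inv_inj (partnerK mM)): e => e; rewrite e eqxx in nxy.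
- move=> i _; case: (eqVneq i ord0) => [->|ni] //.
  have -> : i = ordS ord0 by apply: ord2_eq; rewrite (negbTE ni).
  by rewrite (partnerK mM).
- by [].
- reflexivity.
Qed.

Lemma simple_block b b' : simple M -> b \in M -> b' \in M ->
  verts b = verts b' -> #|verts b| = 2 -> b = b'.
Proof.
move=> /simpleP[_ s2] bM bM' vb /eqP/cards2P[v [w [vw e]]].
have : v \in verts b by rewrite e !inE eqxx.
case/imsetP=> x xb vx; have : v \in verts b' by rewrite -vb e !inE eqxx.
case/imsetP=> y yb vy.
have ex c z : c \in M -> z \in c -> verts c = [set v; w] -> v = z.1 -> (pt z).1 = w.
  move=> cM zc ec vz; have : w \in verts c by rewrite ec !inE eqxx orbT.
  rewrite (block_partner mM cM zc) /verts imsetU !imset_set1 -vz !inE.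
  by rewrite eq_sym (negbTE vw) => /eqP.
have px := ex b x bM xb e vx; have py := ex b' y bM' yb (etrans (esym vb) e) vy.
suff xy : x = y by rewrite (block_partner mM bM xb) (block_partner mM bM' yb) xy.
apply: s2; rewrite -?vx -?vy // ?px ?py //.
by move=> wv; rewrite wv eqxx in vw.
Qed.

Lemma ordS_neq p (i : 'I_p.+1) : 0 < p -> ordS i != i.
Proof.
move=> p0; rewrite -val_eqE /=; have := ltn_ord i.
rewrite ltnS leq_eqVlt => /orP[/eqP ->|h]; first by rewrite modnn; lia.
by rewrite modn_small //; lia.
Qed.

Lemma sub_copy A A' c : simple M -> A \subset M -> A' \subset M ->
  graph_edges A \subset graph_edges A' -> c \in A -> #|verts c| = 2 -> c \in A'.
Proof.
move=> sM sA sA' /subsetP gA cA c2.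
have : verts c \in graph_edges A' by apply: gA; rewrite inE imset_f //= c2.
rewrite inE => /andP[/imsetP[c' cA' e] _].
by rewrite (simple_block sM (subsetP sA _ cA) (subsetP sA' _ cA') e c2).
Qed.

Section Copy.
Variables (o : bool) (p : nat) (A : {set {set pts}}) (a b : 'I_p.+1 -> pts).
Hypothesis ab : forall i, (a i).1 = (b i).1.
Hypothesis aI : injective (fun i => (a i).1).
Hypothesis nab : forall i, a i <> b i.
Hypothesis bn : forall i, ~~ (o && (i == ord_max)) -> pt (b i) = a (ordS i).
Hypothesis bo : o -> pt (b ord_max) = b ord_max /\ pt (a ord0) = a ord0.
Hypothesis eA : A = [set [set b i; pt (b i)] | i : 'I_p.+1] :|:
        (if o then [set [set a ord0]] else set0).

Let u i := (a i).1.

Lemma verts_link i : ~~ (o && (i == ord_max)) ->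
  verts [set b i; pt (b i)] = [set u i; u (ordS i)].
Proof. by move=> oi; rewrite /verts imsetU !imset_set1 bn // -ab. Qed.

Lemma card_verts_link i : 0 < p -> #|[set u i; u (ordS i)]| = 2.
Proof. by move=> p0; rewrite cards2 (inj_eq aI) eq_sym (ordS_neq i p0). Qed.

Lemma copy_blockP c : c \in A ->
  (exists i, ~~ (o && (i == ord_max)) /\ c = [set b i; pt (b i)]) \/
  (o /\ (c = [set a ord0] \/ c = [set b ord_max])).
Proof.
rewrite eA inE => /orP[/imsetP[i _ ->]|].
  have [/andP[ot /eqP ->]|oi] := boolP (o && (i == ord_max)); last by left; exists i.
  by right; split=> //; right; have [-> _] := bo ot; rewrite setUid.
by case: ifP => ot; rewrite inE // => /eqP ->; right; split=> //; left.
Qed.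

Lemma copy_graph_edges : 0 < p ->
  graph_edges A = [set [set u i; u (ordS i)] | i in [set i | ~~ (o && (i == ord_max))]].
Proof.
move=> p0; apply/setP => e; rewrite inE; apply/andP/imsetP.
  move=> [/imsetP[c /copy_blockP[[i [oi ->]]|[_ [->|->]]] ->] c2].
  - by exists i; rewrite ?inE // -/(verts _) verts_link.
  - by rewrite imset_set1 cards1 in c2.
  - by rewrite imset_set1 cards1 in c2.
move=> [i]; rewrite inE => oi ->; split; last by rewrite card_verts_link.
apply/imsetP; exists [set b i; pt (b i)]; last by rewrite -/(verts _) verts_link.
by rewrite eA inE; apply/orP; left; apply: imset_f.
Qed.

Lemma copy_adj i : 0 < p -> ~~ (o && (i == ord_max)) -> adj G (u i) (u (ordS i)).
Proof.
move=> p0 oi; apply/(adj_graph_of mM); split.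
  by rewrite (inj_eq aI) eq_sym ordS_neq.
by exists (b i); rewrite -?ab // bn.
Qed.

Lemma copy_touched : touched A = [set u i | i : 'I_p.+1].
Proof.
apply/setP => z; apply/imsetP/imsetP.
  move=> [x /bigcupP[c /copy_blockP cA xc] ->]; case: cA xc => [[i [oi ->]]|[_ [->|->]]].
  - rewrite bn // !inE => /orP[/eqP ->|/eqP ->]; first by exists i; rewrite -?ab.
    by exists (ordS i).
  - by rewrite inE => /eqP ->; exists ord0.
  - by rewrite inE => /eqP ->; exists ord_max; rewrite -?ab.
move=> [i _ ->]; exists (b i); last by rewrite /u ab.
apply/bigcupP; exists [set b i; pt (b i)]; last by rewrite !inE eqxx.
by rewrite eA inE; apply/orP; left; apply: imset_f.
Qed.

Lemma copy_path_tuple : exists s : p.-tuple 'I_n,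
  forall i, tnth [tuple of u ord0 :: s] i = u i.
Proof.
exists [tuple u (lift ord0 i) | i < p] => i.
case: (unliftP ord0 i) => [j ->|->]; last by rewrite tnth0.
by rewrite tnthS tnth_mktuple.
Qed.

End Copy.

(** Projection of edges is a bijection: a closed chain on at least three vertices has only blocks
    joining different vertices, and simplicity recovers each block from its edge. *)
Lemma cycles_graph_of p : 1 < p -> simple M ->
  #|cycles G p.+1| = #|copies_in false p|.
Proof.
move=> p1 sM; have p0 : 0 < p by exact: ltnW.
have inj : {in copies_in false p &, injective (@graph_edges n R)}.
  suff h A A' : A \in copies_in false p -> A' \in copies_in false p ->
      graph_edges A = graph_edges A' -> A \subset A'.
    by move=> A A' hA hA' e; apply/eqP; rewrite eqEsubset !h.
  move=> hA hA' e; apply/subsetP => c cA.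
  have sA : A \subset M by case/setIdP: hA.
  have sA' : A' \subset M by case/setIdP: hA'.
  apply: (sub_copy sM sA sA' _ cA); first by rewrite e.
  have [a b ab aI nab bn bo eA] := copies_inP _ _ _ hA.
  have [[i [oi ->]]|[//]] := copy_blockP bo eA cA.
  by rewrite (verts_link ab bn oi) (card_verts_link aI).
rewrite -(card_in_imset inj); apply: eq_card => E; apply/imsetP/imsetP.
  move=> [c]; rewrite inE => /and4P[_ _ cyc uc] ->.
  have cI : injective (tnth c) by apply/tuple_uniqP.
  have link i : exists x : pts, (x.1 == tnth c i) && ((pt x).1 == tnth c (ordS i)).
    have /(adj_graph_of mM)[_ [x xi px]] := cycle_tnth _ _ cyc i.
    by exists x; rewrite xi px !eqxx.
  pose b i := xchoose (link i); pose a i := pt (b (ord_pred i)).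
  have b1 i : (b i).1 = tnth c i by case/andP: (xchooseP (link i)) => /eqP.
  have b2 i : (pt (b i)).1 = tnth c (ordS i) by case/andP: (xchooseP (link i)) => _ /eqP.
  have a1 i : (a i).1 = tnth c i by rewrite /a b2 ord_predK.
  have ab i : (a i).1 = (b i).1 by rewrite a1 b1.
  have aI : injective (fun i => (a i).1) by move=> i j /=; rewrite !a1 => /cI.
  (* Equality would make the predecessor and the successor of a vertex coincide, which is impossible
     on a cycle of length at least 3. *)
  have nab i : a i <> b i.
    move=> e; have : (pt (a i)).1 = tnth c (ordS i) by rewrite e b2.
    rewrite /a (partnerK mM) b1 => /cI e'; have := ordSS_neq (ord_pred i) p1.
    by rewrite ord_predK -e' eqxx.
  have bn i : ~~ (false && (i == ord_max)) -> pt (b i) = a (ordS i) by rewrite /a ordSK.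
  have bo : false -> pt (b ord_max) = b ord_max /\ pt (a ord0) = a ord0 by [].
  eexists; first by apply/copies_inP; exists a b => //; reflexivity.
  rewrite (copy_graph_edges ab aI bn bo erefl p0) cycle_edgesE.
  apply/setP => e; apply/imsetP/imsetP => -[i _ ->]; exists i; rewrite ?inE //= ?a1 //.
move=> [A hA ->]; have [a b ab aI nab bn bo eA] := copies_inP _ _ _ hA.
pose c := [tuple (a i).1 | i < p.+1].
have cE i : tnth c i = (a i).1 by rewrite tnth_mktuple.
exists c; last first.
  rewrite (copy_graph_edges ab aI bn bo eA p0) cycle_edgesE.
  apply/setP => e; apply/imsetP/imsetP => -[i _ ->]; exists i; rewrite ?inE //= ?cE //.
rewrite inE /is_cycle size_tuple eqxx ltnS p1 /=; apply/andP; split.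
  by apply/(cycle_tnth (adj G) c) => i; rewrite !cE; apply: (copy_adj ab aI bn).
by apply/(tuple_uniqP c) => i j; rewrite !cE => /aI.
Qed.

Section Open.
Variables (p k : nat).
Hypothesis sM : simple M.
Hypothesis spG : sparse R G k.
Hypothesis pk : p < k.

Lemma few_free_slots (W : {set 'I_n}) : #|W| <= k ->
  2 * #|inner (edges G) W| + #|[set x : pts | (x.1 \in W) && (pt x == x)]| <= 2 * #|W|.
Proof.
move=> Wk; have := sparseP _ _ _ spG W Wk.
rewrite -[X in _ -> _ + X <= _]sum1_card (partition_big (fun x : pts => x.1) [in W]) /=; last first.
  by move=> x; rewrite inE => /andP[].
congr (_ + _ <= _); apply: eq_bigr => v vW; rewrite sum1dep_card.
rewrite -[X in X - _](deg_free mM v sM) addKn; apply: eq_card => x; rewrite !inE.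
by case: (eqVneq x.1 v) => [->|]; rewrite ?andbF // vW andbT.
Qed.

Section OpenCopy.
Variables (A : {set {set pts}}) (a b : 'I_p.+1 -> pts).
Hypothesis ab : forall i, (a i).1 = (b i).1.
Hypothesis aI : injective (fun i => (a i).1).
Hypothesis nab : forall i, a i <> b i.
Hypothesis bn : forall i, ~~ (true && (i == ord_max)) -> pt (b i) = a (ordS i).
Hypothesis bo : true -> pt (b ord_max) = b ord_max /\ pt (a ord0) = a ord0.
Hypothesis eA : A = [set [set b i; pt (b i)] | i : 'I_p.+1] :|: [set [set a ord0]].

Let u i := (a i).1.

Lemma end_slots_neq : a ord0 <> b ord_max.
Proof.
case: (posnP p) => [p0|p0] e.
  by apply: (nab (i := ord_max)); rewrite -e; congr a; apply: val_inj; rewrite /= p0.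
have : u ord0 = u ord_max by rewrite /u e -ab.
by move=> /aI /(congr1 val) /= h; rewrite -h in p0.
Qed.

Lemma open_path (s : p.-tuple 'I_n) :
  (forall i, tnth [tuple of u ord0 :: s] i = u i) -> path (adj G) (u ord0) s.
Proof.
move=> sE; apply/path_tnth => i im; rewrite !sE.
have [p0|p0] := posnP p.
  by case/negP: im; rewrite -val_eqE /=; have := ltn_ord i; lia.
exact: (copy_adj (o := true) ab aI bn).
Qed.

(** The p edges of the chain on p + 1 vertices leave room for only two free slots in a sparse graph,
    and the two ends of the chain already are two. *)
Lemma open_free_slots :
  [set x : pts | (x.1 \in touched A) && (pt x == x)] = [set a ord0; b ord_max].
Proof.
have [eb ea] := bo isT; have tA := copy_touched (o := true) ab bn bo eA.
have cA : #|touched A| = p.+1 by rewrite tA card_imset // card_ord.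
apply/esym/eqP; rewrite eqEcard; apply/andP; split.
  apply/subsetP => x; rewrite !inE tA => /orP[]/eqP ->.
    by rewrite ea eqxx andbT; apply: (imset_f u).
  by rewrite eb eqxx andbT -ab; apply: (imset_f u).
have [s sE] := copy_path_tuple a.
have := inner_add_path (open_path sE) (set11 (u ord0)).
have -> : [set u ord0] :|: [set z in (s : seq _)] = touched A.
  apply/setP => z; rewrite tA !inE; apply/idP/imsetP => [zs|[i _ ->]].
    have : z \in [tuple of u ord0 :: s] by rewrite inE.
    by move=> /tnthP[i ->]; exists i.
  by have := mem_tnth i [tuple of u ord0 :: s]; rewrite sE inE.
have h := few_free_slots (W := touched A); rewrite cA in h; have := h pk.
by rewrite cA cards1 cards2; move/eqP: end_slots_neq => -> /=; lia_card.
Qed.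

End OpenCopy.

(** The edges determine the blocks of size two, and the touched vertices determine the free ends,
    since no further free slots lie there. For p = 0 there are no edges, hence the separate
    hypothesis on touched vertices. *)
Lemma open_copy_sub A A' : A \in copies_in true p -> A' \in copies_in true p ->
  touched A \subset touched A' -> (0 < p -> graph_edges A \subset graph_edges A') ->
  A \subset A'.
Proof.
move=> hA hA' /subsetP tA gA; apply/subsetP => c cA.
have sA : A \subset M by case/setIdP: hA.
have sA' : A' \subset M by case/setIdP: hA'.
have [a b ab aI nab bn bo eA] := copies_inP _ _ _ hA.
have [a' b' ab' aI' nab' bn' bo' eA'] := copies_inP _ _ _ hA'.
have [eb ea] := bo isT; have [eb' _] := bo' isT.
have single x : pt x = x -> x.1 \in touched A -> [set x] \in A'.
  move=> px xA; have : x \in [set a' ord0; b' ord_max].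
    rewrite -(open_free_slots ab' aI' nab' bn' bo' eA').
    by rewrite inE px eqxx andbT tA.
  rewrite !inE eA' => /orP[]/eqP ->; rewrite inE ?inE ?eqxx ?orbT //.
  by apply/orP; left; apply/imsetP; exists ord_max; rewrite // eb' setUid.
have tE i : (a i).1 \in touched A.
  by rewrite (copy_touched ab bn bo eA); apply: (imset_f (fun i => (a i).1)).
have [[i [oi e]]|[_ [e|e]]] := copy_blockP bo eA cA.
- have p0 : 0 < p.
    by rewrite lt0n; apply: contraNneq oi => p0; rewrite -val_eqE /=; have := ltn_ord i; lia.
  apply: (sub_copy sM sA sA' (gA p0) cA).
  by rewrite e (verts_link ab bn oi) (card_verts_link aI).
- by rewrite e; apply: single.
- by rewrite e; apply: single => //; rewrite -ab.
Qed.

Lemma graph_edges_touched A : 0 < p -> A \in copies_in true p ->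
  touched A = cover (graph_edges A).
Proof.
move=> p0 /copies_inP[a b ab aI nab bn bo eA].
rewrite (copy_touched ab bn bo eA) (copy_graph_edges ab aI bn bo eA p0).
apply/setP => z; apply/imsetP/bigcupP => [[i _ ->]|[_ /imsetP[i _ ->]]]; last first.
  by rewrite !inE => /orP[]/eqP ->; eexists.
have [im|im] := boolP (i == ord_max); last first.
  exists [set (a i).1; (a (ordS i)).1]; last by rewrite !inE eqxx.
  by apply/imsetP; exists i; rewrite ?inE.
exists [set (a (ord_pred i)).1; (a (ordS (ord_pred i))).1]; last first.
  by rewrite ord_predK !inE eqxx orbT.
apply/imsetP; exists (ord_pred i); rewrite // inE /= ord_pred_eq_max.
by rewrite (eqP im) -val_eqE /=; lia.
Qed.

(** An endpoint of degree R - 1 has exactly one free slot, which closes off the chain. Conversely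
    the ends of an open chain lie at different vertices and carry all its free slots, so both have
    degree exactly R - 1. *)
Lemma paths_graph_of : 0 < p -> 0 < R ->
  #|paths_with_end_degree G (R - 1) p| = #|copies_in true p|.
Proof.
move=> p0 R0.
have inj : {in copies_in true p &, injective (@graph_edges n R)}.
  move=> A A' hA hA' e; apply/eqP; rewrite eqEsubset.
  by rewrite !open_copy_sub //= ?e // !graph_edges_touched // e.
have max0 : (ord0 : 'I_p.+1) != ord_max by rewrite -val_eqE /=; lia.
rewrite -(card_in_imset inj); apply: eq_card => E; apply/imsetP/imsetP; last first.
  move=> [A hA ->]; have [a b ab aI nab bn bo eA] := copies_inP _ _ _ hA.
  have [s sE] := copy_path_tuple a; exists ((a ord0).1, s); last first.
    rewrite (copy_graph_edges ab aI bn bo eA p0) path_edgesE.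
    apply/setP => e; apply/imsetP/imsetP => -[i]; rewrite !inE => im ->;
    by exists i; rewrite ?inE // ?sE.
  have freeE v x : x.1 = v -> v \in touched A ->
      (forall y, y \in [set a ord0; b ord_max] -> (y.1 == v) = (y == x)) ->
      x \in [set a ord0; b ord_max] -> deg G v == R - 1.
    move=> xv vA yx xF; have := deg_free mM v sM.
    suff -> : free M v = 1 by move=> h; apply/eqP; lia.
    rewrite -(cards1 x); apply: eq_card => y; rewrite inE [RHS]inE.
    have := open_free_slots ab aI nab bn bo eA => /setP/(_ y); rewrite inE.
    have [yv|yv] := eqVneq y.1 v; last by move=> _; apply/esym/eqP => e; rewrite e xv eqxx in yv.
    rewrite yv vA /= => ->; apply/idP/eqP => [yF|->//].
    by apply/eqP; rewrite -yx // yv.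
  have tE i : (a i).1 \in touched A.
  by rewrite (copy_touched ab bn bo eA); apply: (imset_f (fun i => (a i).1)).
  rewrite inE /= /is_path p0 size_tuple eqxx /=.
  rewrite (open_path ab aI bn sE) /= last_tnth sE.
  have u01 : ((a ord0).1 == (a ord_max).1) = false by rewrite (inj_eq aI) (negbTE max0).
  apply/and3P; split.
  - apply/(tuple_uniqP [tuple of (a ord0).1 :: s]) => i j; rewrite !sE; exact: aI.
  - apply: (freeE _ (a ord0)) => // [y|]; last by rewrite !inE eqxx.
    rewrite !inE => /orP[]/eqP ->; first by rewrite !eqxx.
    rewrite -ab eq_sym u01; apply/esym/eqP => e; move: u01.
    by rewrite -e -ab eqxx.
  - apply: (freeE _ (b ord_max)) => // [y|]; last by rewrite !inE eqxx orbT.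
    rewrite !inE => /orP[]/eqP ->; last by rewrite ab !eqxx.
    rewrite u01; apply/esym/eqP => e; move: u01.
    by rewrite e -ab eqxx.
move=> [[v s]]; rewrite inE /= => /and3P[/and4P[_ _ ps us] /eqP dv /eqP dl] ->.
pose w := tnth [tuple of v :: s].
have wI : injective w by apply/tuple_uniqP.
have free1 z : deg G z = R - 1 -> exists x : pts, (x.1 == z) && (pt x == x).
  move=> dz; have := deg_free mM z sM; rewrite dz => fz.
  have : 0 < free M z by lia.
  by rewrite card_gt0 => /set0Pn[x]; rewrite inE; exists x.
have link i : exists x : pts, (x.1 == w i) &&
    (if i == ord_max then pt x == x else (pt x).1 == w (ordS i)).
  case: eqP => [->|/eqP im]; first by apply: free1; rewrite /w -last_tnth.
  have /(adj_graph_of mM)[_ [x xi px]] := path_tnth _ _ _ ps i im.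
  by exists x; rewrite xi px !eqxx.
have [y0 /andP[/eqP y0v /eqP py0]] := free1 v dv.
pose b i := xchoose (link i).
pose a i := if i == ord0 then y0 else pt (b (ord_pred i)).
have bP i : ((b i).1 == w i) &&
    (if i == ord_max then pt (b i) == b i else (pt (b i)).1 == w (ordS i)).
  exact: (xchooseP (link i)).
have b1 i : (b i).1 = w i by case/andP: (bP i) => /eqP.
have b2 i : i != ord_max -> (pt (b i)).1 = w (ordS i).
  by move=> im; case/andP: (bP i); rewrite (negbTE im) => _ /eqP.
have b3 : pt (b ord_max) = b ord_max.
  by case/andP: (bP ord_max); rewrite eqxx => _ /eqP.
have a1 i : (a i).1 = w i.
  rewrite /a; case: eqP => [->|/eqP i0]; first by rewrite y0v /w tnth0.
  by rewrite b2 ?ord_predK // ord_pred_eq_max.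
have ab i : (a i).1 = (b i).1 by rewrite a1 b1.
have aI : injective (fun i => (a i).1) by move=> i j /=; rewrite !a1 => /wI.
have nab i : a i <> b i.
  rewrite /a; case: eqP => [->|/eqP i0] e.
    have := b2 ord0 max0; rewrite -e py0 y0v.
    have -> : v = w ord0 by rewrite /w tnth0.
    by move=> /wI /esym/eqP; rewrite (negbTE (ordS_neq _ p0)).
  have e' : pt (b i) = b (ord_pred i) by rewrite -e (partnerK mM).
  have [im|im] := eqVneq i ord_max.
    have := b3; rewrite -im e' => /(congr1 fst) /=; rewrite !b1 => /wI e2.
    by have := ordS_neq (ord_pred i) p0; rewrite ord_predK e2 eqxx.
  have p1 : 1 < p by move: i0 im; rewrite -!val_eqE /=; have := ltn_ord i; lia.
  have := b2 i im; rewrite e' b1 => /wI e2; have := ordSS_neq (ord_pred i) p1.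
  by rewrite ord_predK -e2 eqxx.
have bn i : ~~ (true && (i == ord_max)) -> pt (b i) = a (ordS i).
  by move=> /= im; rewrite /a ordS_eq0 (negbTE im) ordSK.
have bo : true -> pt (b ord_max) = b ord_max /\ pt (a ord0) = a ord0 by rewrite /a eqxx.
eexists; first by apply/copies_inP; exists a b => //; reflexivity.
rewrite (copy_graph_edges ab aI bn bo erefl p0) path_edgesE.
apply/setP => e; apply/imsetP/imsetP => -[i]; rewrite !inE => im ->;
by exists i; rewrite ?inE // ?a1.
Qed.

End Open.

Lemma open0_graph_of k : simple M -> sparse R G k -> 0 < k -> 1 < R ->
  #|[set v | deg G v == R - 2]| = #|copies_in true 0|.
Proof.
move=> sM spG k0 R1.
have inj : {in copies_in true 0 &, injective (@touched n R)}.
  move=> A A' hA hA' e; apply/eqP; rewrite eqEsubset.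
  by rewrite !(open_copy_sub sM spG k0) //= e.
rewrite -(card_in_imset inj) -(card_imset _ (@set1_inj 'I_n)); apply: eq_card => W.
have o0 (i : 'I_1) : i = ord0 by apply: val_inj; case: i => [[]].
apply/imsetP/imsetP.
  move=> [v]; rewrite inE => /eqP dv ->.
  have := deg_free mM v sM; rewrite dv => fv.
  have /eqP/cards2P[x [y [xy F]]] : free M v = 2 by lia.
  have /andP[/eqP xv /eqP px] : (x.1 == v) && (pt x == x).
    by move/setP/(_ x): F; rewrite !inE eqxx.
  have /andP[/eqP yv /eqP py] : (y.1 == v) && (pt y == y).
    by move/setP/(_ y): F; rewrite !inE eqxx orbT.
  pose a (i : 'I_1) := x; pose b (i : 'I_1) := y.
  have ab i : (a i).1 = (b i).1 by rewrite /a xv yv.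
  have bn (i : 'I_1) : ~~ (true && (i == ord_max)) -> pt (b i) = a (ordS i).
    by rewrite (o0 i).
  have bo : true -> pt (b ord_max) = b ord_max /\ pt (a ord0) = a ord0 by [].
  have aI : injective (fun i => (a i).1) by move=> i j _; rewrite (o0 i) (o0 j).
  have nab i : a i <> b i by apply/eqP.
  eexists; first by apply/copies_inP; exists a b => //; reflexivity.
  rewrite (copy_touched ab bn bo erefl); apply/setP => z; rewrite inE.
  apply/eqP/imsetP => [->|[i _ ->]]; first by exists ord0; rewrite // xv.
  exact: xv.
move=> [A hA ->]; have [a b ab aI nab bn bo eA] := copies_inP _ _ _ hA.
have tA : touched A = [set (a ord0).1].
  rewrite (copy_touched ab bn bo eA); apply/setP => z; rewrite inE.
  apply/imsetP/eqP => [[i _ ->]|->]; first by rewrite (o0 i).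
  by exists ord0.
exists (a ord0).1 => //; rewrite inE; have := deg_free mM (a ord0).1 sM.
suff -> : free M (a ord0).1 = 2 by move=> h; apply/eqP; lia.
have := open_free_slots sM spG k0 ab aI nab bn bo eA.
rewrite tA => e; transitivity #|[set a ord0; b ord_max]|.
  by rewrite -e; apply: eq_card => x; rewrite !inE.
rewrite cards2; suff -> : a ord0 != b ord_max by [].
by apply/eqP; rewrite (o0 ord_max); apply: nab.
Qed.

End Correspondence.

(** * The second moment of the weight *)

Section SecondMoment.
Variables (n R : nat).
Hypothesis R_gt1 : 1 < R.
Local Notation slot := (slot n R).
Implicit Types (M : {set {set slot}}) (V : {set 'I_n}).

Definition free_at M (v : 'I_n) : {set 'I_R} :=
  [set i | partner M (v, i) == (v, i)].

Lemma card_free_at M v : #|free_at M v| = free M v.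
Proof.
rewrite -(card_imset _ (f := fun i : 'I_R => (v, i))); last by move=> i j [].
apply: eq_card => -[w i]; rewrite inE /=; apply/imsetP/andP.
  by move=> [j]; rewrite inE => pj [-> ->].
by move=> [/eqP -> pi]; exists i; rewrite ?inE.
Qed.

(** A factorial differs from 1 only if a pair of free slots exists, and events of prescribed pairs
    can be counted. *)
Lemma fact_sqr_le f : f <= R -> f`! ^ 2 <= 1 + R`! ^ 2 * 'C(f, 2).
Proof.
case: f => [|[|f]] fR //.
apply: leq_trans (leq_addl _ _); rewrite -[leqLHS]muln1 leq_mul ?bin_gt0 //.
by rewrite leq_exp2r // leq_fact.
Qed.

Lemma sum_free_pairs V :
  \sum_(M in matchings [set: slot]) \prod_(v in V) 'C(free M v, 2) <=
  'C(R, 2) ^ #|V| * involutions (n * R - 2 * #|V|).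
Proof.
pose prs : {set {set 'I_R}} := [set e : {set 'I_R} | #|e| == 2].
rewrite (eq_bigr (fun M => \sum_(h in pffun_on (set0 : {set 'I_R}) (mem V) (mem prs))
    \prod_(v in V) (h v \subset free_at M v : nat))); last first.
  move=> M _; rewrite -(big_distr_big (set0 : {set 'I_R}) (mem V) (mem prs)
    (fun v (e : {set 'I_R}) => (e \subset free_at M v : nat))).
  apply: eq_bigr => v _.
  rewrite -card_free_at -cards_draws -sum1_card big_mkcond [RHS]big_mkcond /=.
  apply: eq_bigr => e _; rewrite !inE; case: (e \subset _); case: (#|e| == 2) => //.
rewrite exchange_big /=.
have -> : 'C(R, 2) ^ #|V| * involutions (n * R - 2 * #|V|) =
    \sum_(h in pffun_on (set0 : {set 'I_R}) (mem V) (mem prs))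
      involutions (n * R - 2 * #|V|).
  by rewrite sum_nat_const card_pffun_on /prs card_draws card_ord.
apply: leq_sum => h /pffun_onP[_ /= hV].
(* With h choosing a pair at each vertex of V, these 2|V| slots are prescribed to be free, which
   leaves a matching of the others. *)
pose U : {set slot} := [set x | (x.1 \in V) && (x.2 \in h x.1)].
pose A : {set {set slot}} := [set [set x] | x in U].
have mA : A \in matchings U.
  apply/matchingsP; split.
  - apply/setP => x; apply/bigcupP/idP => [[_ /imsetP[y yU ->]]|xU].
      by rewrite inE => /eqP ->.
    by exists [set x]; [exact: imset_f|rewrite inE].
  - apply/trivIsetP => _ _ /imsetP[x _ ->] /imsetP[y _ ->] xy.
    by rewrite disjoints1 inE; apply: contra xy => /eqP ->.
  - by move=> _ /imsetP[x _ ->]; rewrite cards1.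
have cU : #|U| = 2 * #|V|.
  rewrite -sum1_card (partition_big (fun x : slot => x.1) [in V]) /=; last first.
    by move=> x; rewrite inE => /andP[].
  rewrite mulnC -sum_nat_const; apply: eq_bigr => v vV; rewrite sum1dep_card.
  have hv : #|h v| = 2.
    have : h v \in prs by apply: hV; exact: image_f.
    by rewrite inE => /eqP.
  rewrite -[RHS]hv -[RHS](card_imset _ (f := fun i : 'I_R => (v, i))); last by move=> i j [].
  apply: eq_card => -[w i]; rewrite !inE /=; apply/idP/imsetP.
    by move=> /andP[/andP[_ ih] /eqP wv]; exists i; rewrite -?wv.
  by move=> [j jh [-> ->]]; rewrite vV jh eqxx.
have := card_matchings_sup xpredT mA (subsetT U).
have -> : #|[set M in matchings ([set: slot] :\: U) | true]| =
    involutions (n * R - 2 * #|V|).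
  rewrite -cU -[n in n * R]card_ord -[R in _ * R]card_ord -card_prod -cardsT.
  have <- : #|[set: slot] :\: U| = #|[set: slot]| - #|U|.
    by rewrite cardsD (setIidPr (subsetT U)).
  by rewrite -card_matchings; apply: eq_card => M; rewrite inE andbT.
move=> <-; rewrite -sum1_card big_mkcond [leqRHS]big_mkcond /=.
apply: leq_sum => M _; rewrite [in X in _ <= X]in_set.
case mM: (M \in matchings _) => //=; rewrite andbT.
case sA: (A \subset M).
  apply: leq_trans (_ : \prod_(v in V) 1 <= _); last by rewrite prod_nat_const exp1n.
  by apply: leq_prod => v _; case: (_ \subset _).
have /subsetPn[_ /imsetP[x xU ->] xM] := negbT sA.
move: (xU); rewrite inE => /andP[xV xh]; rewrite (bigD1 x.1) //= mulnC.
suff -> : h x.1 \subset free_at M x.1 = false by rewrite muln0.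
apply/negP => /subsetP/(_ _ xh); rewrite inE -surjective_pairing.
by rewrite -(free_block mM) (negbTE xM).
Qed.

Lemma involutions_sub2 m t : 2 * t <= m ->
  \prod_(i < t) (m - 2 * i - 1) * involutions (m - 2 * t) <= involutions m.
Proof.
elim: t => [|t IH] tm; first by rewrite big_ord0 mul1n muln0 subn0.
apply: leq_trans (IH _); last by lia.
rewrite big_ord_recr /= -mulnA leq_mul2l; apply/orP; right.
rewrite [leqRHS]involutions_rec; last by lia.
have -> : m - 2 * t - 2 = m - 2 * t.+1 by lia.
exact: leq_addl.
Qed.

Lemma ffact_prod_le t : t <= n -> n ^_ t <= \prod_(i < t) (n * R - 2 * i - 1).
Proof.
move=> tn; rewrite ffact_prod; apply: leq_prod => i _.
have : i < n by apply: leq_trans tn.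
have : n * 2 <= n * R by rewrite leq_mul2l R_gt1 orbT.
lia.
Qed.

(** Expand the product over vertices of 1 + c C(f, 2) into a sum over sets V of vertices and group
    these by size. *)
Lemma sum_weight_sqr :
  \sum_(M in matchings [set: slot]) weight M ^ 2 <=
  \sum_(t < n.+1) 'C(n, t) * ((R`! ^ 2 * 'C(R, 2)) ^ t * involutions (n * R - 2 * t)).
Proof.
apply: leq_trans (_ : \sum_(M in matchings [set: slot])
    \sum_(V : {set 'I_n}) \prod_(v in V) (R`! ^ 2 * 'C(free M v, 2)) <= _).
  apply: leq_sum => M mM; rewrite /weight -mulnn -big_split /=.
  apply: leq_trans (_ : \prod_v (R`! ^ 2 * 'C(free M v, 2) + 1) <= _).
    apply: leq_prod => v _; rewrite mulnn addnC; apply: fact_sqr_le.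
    by rewrite -card_free_at -[leqRHS]card_ord max_card.
  by rewrite bigA_distr; apply: leq_sum => V _; rewrite -big_mkcond.
rewrite exchange_big /=.
apply: leq_trans (_ : \sum_(V : {set 'I_n})
   (R`! ^ 2 * 'C(R, 2)) ^ #|V| * involutions (n * R - 2 * #|V|) <= _).
  apply: leq_sum => V _; under eq_bigr do rewrite big_split /= prod_nat_const.
  by rewrite -big_distrr /= expnMn -mulnA leq_mul2l sum_free_pairs orbT.
have cV (V : {set 'I_n}) : #|V| < n.+1 by rewrite ltnS -[leqRHS]card_ord max_card.
rewrite (partition_big (fun V => Ordinal (cV V)) xpredT) //=.
apply: leq_sum => t _; rewrite -[n in 'C(n, t)]card_ord -card_draws -sum_nat_const.
rewrite [leqRHS](eq_bigl (fun V => Ordinal (cV V) == t)) => [|V]; last first.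
  by rewrite inE -val_eqE.
by apply: leq_sum => V /eqP <-.
Qed.

(** Iterating I(m) >= (m-1) I(m-2), and using R >= 2 to compare the factors with n - i, the number
    of vertex sets of size t is absorbed up to 1/t!. The sum is thus a partial exponential series,
    bounded in n. *)
Lemma second_moment_weight (K : numFieldType) :
  ((\sum_(M in matchings [set: slot]) weight M ^ 2)%:R <=
   (\sum_(t < n.+1) (R`! ^ 2 * 'C(R, 2))%:R ^+ t / t`!%:R) *
     (involutions (n * R))%:R :> K)%R.
Proof.
apply: le_trans (_ : (\sum_(t < n.+1) 'C(n, t) * ((R`! ^ 2 * 'C(R, 2)) ^ t *
    involutions (n * R - 2 * t)))%:R <= _)%R; first by rewrite ler_nat sum_weight_sqr.
rewrite natr_sum mulr_suml; apply: ler_sum => t _.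
rewrite mulrAC ler_pdivlMr ?ltr0n ?fact_gt0 // -natrX -!natrM ler_nat.
rewrite mulnAC bin_ffact mulnCA leq_mul2l; apply/orP; right.
have tn : t <= n by rewrite -ltnS.
apply: leq_trans (involutions_sub2 (m := n * R) (t := t) _); last first.
  have : n * 2 <= n * R by rewrite leq_mul2l R_gt1 orbT.
  lia.
by rewrite leq_mul2r ffact_prod_le ?orbT.
Qed.

End SecondMoment.

From mathcomp Require Import all_classical all_reals all_analysis.

Import numFieldNormedType.Exports.
Local Open Scope classical_set_scope.
Local Open Scope ring_scope.

(** * Limits *)

Section Limits.
Variable K : realType.
Implicit Types f g : nat -> K.

Lemma cvg0_le f g : (\forall n \near \oo, `|f n| <= g n) ->
  g @ \oo --> (0 : K) -> f @ \oo --> (0 : K).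
Proof.
move=> fg g0; apply/norm_cvg0P.
have h0 : (fun _ : nat => 0 : K) @ \oo --> (0 : K) by exact: cvg_cst.
apply: (squeeze_cvgr _ h0 g0).
by near=> n; rewrite normr_ge0 /=; near: n.
Unshelve. all: by end_near. Qed.

Lemma cvg_dist0 f g (l : K) : (fun n => f n - g n) @ \oo --> (0 : K) ->
  g @ \oo --> l -> f @ \oo --> l.
Proof.
move=> h gl; have -> : f = (fun n => f n - g n) \+ g.
  by apply/funext => n /=; rewrite subrK.
by rewrite -[l]add0r; exact: cvgD.
Qed.

Lemma cvg_sum_fin (I : finType) (P : pred I) (F : I -> nat -> K) (l : I -> K) :
  (forall i, P i -> F i @ \oo --> l i) ->
  (fun n => \sum_(i | P i) F i n) @ \oo --> \sum_(i | P i) l i.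
Proof. by move=> h; apply: cvg_big => //; exact: add_continuous. Qed.

Lemma cvg_prod_fin (I : finType) (P : pred I) (F : I -> nat -> K) (l : I -> K) :
  (forall i, P i -> F i @ \oo --> l i) ->
  (fun n => \prod_(i | P i) F i n) @ \oo --> \prod_(i | P i) l i.
Proof. by move=> h; apply: cvg_big => //; exact: mul_continuous. Qed.

Lemma delta_cvg0 : delta K @ \oo --> (0 : K).
Proof.
apply/cvgr0Pnorm_lt => e e0; near=> n.
have n0 : (0 < n)%N by near: n; exact: nbhs_infty_gt.
rewrite ger0_norm ?delta_ge0 // /delta invf_plt ?posrE ?sqrtr_gt0 ?ltr0n //.
rewrite -(@ger0_norm _ e^-1) ?invr_ge0 ?ltW // -sqrtr_sqr ltr_sqrt ?ltr0n //.
by near: n; exact: nbhs_infty_gtr.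
Unshelve. all: by end_near. Qed.

Lemma cvg_cdelta (c : K) : (fun n => c * delta K n) @ \oo --> (0 : K).
Proof. by rewrite -(mulr0 c); apply: cvgMr; exact: delta_cvg0. Qed.

Lemma cvg0_delta f (c : K) : (\forall n \near \oo, `|f n| <= c * delta K n) ->
  f @ \oo --> (0 : K).
Proof. by move=> h; apply: cvg0_le h (cvg_cdelta c). Qed.

End Limits.

(** * Convergence of the expected numbers of copies *)

Section MeanCount.
Variables (K : realType) (R : nat).
Hypothesis R_gt1 : (1 < R)%N.
Local Notation inv m := ((involutions m)%:R : K).

(** In I(m+2) = I(m+1) + (m+1) I(m) the first term is smaller than the second by a factor of order
    n^(-1/2), and m + 1 differs from (n - i) R by a constant. *)
Lemma involutions_ratio2 (i n : nat) : (2 * i + 2 <= n)%N ->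
  `|((n - i) * R)%:R * (inv (n * R - 2 * i.+1) / inv (n * R - 2 * i)) - 1| <=
  (i * R + 2 * i + 2 + R)%:R * delta K n.
Proof.
move=> ni; have nR : (2 * n <= n * R)%N by rewrite mulnC leq_mul2l R_gt1 orbT.
have [m Em] : exists m, (n * R - 2 * i = m.+2)%N.
  by exists (n * R - 2 * i - 2)%N; lia.
have -> : (n * R - 2 * i.+1 = m)%N by lia.
rewrite Em involutionsSS natrD [(m.+1 * _)%:R]natrM.
have n0 : (0 < n)%N by lia.
have a0 := inv_gt0 K m; set a := inv m in a0 *.
have /andP[blo bhi] := involutions_ratio K m; rewrite -/a in blo bhi.
set b := inv m.+1 in blo bhi *.
have b0 : 0 <= b by rewrite ler0n.
have m10 : 0 < m.+1%:R :> K by rewrite ltr0n.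
have d0 : 0 < b + m.+1%:R * a by rewrite ltr_wpDl // mulr_gt0.
rewrite mulrA -[X in _ - X](@divff _ (b + m.+1%:R * a)) ?gt_eqF // -mulrBl.
rewrite normrM normfV (ger0_norm (ltW d0)) ler_pdivrMr //.
pose s := Num.sqrt (n * R)%:R : K.
have sm : Num.sqrt m%:R <= s :> K by rewrite ler_sqrt ?ler0n // ler_nat; lia.
have s0 : 0 <= s by exact: sqrtr_ge0.
have e1 : ((n - i) * R)%:R = m.+1%:R + (2 * i + 1)%:R - (i * R)%:R :> K.
  apply/eqP; rewrite eq_sym subr_eq -natrD -natrD eqr_nat; apply/eqP.
  have : (i * R <= n * R)%N by rewrite leq_mul2r; lia.
  rewrite mulnBl; lia.
have -> : ((n - i) * R)%:R * a - (b + m.+1%:R * a) =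
          ((2 * i + 1)%:R - (i * R)%:R) * a - b by rewrite e1; ring.
have lhs : `|((2 * i + 1)%:R - (i * R)%:R) * a - b| <=
    ((i * R + 2 * i + 2)%:R + s) * a.
  apply: le_trans (ler_normB _ _) _; rewrite (ger0_norm b0) normrM (ger0_norm (ltW a0)).
  have : `|(2 * i + 1)%:R - (i * R)%:R| <= (2 * i + 1)%:R + (i * R)%:R :> K.
    by apply: le_trans (ler_normB _ _) _; rewrite !normr_nat.
  have := ler_wpM2r (ltW a0) sm.
  rewrite !natrD !natrM; nra.
apply: le_trans lhs _.
have sd : s <= R%:R * (n%:R * delta K n).
  have nd : n%:R * delta K n = Num.sqrt n%:R :> K.
    rewrite /delta -{1}[n%:R](@sqr_sqrtr _ n%:R) ?ler0n // expr2 mulfK //.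
    by rewrite gt_eqF // sqrtr_gt0 ltr0n.
  rewrite nd /s natrM sqrtrM ?ler0n // mulrC ler_wpM2r ?sqrtr_ge0 //.
  rewrite -[leRHS](@ger0_norm _ R%:R) ?ler0n // -sqrtr_sqr ler_sqrt ?sqr_ge0 //.
  by rewrite -natrX ler_nat -mulnn leq_pmulr // ltnW.
have nd1 : 1 <= n%:R * delta K n.
  have := delta_pow K 1 n0; rewrite expr1 muln1 expr2 mulrA => h.
  rewrite -[leLHS]h -[leRHS]mulr1 ler_wpM2l ?delta_le1 // mulr_ge0 ?ler0n ?delta_ge0 //.
have nm : n%:R <= m.+1%:R :> K by rewrite ler_nat; lia.
have d1 := delta_ge0 K n.
apply: le_trans (_ : (i * R + 2 * i + 2 + R)%:R * (n%:R * delta K n) * a <= _).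
  rewrite ler_pM2r // [in leRHS]natrD mulrDl lerD //.
  by rewrite -[leLHS]mulr1 ler_wpM2l.
rewrite -!mulrA ler_wpM2l ?ler0n // [n%:R * _]mulrCA ler_wpM2l //.
by rewrite -[leLHS]add0r lerD // ler_pM2r.
Qed.

(** Writing R(R - 1) as R times R - 1, the n-dependent part telescopes into v ratios that tend to
    1. *)
Lemma copies_density_cvg v (A0 : {set {set slot v 2}}) :
  A0 \in matchings [set: slot v 2]%SET ->
  (fun n => #|copies n R A0|%:R * (inv (n * R - 2 * v) / inv (n * R)))
    @ \oo --> (R.-1%:R ^+ v / #|aut A0|%:R : K).
Proof.
move=> mA.
have aut0 : #|aut A0|%:R != 0 :> K by rewrite pnatr_eq0 -lt0n aut_gt0.
pose r i n : K := ((n - i) * R)%:R * (inv (n * R - 2 * i.+1) / inv (n * R - 2 * i)).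
have rE n w : \prod_(i < w) r i n =
    (n ^_ w * R ^ w)%:R * (inv (n * R - 2 * w) / inv (n * R)).
  elim: w => [|w IH]; first by rewrite big_ord0 muln0 subn0 divff ?inv_neq0 // mulr1.
  rewrite big_ord_recr /= IH ffactnSr expnSr /r !natrM.
  have := inv_neq0 K (n * R - 2 * w); have := inv_neq0 K (n * R).
  by move: (inv _) (inv (n * R - 2 * w)) => x y xn yn; field; rewrite xn yn.
have lim : (fun n => \prod_(i < v) r i n) @ \oo --> (1 : K).
  have := @cvg_prod_fin K 'I_v predT (fun i n => r i n) (fun=> 1).
  rewrite big1 //; apply => i _; apply: (@cvg_dist0 _ _ (fun=> 1)); last exact: cvg_cst.
  apply: (@cvg0_delta _ _ (i * R + 2 * i + 2 + R)%:R); near=> n.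
  by apply: involutions_ratio2; near: n; exact: nbhs_infty_ge.
have -> : (fun n => #|copies n R A0|%:R * (inv (n * R - 2 * v) / inv (n * R))) =
    (fun n => R.-1%:R ^+ v / #|aut A0|%:R * \prod_(i < v) r i n).
  apply/funext => n; rewrite rE [RHS]mulrA; congr (_ * _).
  apply: (mulIf aut0); rewrite -[LHS]natrM card_copies // mulrAC divfK //.
  by rewrite expnMn !natrM !natrX; ring.
by rewrite -[X in _ --> X]mulr1; apply: cvgMr.
Unshelve. all: by end_near. Qed.

End MeanCount.

(** * A Poisson limit from an approximate recursion *)

Section PoissonLimit.
Variables (K : realType) (I : finType).
Implicit Types x y : {ffun I -> nat}.
Variables (p : nat -> {ffun I -> nat} -> K) (m : nat -> I -> K) (lam : I -> K).
Variable C : K.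
Hypothesis p_ge0 : forall n x, 0 <= p n x.
Hypothesis p_rec : forall x t, (0 < x t)%N ->
  (fun n => (x t)%:R * p n x - m n t * p n (drop1 x t)) @ \oo --> (0 : K).
Hypothesis m_lim : forall t, (fun n => m n t) @ \oo --> lam t.
Hypothesis lam_ge0 : forall t, 0 <= lam t.

Let box (L : nat) (y : {ffun I -> 'I_L.+1}) : {ffun I -> nat} := [ffun t => y t : nat].

Hypothesis p_box_le : forall L n, \sum_(y : {ffun I -> 'I_L.+1}) p n (box y) <= 1.
Hypothesis p_box_ge : forall L, \forall n \near \oo,
  1 - C / L.+1%:R <= \sum_(y : {ffun I -> 'I_L.+1}) p n (box y).

Let q x : K := \prod_t (lam t ^+ x t / (x t)`!%:R).
Let x0 : {ffun I -> nat} := [ffun=> 0%N].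

Lemma p_le1 n x : p n x <= 1.
Proof.
pose L := \max_t x t.
pose y : {ffun I -> 'I_L.+1} := [ffun t => inord (x t)].
have -> : x = box y.
  apply/ffunP => t; rewrite !ffunE inordK // ltnS.
  exact: (leq_bigmax (F := fun t => x t)).
apply: le_trans (p_box_le L n); rewrite (bigD1 y) //= lerDl.
by apply: sumr_ge0 => *.
Qed.

(** Each use of the recursion lowers one coordinate and contributes lambda_t / x_t; descending to
    the zero vector collects the unnormalized Poisson weight q x. *)
Lemma p_ratio x : (fun n => p n x - q x * p n x0) @ \oo --> (0 : K).
Proof.
have [w] := ubnP (\sum_t x t); elim: w x => // w IH x; rewrite ltnS => xw.
have [/eqP|[t xt]] : x = x0 \/ exists t, (0 < x t)%N.
- case: (pickP (fun t => 0 < x t)%N) => [t xt|h]; first by right; exists t.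
  left; apply/ffunP => t; rewrite ffunE; apply/eqP; rewrite -leqn0 leqNgt.
  by have := h t => /= ->.
- move=> /eqP ->; rewrite /q big1 => [|t _]; last by rewrite ffunE fact0 expr0 divr1.
  have -> : (fun n => p n x0 - 1 * p n x0) = (fun=> 0) by apply/funext => n; rewrite mul1r subrr.
  exact: cvg_cst.
pose y := drop1 x t.
have yw : (\sum_u y u < w)%N.
  apply: leq_trans xw; rewrite (bigD1 t) //= [X in (_ < X)%N](bigD1 t) //=.
  rewrite /y drop1E eqxx subn1 -(ltn_predK xt) /= ltnS leq_add2l.
  by apply: leq_sum => u _; rewrite drop1E leq_subr.
have xt0 : (x t)%:R != 0 :> K by rewrite pnatr_eq0 -lt0n.
have qE : (x t)%:R * q x = lam t * q y.
  rewrite /q (bigD1 t) //= [in RHS](bigD1 t) //= !mulrA; congr (_ * _).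
    rewrite /y drop1E eqxx subn1; case: (x t) xt xt0 => // e _ e0 /=.
    rewrite factS natrM exprS; have : e`!%:R != 0 :> K by rewrite pnatr_eq0 -lt0n fact_gt0.
    by move: e`!%:R (e.+1%:R) e0 => f g g0 f0; field; rewrite g0 f0.
  by apply: eq_bigr => u ut; rewrite /y drop1E (negbTE ut) subn0.
have lim : (fun n => ((x t)%:R * p n x - m n t * p n y) +
     ((m n t - lam t) * p n y + lam t * (p n y - q y * p n x0))) @ \oo --> (0 : K).
  rewrite -[X in _ --> X](addr0 0) -[X in _ --> _ + X](addr0 0).
  apply: cvgD; first exact: p_rec.
  apply: cvgD; last by rewrite -(mulr0 (lam t)); apply: cvgMr; exact: IH.
  apply: (@cvg0_le _ _ (fun n => `|m n t - lam t|)).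
    by near=> n; rewrite normrM (ger0_norm (p_ge0 _ _)) -[leRHS]mulr1 ler_wpM2l ?p_le1.
  apply/norm_cvg0P; rewrite -(subrr (lam t)); apply: cvgB; [exact: m_lim|exact: cvg_cst].
have -> : (fun n => p n x - q x * p n x0) = (fun n => (x t)%:R^-1 *
    (((x t)%:R * p n x - m n t * p n y) +
     ((m n t - lam t) * p n y + lam t * (p n y - q y * p n x0)))).
  apply/funext => n; apply: (mulfI xt0); rewrite mulVKf // mulrBr mulrA qE; ring.
by rewrite -(mulr0 (x t)%:R^-1); apply: cvgMr.
Unshelve. all: by end_near. Qed.

Let S (L : nat) : K := \prod_t \sum_(i < L.+1) lam t ^+ i / i`!%:R.

Lemma S_cvg : S @ \oo --> \prod_t expR (lam t).
Proof.
apply: cvg_prod_fin => t _.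
have h : series (exp_coeff (lam t)) @ \oo --> expR (lam t).
  exact: is_cvg_series_exp_coeff.
have -> : (fun n => \sum_(i < n.+1) lam t ^+ i / i`!%:R) =
    (fun n => series (exp_coeff (lam t)) n.+1).
  by apply/funext => n; rewrite /series /= big_mkord.
by rewrite cvg_shiftS.
Qed.

Lemma S_ge1 L : 1 <= S L.
Proof.
rewrite /S; elim/big_ind: _ => // [a b|t _]; first exact: mulr_ege1.
rewrite big_ord_recl expr0 fact0 divr1 lerDl; apply: sumr_ge0 => i _.
by rewrite divr_ge0 ?ler0n ?exprn_ge0.
Qed.

Lemma sum_box_q L : \sum_(y : {ffun I -> 'I_L.+1}) q (box y) = S L.
Proof.
rewrite /S bigA_distr_bigA; apply: eq_bigr => y _.
by apply: eq_bigr => t _; rewrite ffunE.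
Qed.

Let E : K := \prod_t expR (lam t).

Lemma E_gt0 : 0 < E.
Proof. by apply: prodr_gt0 => t _; exact: expR_gt0. Qed.

Lemma p0_cvg : (fun n => p n x0) @ \oo --> E^-1.
Proof.
apply/cvgrPdist_lt => e e0.
have e4 : 0 < e / 4 by rewrite divr_gt0.
(* The box is fixed before n grows: it is finite, so all ratios in it are under control at once, and
   the mass outside is at most C/(L+1) for large n. *)
have /filter_ex[L [SL CL]] : \forall L \near \oo,
    `|E^-1 - (S L)^-1| < e / 4 /\ C / L.+1%:R < e / 4.
  near=> L; split.
    near: L; apply: (@cvgr_dist_lt _ _ _ \oo); last exact: e4.
    by apply: cvgV; [rewrite gt_eqF // E_gt0|exact: S_cvg].
  rewrite ltr_pdivrMr ?ltr0n // mulrC -ltr_pdivrMr //.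
  apply: lt_le_trans (_ : L%:R <= _); last by rewrite ler_nat.
  by near: L; exact: nbhs_infty_gtr.
have h : (fun n => \sum_(y : {ffun I -> 'I_L.+1}) (p n (box y) - q (box y) * p n x0))
    @ \oo --> (0 : K).
  have := @cvg_sum_fin K {ffun I -> 'I_L.+1} predT
    (fun (y : {ffun I -> 'I_L.+1}) n => p n (box y) - q (box y) * p n x0) (fun=> 0).
  by rewrite big1 //; apply => y _; exact: p_ratio.
near=> n.
have d1 : `|\sum_(y : {ffun I -> 'I_L.+1}) p n (box y) - S L * p n x0| < e / 4.
  rewrite -sum_box_q mulr_suml -sumrB; near: n.
  exact: (@cvgr0_norm_lt _ _ _ \oo _ _ h).
have d2 : 1 - C / L.+1%:R <= \sum_(y : {ffun I -> 'I_L.+1}) p n (box y).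
  by near: n; exact: p_box_ge.
have d3 := p_box_le L n; have S1 := S_ge1 L.
move: d1 d2 d3; set s := \sum_y _ => d1 d2 d3.
have S0 : 0 < S L by apply: lt_le_trans S1.
have d4 : `|(S L)^-1 - p n x0| < e / 2.
  apply: le_lt_trans (_ : `|1 - S L * p n x0| < _).
    have -> : (S L)^-1 - p n x0 = (S L)^-1 * (1 - S L * p n x0).
      by rewrite mulrBr mulr1 mulKf // gt_eqF.
    rewrite normrM normfV (ger0_norm (ltW S0)) -[leRHS]mul1r ler_wpM2r //.
    by rewrite invf_le1.
  have -> : 1 - S L * p n x0 = (1 - s) + (s - S L * p n x0) by ring.
  apply: le_lt_trans (ler_normD _ _) _.
  have -> : e / 2 = e / 4 + e / 4 by lra.
  apply: ltr_leD => //; last exact: ltW.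
  rewrite ger0_norm ?subr_ge0 //; apply: le_lt_trans CL.
  by rewrite lerBlDr -lerBlDl.
rewrite -(subrK (S L)^-1 E^-1) -addrA; apply: le_lt_trans (ler_normD _ _) _.
lra.
Unshelve. all: by end_near. Qed.

Lemma poisson_cvg x : (fun n => p n x) @ \oo -->
  \prod_t (lam t ^+ x t / (x t)`!%:R * expR (- lam t)).
Proof.
apply: (@cvg_dist0 _ _ (fun n => q x * p n x0)); first exact: p_ratio.
have -> : \prod_t (lam t ^+ x t / (x t)`!%:R * expR (- lam t)) = q x * E^-1.
  rewrite big_split /= -/(q x) /E -prodfV; congr (_ * _).
  by apply: eq_bigr => t _; rewrite expRN.
by apply: cvgMr; exact: p0_cvg.
Qed.

End PoissonLimit.

(** * Poisson limit for the numbers of chains *)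

Section PatternPoisson.
Variables (K : realType) (R k : nat) (I : finType) (ty : I -> bool * nat).
Hypothesis R_gt1 : (1 < R)%N.
Hypothesis ty_inj : injective ty.
Hypothesis ty_le : forall t, ((ty t).2.+1 <= k)%N.

Definition pattern_copies n t := copies n R (chain (ty t).1 (ty t).2).

(** The limiting expected number of copies. Only its rationality and positivity matter, so the
    automorphisms are not counted explicitly. *)
Definition pattern_mean (o : bool) (p : nat) : rat :=
  R.-1%:R ^+ p.+1 / #|aut (chain o p)|%:R.

Definition pattern_counts n (M : {set {set slot n R}}) : {ffun I -> nat} :=
  counts (@pattern_copies n) M.

Let str n t A : A \in @pattern_copies n t -> is_structure A.
Proof. exact/copies_structure/chain_connected/chain_matching. Qed.

Let mat n t A : A \in @pattern_copies n t -> A \in matchings (finset.cover A).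
Proof. exact/copies_matching/chain_matching. Qed.

Let tou n t A : A \in @pattern_copies n t -> #|touched A| = (ty t).2.+1.
Proof. exact/copies_touched/chain_matching. Qed.

Let inj n t u A : A \in @pattern_copies n t -> A \in @pattern_copies n u -> t = u.
Proof.
move=> At Au; apply: ty_inj; have := copies_chain_inj At Au.
by rewrite -!surjective_pairing.
Qed.

Let P n (Q : pred {set {set slot n R}}) : K := Pr K [set: slot n R]%SET Q.

Let large n : (2 * k * (R + 1) + 1 <= n)%N ->
  (0 < n)%N /\ (n + R * (2 * k) + 2 * k <= n * R)%N.
Proof.
move=> h; split; first by lia.
have : (n * 2 <= n * R)%N by rewrite leq_mul2l R_gt1 orbT.
by move: h; rewrite mulnDr muln1 mulnC; lia.
Qed.

Let lam t : K := ratr (pattern_mean (ty t).1 (ty t).2).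

Lemma pattern_mean_gt0 o p : 0 < pattern_mean o p.
Proof.
rewrite divr_gt0 ?exprn_gt0 ?ltr0n ?aut_gt0 //; last by case: (R) R_gt1 => [|[]].
Qed.

Lemma mean_count_cvg t :
  (fun n => mean_count K (@pattern_copies n) t) @ \oo --> lam t.
Proof.
have lamE : lam t = R.-1%:R ^+ (ty t).2.+1 / #|aut (chain (ty t).1 (ty t).2)|%:R.
  by rewrite /lam /pattern_mean rmorphM /= fmorphV rmorphXn /= !ratr_nat.
rewrite lamE.
apply: (cvg_dist0 _ (copies_density_cvg R_gt1 (chain_matching (ty t).1 (ty t).2))).
apply: (@cvg0_delta _ _ 0); near=> n.
rewrite (mean_countE K (@str n) (@mat n) (@tou n)).
by rewrite subrr normr0 mul0r.
Unshelve. all: by end_near. Qed.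

Lemma sum_box n L (M : {set {set slot n R}}) :
  \sum_(y : {ffun I -> 'I_L.+1})
     ((pattern_counts M == [ffun t => y t : nat] :> {ffun I -> nat})%:R : K) =
  [forall t, (pattern_counts M t <= L)%N]%:R.
Proof.
case: forallP => [h|nh]; last first.
  rewrite big1 // => y _; case: eqP => // e; case: nh => t.
  by rewrite e ffunE -ltnS.
pose y0 : {ffun I -> 'I_L.+1} := [ffun t => inord (pattern_counts M t)].
rewrite (bigD1 y0) //= big1 ?addr0 => [|y yy0].
  suff -> : pattern_counts M = [ffun t => y0 t : nat] by rewrite eqxx.
  by apply/ffunP => t; rewrite !ffunE inordK // ltnS; have := h t; rewrite ffunE.
case: eqP => // e; case/eqP: yy0; apply/ffunP => t; apply: val_inj.
by rewrite [in RHS]ffunE e [in RHS]ffunE inord_val.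
Qed.

Lemma Pr_box n L :
  \sum_(y : {ffun I -> 'I_L.+1})
     P (fun M : {set {set slot n R}} => pattern_counts M == [ffun t => y t : nat]) =
  P (fun M : {set {set slot n R}} => [forall t, (pattern_counts M t <= L)%N]).
Proof.
rewrite /P PrE; under eq_bigr do rewrite PrE.
rewrite -mulr_suml exchange_big; congr (_ / _); apply: eq_bigr => M _.
exact: sum_box.
Qed.

Lemma pattern_poisson (x : {ffun I -> nat}) :
  (fun n => P (fun M : {set {set slot n R}} => pattern_counts M == x)) @ \oo -->
  \prod_t (lam t ^+ x t / (x t)`!%:R * expR (- lam t)).
Proof.
apply: (@poisson_cvg K I (fun n x => P (fun M : {set {set slot n R}} => pattern_counts M == x))
  (fun n t => mean_count K (@pattern_copies n) t) lam
  (\sum_(t : I) (shape_bound R k)%:R)).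
- by move=> n y; exact: Pr_ge0.
- move=> y t yt; apply: (@cvg0_delta _ _ (recursion_const K R k)); near=> n.
  have [n0 hn] : (0 < n)%N /\ (n + R * (2 * k) + 2 * k <= n * R)%N.
    by apply: large; near: n; exact: nbhs_infty_ge.
  exact: (Pr_recursion K n0 (@str n) (@mat n) (@tou n) (@inj n) (fun=> isT) ty_le).
- exact: mean_count_cvg.
- by move=> t; rewrite ler0q ltW // pattern_mean_gt0.
- by move=> L n; rewrite Pr_box Pr_le1.
move=> L; near=> n.
have [n0 hn] : (0 < n)%N /\ (n + R * (2 * k) + 2 * k <= n * R)%N.
  by apply: large; near: n; exact: nbhs_infty_ge.
rewrite Pr_box lerBlDr -[leLHS](Pr1 K [set: slot n R]%SET).
apply: le_trans (_ : P (fun M : {set {set slot n R}} => [forall t, (pattern_counts M t <= L)%N]) +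
  P (fun M : {set {set slot n R}} => [exists t in xpredT, (L.+1 <= pattern_counts M t)%N]) <= _).
  apply: le_trans (Pr_or _ _ _ _); apply: Pr_mono => M _ _.
  rewrite -implyNb; apply/implyP => /forallPn[t]; rewrite -ltnNge => h.
  by apply/exists_inP; exists t.
rewrite lerD2l; apply: le_trans (Pr_exists _ _ _ _) _.
rewrite mulr_suml; apply: ler_sum => t _.
rewrite ler_pdivlMr ?ltr0n // mulrC.
apply: le_trans (Pr_counts_tail K _ t _) _.
apply: (mean_count_le K n0 (@str n) (@tou n) ty_le); lia.
Unshelve. all: by end_near. Qed.

Lemma Pr_pattern_tail t m : \forall n \near \oo,
  m%:R * P (fun M : {set {set slot n R}} => (m <= pattern_counts M t)%N) <=
  (shape_bound R k)%:R.
Proof.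
near=> n.
have [n0 hn] : (0 < n)%N /\ (n + R * (2 * k) + 2 * k <= n * R)%N.
  by apply: large; near: n; exact: nbhs_infty_ge.
apply: le_trans (Pr_counts_tail K _ t m) _.
apply: (mean_count_le K n0 (@str n) (@tou n) ty_le); lia.
Unshelve. all: by end_near. Qed.

End PatternPoisson.

(** * From random matchings to random graphs *)

Section GraphMeasure.
Variables (K : realType) (R : nat).
Hypothesis R_gt1 : (1 < R)%N.
Let R_gt0 : (0 < R)%N. Proof. exact: ltnW. Qed.

Local Notation pts n := (slot n R).
Local Notation P n Q := (Pr K [set: pts n]%SET Q).
Local Notation inv m := ((involutions m)%:R : K).

(* The number of graphs with property Q, rescaled so as to be comparable with
   probabilities of events about a random matching. *)
Definition gmass n (Q : pred (graph n)) : K :=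
  #|[set G in bounded_graphs n R | Q G]%SET|%:R * (R`! ^ n)%:R / inv (n * R).

Lemma gmassE n (Q : pred (graph n)) :
  gmass Q = (\sum_(M in matchings [set: pts n]%SET)
    (weight M)%:R * (simple M && Q (graph_of M))%:R) / inv (n * R).
Proof.
rewrite /gmass -natrM -sum_weight // natr_sum big_mkcondr; congr (_ / _).
by apply: eq_bigr => M _; case: (_ && _); rewrite ?mulr1 ?mulr0.
Qed.

Lemma card_pts n : #|[set: pts n]%SET| = (n * R)%N.
Proof. by rewrite cardsT card_prod !card_ord. Qed.

Lemma PE n (Q : pred {set {set pts n}}) :
  P n Q = (\sum_(M in matchings [set: pts n]%SET) (Q M)%:R) / inv (n * R).
Proof. by rewrite PrE card_pts. Qed.

Lemma gmass_ge0 n (Q : pred (graph n)) : 0 <= gmass Q.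
Proof. by rewrite divr_ge0 ?mulr_ge0 ?ler0n. Qed.

Lemma gmass_mono n (Q Q' : pred (graph n)) :
  (forall G, G \in bounded_graphs n R -> Q G -> Q' G) -> gmass Q <= gmass Q'.
Proof.
move=> h; rewrite ler_wpM2r ?invr_ge0 ?ler0n // ler_wpM2r ?ler0n // ler_nat.
apply: subset_leq_card; apply/fintype.subsetP => G /setIdP[bG QG].
by rewrite inE bG h.
Qed.

Lemma gmassD n (Q Q' : pred (graph n)) :
  gmass Q = gmass (fun G => Q G && Q' G) + gmass (fun G => Q G && ~~ Q' G).
Proof.
rewrite /gmass -!mulrDl -natrD; congr (_%:R * _ / _).
rewrite -(cardsID [set G | Q' G]%SET); congr (_ + _)%N; apply: eq_card => G;
by rewrite !inE; case: [forall v, _]; case: (Q G); case: (Q' G).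
Qed.

Definition moment_bound : K := expR (R`! ^ 2 * 'C(R, 2))%:R.

Lemma moment_boundP n :
  (\sum_(M in matchings [set: pts n]%SET) (weight M)%:R ^+ 2) / inv (n * R) <=
  moment_bound.
Proof.
rewrite ler_pdivrMr ?inv_gt0 //; under eq_bigr do rewrite -natrX.
rewrite -natr_sum; apply: le_trans (second_moment_weight n R_gt1 K) _.
rewrite ler_wpM2r ?ler0n // /moment_bound.
set c := (_ * _)%:R; have c0 : 0 <= c by rewrite ler0n.
have -> : \sum_(t < n.+1) c ^+ t / t`!%:R = series (exp_coeff c) n.+1.
  by rewrite /series /= big_mkord.
apply: nondecreasing_cvgn_le; last exact: is_cvg_series_exp_coeff.
apply/nondecreasing_seqP => m; rewrite /series /= big_nat_recr //= lerDl.
exact: exp_coeff_ge0.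
Qed.

(** A matching of weight at most L contributes at most L; a heavier one at most its squared weight
    divided by L. *)
Lemma gmass_le n (Q : pred (graph n)) (L : K) : 0 < L ->
  gmass Q <= moment_bound / L + L * P n (fun M => simple M && Q (graph_of M)).
Proof.
move=> L0; apply: le_trans (_ : (\sum_(M in matchings [set: pts n]%SET)
   ((weight M)%:R ^+ 2 / L + L * (simple M && Q (graph_of M))%:R)) / inv (n * R) <= _).
  rewrite gmassE ler_wpM2r ?invr_ge0 ?ler0n //; apply: ler_sum => M _.
  have w0 : 0 <= (weight M)%:R :> K by rewrite ler0n.
  have w2 : 0 <= (weight M)%:R ^+ 2 / L by rewrite divr_ge0 ?sqr_ge0 ?ltW.
  case: (_ && _); rewrite ?mulr1 ?mulr0 ?addr0 //.
  have [wL|Lw] := leP (weight M)%:R L; first by apply: le_trans wL _; rewrite lerDr.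
  apply: le_trans (_ : (weight M)%:R ^+ 2 / L <= _); last by rewrite lerDl ltW.
  by rewrite ler_pdivlMr // expr2 ler_wpM2l // ltW.
rewrite big_split /= mulrDl lerD //.
  rewrite -mulr_suml mulrAC ler_wpM2r ?invr_ge0 ?(ltW L0) //; exact: moment_boundP.
by rewrite -mulr_sumr -mulrA PE.
Qed.

Lemma gmass_cvg0 (Q : forall n, pred (graph n)) :
  (fun n => P n (fun M => simple M && Q n (graph_of M))) @ \oo --> (0 : K) ->
  (fun n => gmass (Q n)) @ \oo --> (0 : K).
Proof.
move=> h; apply/cvgr0Pnorm_lt => e e0.
have c0 : 0 < moment_bound by exact: expR_gt0.
pose L := 2 * moment_bound / e.
have L0 : 0 < L by rewrite divr_gt0 ?mulr_gt0.
have h2 : (fun n => L * P n (fun M => simple M && Q n (graph_of M))) @ \oo --> (0 : K).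
  by rewrite -(mulr0 L); apply: cvgMr.
near=> n.
rewrite ger0_norm ?gmass_ge0 //; apply: le_lt_trans (gmass_le _ L0) _.
have -> : moment_bound / L = e / 2.
  by rewrite /L; field; rewrite !gt_eqF.
have : `|L * P n (fun M => simple M && Q n (graph_of M))| < e / 2.
  near: n; apply: (@cvgr0_norm_lt _ _ _ \oo _ _ h2); by rewrite divr_gt0.
rewrite ger0_norm; last by rewrite mulr_ge0 ?Pr_ge0 // ltW.
lra.
Unshelve. all: by end_near. Qed.

Definition has_overfull k n (M : {set {set pts n}}) : bool :=
  [exists A : {set {set pts n}}, overfull k A && (A \subset M)].

Lemma Pr_has_overfull_cvg0 k : (fun n => P n (@has_overfull k n)) @ \oo --> (0 : K).
Proof.
apply: (@cvg0_delta _ _ (k.+1 * shape_bound R k)%:R); near=> n.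
have n0 : (0 < n)%N by near: n; exact: nbhs_infty_gt.
have hn : (n + R * k <= #|[set: pts n]%SET|)%N.
  rewrite card_pts; have : (R * k <= n)%N by near: n; exact: nbhs_infty_ge.
  have : (n * 2 <= n * R)%N by rewrite leq_mul2l R_gt1 orbT.
  lia.
rewrite ger0_norm ?Pr_ge0 //; apply: le_trans (Pr_overfull K n0 hn).
apply: le_trans (_ : P n (fun M => [exists A in [pred A | overfull k A], A \subset M]) <= _).
  by apply: Pr_mono => M _ /existsP[A /andP[dA sA]]; apply/exists_inP; exists A.
exact: Pr_exists.
Unshelve. all: by end_near. Qed.

Lemma gmass_not_sparse k : (fun n => gmass (fun G : graph n => ~~ sparse R G k)) @ \oo --> (0 : K).
Proof.
apply: gmass_cvg0; apply: cvg0_le (Pr_has_overfull_cvg0 k); near=> n.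
rewrite ger0_norm ?Pr_ge0 //; apply: Pr_mono => M mM /andP[sM].
by apply: contraR => nd; exact: sparse_graph_of.
Unshelve. all: by end_near. Qed.

Definition defect2 n (G : graph n) : nat := #|[set v | deg G v == (R - 2)%N]%SET|.

(** Sparseness of single vertices allows at most two free slots at each, and among 0!, 1! and 2!
    only the last exceeds 1. *)
Lemma weight_sparse n (M : {set {set pts n}}) k : M \in matchings [set: pts n]%SET ->
  simple M -> sparse R (graph_of M) k -> (0 < k)%N ->
  weight M = (2 ^ defect2 (graph_of M))%N.
Proof.
move=> mM sM sp k0; rewrite /defect2 -prod_nat_const [RHS]big_mkcond /=.
apply: eq_bigr => v _; rewrite inE.
have := deg_free mM v sM.
have := few_free_slots mM sM sp (W := [set v]%SET).
rewrite cards1 => /(_ k0) h; have : (free M v <= 2)%N.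
  apply: leq_trans (leq_trans (leq_addl _ _) h); apply: subset_leq_card.
  by apply/fintype.subsetP => x; rewrite !inE.
case: (free M v) => [|[|[|f]]] // _ e.
- by case: eqP => //; lia.
- by case: eqP => //; lia.
- by case: eqP => //; lia.
Qed.

(** On sparse graphs with j vertices of degree R - 2 the weight is the constant 2^j, so mass is
    proportional to probability. The non-sparse ones are negligible for both. *)
Lemma gmass_cvg k j (Q : forall n, pred (graph n))
    (N : forall n, pred {set {set pts n}}) (l : K) : (0 < k)%N ->
  (forall n (M : {set {set pts n}}), M \in matchings [set: pts n]%SET -> N n M -> simple M) ->
  (forall n (M : {set {set pts n}}), M \in matchings [set: pts n]%SET ->
     simple M -> sparse R (graph_of M) k -> Q n (graph_of M) = N n M) ->
  (forall n (G : graph n), Q n G -> defect2 G = j) ->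
  (fun n => P n (N n)) @ \oo --> l ->
  (fun n => gmass (Q n)) @ \oo --> (2 ^ j)%:R * l.
Proof.
move=> k0 Ns QN Qj Nl; apply: (@cvg_dist0 _ _ (fun n => (2 ^ j)%:R * P n (N n))); last first.
  exact: cvgMr.
apply: (@cvg0_le _ _ (fun n => gmass (fun G : graph n => ~~ sparse R G k) +
                      (2 ^ j)%:R * P n (@has_overfull k n))); last first.
  rewrite -(addr0 0); apply: cvgD; first exact: gmass_not_sparse.
  by rewrite -[X in _ --> X](mulr0 (2 ^ j)%:R); apply: cvgMr; exact: Pr_has_overfull_cvg0.
near=> n; rewrite !gmassE !PE mulrA mulr_sumr -mulrBl mulrA mulr_sumr -mulrDl.
rewrite normrM (ger0_norm (_ : 0 <= (inv (n * R))^-1)) ?invr_ge0 ?ler0n //.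
rewrite ler_wpM2r ?invr_ge0 ?ler0n // -sumrB -big_split /=.
apply: le_trans (ler_norm_sum _ _ _) _; apply: ler_sum => M mM.
have [sM|nsM] := boolP (simple M); rewrite /=; last first.
  case NM: (N n M); first by rewrite (Ns n M mM NM) in nsM.
  by rewrite !mulr0 subrr normr0 add0r mulr_ge0 ?ler0n.
have [sp|nsp] := boolP (sparse R (graph_of M) k); rewrite /=.
  rewrite (QN n M mM sM sp) mulr0 add0r.
  case NM: (N n M); last by rewrite !mulr0 subrr normr0 mulr_ge0 ?ler0n.
  have QM : Q n (graph_of M) by rewrite QN.
  rewrite (weight_sparse mM sM sp k0) (Qj n _ QM) !mulr1 subrr normr0.
  by rewrite mulr_ge0 ?ler0n.
have hd : has_overfull k M.
  by apply: contraR nsp => nd; exact: sparse_graph_of.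
rewrite hd !mulr1; apply: le_trans (ler_normB _ _) _.
rewrite !normrM !normr_nat lerD //.
  by rewrite -[leRHS]mulr1 ler_wpM2l ?ler0n // lern1; case: (Q _ _).
by rewrite -[leRHS]mulr1 ler_wpM2l ?ler0n // lern1; case: (N _ _).
Unshelve. all: by end_near. Qed.

Lemma gmass_ratio n (Q Q' : pred (graph n)) :
  gmass Q / gmass Q' =
  #|[set G in bounded_graphs n R | Q G]%SET|%:R /
  #|[set G in bounded_graphs n R | Q' G]%SET|%:R.
Proof.
have c0 : (R`! ^ n)%:R / inv (n * R) != 0 :> K.
  by rewrite mulf_neq0 ?invr_neq0 ?inv_neq0 // pnatr_eq0 -lt0n expn_gt0 fact_gt0.
by rewrite /gmass -!(mulrA _ _ (inv (n * R))^-1) -mulf_div divff ?mulr1.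
Qed.

Lemma proportion_gmass n (PP : graph n -> Prop) :
  proportion K (bounded_graphs n R) PP =
  gmass (fun G => `[< PP G >]) / gmass (fun _ : graph n => true).
Proof.
rewrite gmass_ratio; congr (_ / #|pred_of_set _|%:R).
by apply/setP => G; rewrite inE andbT.
Qed.

Lemma proportion_with_gmass n j (PP : graph n -> Prop) :
  proportion K (bounded_graphs_with n R j) PP =
  gmass (fun G => (defect2 G == j) && `[< PP G >]) /
  gmass (fun G : graph n => defect2 G == j).
Proof.
rewrite gmass_ratio; congr (#|pred_of_set _|%:R / _).
by apply/setP => G; rewrite !inE andbA.
Qed.

End GraphMeasure.

(** * The limit theorems *)

Lemma sparse_le n R (G : graph n) k k' :
  (k <= k')%N -> sparse R G k' -> sparse R G k.
Proof.
by move=> kk' /sparseP sp; apply/sparseP => W Wk; apply: sp; exact: leq_trans kk'.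
Qed.

Section ShortPatterns.
Variables (K : realType) (R k : nat).
Hypothesis R_gt1 : (1 < R)%N.
Hypothesis k_ge3 : (3 <= k)%N.
Local Notation pts n := (slot n R).
Local Notation P n Q := (Pr K [set: pts n]%SET Q).

Definition poisson_weight (a : K) (x : nat) : K := a ^+ x / x`!%:R * expR (- a).

Let mean o p : K := ratr (pattern_mean R o p).

Lemma poisson_weight_gt0 a x : 0 < a -> 0 < poisson_weight a x.
Proof.
by move=> a0; rewrite mulr_gt0 ?expR_gt0 // divr_gt0 ?exprn_gt0 // ltr0n fact_gt0.
Qed.

(** [inl i] is the closed chain on i + 1 vertices, loops and double edges included; [inr i] is the
    open chain with i edges. Open chains reach k + 1 vertices, hence the bound [k.+1] below. *)
Definition all_types (t : 'I_k + 'I_k.+1) : bool * nat :=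
  match t with inl i => (false, i : nat) | inr i => (true, i : nat) end.

Lemma all_types_inj : injective all_types.
Proof. by move=> [i|i] [j|j] //= [] /val_inj ->. Qed.

Lemma all_types_le t : ((all_types t).2.+1 <= k.+1)%N.
Proof. by case: t => i /=; have := ltn_ord i; lia. Qed.

Definition base_types (t : bool + unit) : bool * nat :=
  match t with inl b => (false, b : nat) | inr _ => (true, 0%N) end.

Lemma base_types_inj : injective base_types.
Proof. by move=> [[]|[]] [[]|[]]. Qed.

Lemma base_types_le t : ((base_types t).2.+1 <= 2)%N.
Proof. by case: t => [[]|[]]. Qed.

Definition all_target (j : nat) (r s : nat -> nat) : {ffun 'I_k + 'I_k.+1 -> nat} :=
  [ffun t : 'I_k + 'I_k.+1 => match t with
   | inl i => if (i < 2)%N then 0%N else r i.+1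
   | inr i => if i == 0%N :> nat then j else s i
   end].

Definition base_target (j : nat) : {ffun bool + unit -> nat} :=
  [ffun t : bool + unit => if t is inr _ then j else 0%N].

(** The limiting probability that a matching has no loop, no double edge and exactly j vertices with
    two free slots. It occurs as a factor in the limit for all counts and cancels on
    conditioning. *)
Definition base_limit (j : nat) : K :=
  poisson_weight (mean false 0) 0 * poisson_weight (mean false 1) 0 *
  poisson_weight (mean true 0) j.

Definition counts_limit (r s : nat -> nat) : K :=
  (\prod_(3 <= p < k.+1) poisson_weight (mean false p.-1) (r p)) *
  (\prod_(1 <= p < k.+1) poisson_weight (mean true p) (s p)).

Lemma base_limit_gt0 j : 0 < base_limit j.
Proof.
by apply: mulr_gt0; [apply: mulr_gt0|]; apply: poisson_weight_gt0;
  rewrite ltr0q pattern_mean_gt0.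
Qed.

Lemma base_poisson j :
  (fun n => P n (fun M => pattern_counts base_types M == base_target j)) @ \oo -->
  base_limit j.
Proof.
have := @pattern_poisson K R 2 _ _ R_gt1 base_types_inj base_types_le (base_target j).
rewrite big_sumType /= big_bool (big_pred1 tt) /= => [|[]] //; rewrite !ffunE.
by rewrite (mulrC (_ / _ * _)).
Qed.

Lemma all_poisson j r s :
  (fun n => P n (fun M => pattern_counts all_types M == all_target j r s)) @ \oo -->
  base_limit j * counts_limit r s.
Proof.
have := @pattern_poisson K R k.+1 _ _ R_gt1 all_types_inj all_types_le (all_target j r s).
suff -> : \prod_t (ratr (pattern_mean R (all_types t).1 (all_types t).2)
     ^+ all_target j r s t / (all_target j r s t)`!%:R *
   expR (- ratr (pattern_mean R (all_types t).1 (all_types t).2))) =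
   base_limit j * counts_limit r s :> K by [].
rewrite big_sumType /=.
under eq_bigr do rewrite ffunE.
under [X in _ * X]eq_bigr do rewrite ffunE.
rewrite -(big_mkord xpredT (fun i => poisson_weight (mean false i)
  (if (i < 2)%N then 0%N else r i.+1))).
rewrite -(big_mkord xpredT (fun i => poisson_weight (mean true i)
  (if i == 0%N then j else s i))).
rewrite big_ltn; last by lia.
rewrite big_ltn; last by lia.
rewrite [X in _ * X]big_ltn //= /base_limit /counts_limit.
have -> : \prod_(3 <= p < k.+1) poisson_weight (mean false p.-1) (r p) =
    \prod_(2 <= i < k) poisson_weight (mean false i) (if (i < 2)%N then 0%N else r i.+1).
  rewrite big_add1 /=; apply: eq_big_nat => i /andP[i2 _].
  by rewrite ltnNge i2.
have -> : \prod_(1 <= p < k.+1) poisson_weight (mean true p) (s p) =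
    \prod_(1 <= i < k.+1) poisson_weight (mean true i) (if i == 0%N then j else s i).
  by apply: eq_big_nat => i /andP[i1 _]; rewrite gtn_eqF.
ring.
Qed.

Lemma pattern_countsE (I : finType) (ty : I -> bool * nat) n (M : {set {set pts n}}) t :
  pattern_counts ty M t = #|copies_in M (ty t).1 (ty t).2|.
Proof. by rewrite ffunE. Qed.

Lemma base_countsP n (M : {set {set pts n}}) j : M \in matchings [set: pts n]%SET ->
  (pattern_counts base_types M == base_target j) =
  simple M && (#|copies_in M true 0| == j).
Proof.
move=> mM; rewrite simple_copies // -!cards_eq0; apply/eqP/andP.
  move=> /ffunP e; have := (e (inl false), e (inl true), e (inr tt)).
  by rewrite !pattern_countsE !ffunE /= => -[[-> ->] ->]; rewrite !eqxx.
move=> [/andP[/eqP e0 /eqP e1] /eqP ej]; apply/ffunP => -[[]|[]];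
by rewrite pattern_countsE ffunE.
Qed.

Lemma all_counts_simple n (M : {set {set pts n}}) j r s :
  M \in matchings [set: pts n]%SET ->
  pattern_counts all_types M == all_target j r s -> simple M.
Proof.
move=> mM /eqP/ffunP e; rewrite simple_copies // -!cards_eq0.
have k0 : (0 < k)%N by lia.
have k1 : (1 < k)%N by lia.
have := (e (inl (Ordinal k0)), e (inl (Ordinal k1))).
by rewrite !pattern_countsE !ffunE /= => -[-> ->].
Qed.

Lemma all_countsP n (M : {set {set pts n}}) j r s :
  M \in matchings [set: pts n]%SET -> simple M -> sparse R (graph_of M) k.+1 ->
  (defect2 R (graph_of M) == j) && `[< has_counts (graph_of M) R k r s >] =
  (pattern_counts all_types M == all_target j r s).
Proof.
move=> mM sM sp.
have ch : defect2 R (graph_of M) = #|copies_in M true 0|.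
  exact: (open0_graph_of mM sM sp).
have pa p : (0 < p <= k)%N ->
    #|paths_with_end_degree (graph_of M) (R - 1) p| = #|copies_in M true p|.
  move=> /andP[p0 pk]; apply: (paths_graph_of mM sM sp) => //.
  exact: ltnW.
have cy p : (1 < p)%N -> #|cycles (graph_of M) p.+1| = #|copies_in M false p|.
  by move=> p1; apply: cycles_graph_of.
have := sM; rewrite simple_copies // -!cards_eq0 => /andP[/eqP c0 /eqP c1].
apply/andP/eqP.
  move=> [/eqP chj /asboolP[hc hs]]; apply/ffunP => -[i|i].
    rewrite pattern_countsE ffunE /=; case: ltnP => i2.
      by case: i i2 => [[|[|i]] ?].
    by rewrite -cy // hc //; have := ltn_ord i; lia.
  rewrite pattern_countsE ffunE /=; case: eqP => [->|/eqP i0]; first by rewrite -ch.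
  by rewrite -pa ?hs //; have := ltn_ord i; lia.
move=> /ffunP e; split; first by rewrite ch; have := e (inr ord0); rewrite pattern_countsE ffunE => /= ->.
apply/asboolP; split=> p hp.
  have pk : (p.-1 < k)%N by lia.
  have := e (inl (Ordinal pk)); rewrite pattern_countsE ffunE /= -cy; last by lia.
  by rewrite prednK; [|lia]; case: ltnP => //; lia.
have pk : (p < k.+1)%N by lia.
have := e (inr (Ordinal pk)); rewrite pattern_countsE ffunE /= -pa //.
by case: eqP => // p0; lia.
Qed.

Lemma defect2_gmass_cvg j :
  (fun n => gmass K R (fun G : graph n => defect2 R G == j)) @ \oo -->
  (2 ^ j)%:R * base_limit j.
Proof.
apply: (@gmass_cvg K R R_gt1 1 j _ (fun n M => pattern_counts base_types M == base_target j)) => //.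
- by move=> n M mM; rewrite base_countsP // => /andP[].
- move=> n M mM sM sp; rewrite base_countsP // sM /=.
  by rewrite /defect2 (open0_graph_of mM sM sp).
- by move=> n G /eqP.
- exact: base_poisson.
Qed.

Lemma counts_gmass_cvg j r s :
  (fun n => gmass K R (fun G : graph n =>
     (defect2 R G == j) && `[< has_counts G R k r s >])) @ \oo -->
  (2 ^ j)%:R * (base_limit j * counts_limit r s).
Proof.
apply: (@gmass_cvg K R R_gt1 k.+1 j _
  (fun n M => pattern_counts all_types M == all_target j r s)) => //.
- by move=> n M mM; apply: all_counts_simple.
- by move=> n M mM sM sp; apply: all_countsP.
- by move=> n G /andP[/eqP].
- exact: all_poisson.
Qed.

Lemma proportion_with_cvg j r s :
  (fun n => proportion K (bounded_graphs_with n R j)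
     (fun G => has_counts G R k r s)) @ \oo --> counts_limit r s.
Proof.
have c0 : (2 ^ j)%:R * base_limit j != 0 :> K.
  by rewrite mulf_neq0 ?gt_eqF ?base_limit_gt0 // ltr0n expn_gt0.
have -> : counts_limit r s =
    (2 ^ j)%:R * (base_limit j * counts_limit r s) / ((2 ^ j)%:R * base_limit j).
  by rewrite mulrA mulrAC divff // mul1r.
under eq_fun do rewrite proportion_with_gmass.
apply: cvgM; first exact: counts_gmass_cvg.
by apply: cvgV => //; exact: defect2_gmass_cvg.
Qed.

(** The graphs without vertices of degree R - 2 alone have mass tending to [base_limit 0], which is
    positive. *)
Lemma gmass_total_ge : exists2 c : K, 0 < c &
  \forall n \near \oo, c <= gmass K R (fun _ : graph n => true).
Proof.
have b0 := base_limit_gt0 0; exists (base_limit 0 / 2); first by rewrite divr_gt0.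
have := @defect2_gmass_cvg 0; rewrite expn0 mul1r => h; near=> n.
apply: le_trans (_ : gmass K R (fun G : graph n => defect2 R G == 0%N) <= _); last first.
  exact: gmass_mono.
have : `|base_limit 0 - gmass K R (fun G : graph n => defect2 R G == 0%N)| < base_limit 0 / 2.
  by near: n; apply: (@cvgr_dist_lt _ _ _ \oo _ _ _ h); rewrite divr_gt0.
by rewrite ltr_norml => /andP[_]; lra.
Unshelve. all: by end_near. Qed.

Lemma gmass_ratio_cvg0 (Q : forall n, pred (graph n)) :
  (fun n => gmass K R (Q n)) @ \oo --> (0 : K) ->
  (fun n => gmass K R (Q n) / gmass K R (fun _ : graph n => true)) @ \oo --> (0 : K).
Proof.
move=> h; have [c c0 hc] := gmass_total_ge.
have h2 : (fun n => c^-1 * gmass K R (Q n)) @ \oo --> (0 : K).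
  by rewrite -(mulr0 c^-1); apply: cvgMr.
apply: cvg0_le h2; near=> n.
have cT : c <= gmass K R (fun _ : graph n => true) by near: n.
rewrite ger0_norm ?divr_ge0 ?gmass_ge0 // mulrC ler_wpM2r ?gmass_ge0 //.
by rewrite lef_pV2 // posrE // (lt_le_trans c0).
Unshelve. all: by end_near. Qed.

Lemma proportion_cvg0 (PP : forall n, graph n -> Prop) k0 :
  (forall n (G : graph n), G \in bounded_graphs n R -> sparse R G k0 -> ~ PP n G) ->
  (fun n => proportion K (bounded_graphs n R) (PP n)) @ \oo --> (0 : K).
Proof.
move=> h; under eq_fun do rewrite proportion_gmass.
apply: gmass_ratio_cvg0; apply: (cvg0_le _ (@gmass_not_sparse K R R_gt1 k0)); near=> n.
rewrite ger0_norm ?gmass_ge0 //; apply: gmass_mono => G bG /asboolP PG.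
by apply/negP => sp; exact: h PG.
Unshelve. all: by end_near. Qed.

Lemma proportion_cvg1 (PP : forall n, graph n -> Prop) k0 :
  (forall n (G : graph n), G \in bounded_graphs n R -> sparse R G k0 -> PP n G) ->
  (fun n => proportion K (bounded_graphs n R) (PP n)) @ \oo --> (1 : K).
Proof.
move=> h; have [c c0 hc] := gmass_total_ge.
apply: (@cvg_dist0 _ _ (fun=> 1)); last exact: cvg_cst.
have h0 : (fun n => proportion K (bounded_graphs n R) (fun G => ~ PP n G)) @ \oo --> (0 : K).
  by apply: (@proportion_cvg0 _ k0) => n G bG sp nP; apply: nP; exact: h sp.
apply: cvg0_le h0; near=> n.
have cT : c <= gmass K R (fun _ : graph n => true) by near: n.
have T0 : 0 < gmass K R (fun _ : graph n => true) by apply: lt_le_trans cT.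
rewrite !proportion_gmass.
have := gmassD K R (fun _ : graph n => true) (fun G => `[< PP n G >]).
have -> : gmass K R (fun G => true && ~~ `[< PP n G >]) =
    gmass K R (fun G => `[< ~ PP n G >]).
  by congr (gmass K R _); apply/funext => G; rewrite asbool_neg.
set T := gmass K R (fun=> true) in T0 *; set g1 := gmass K R _; set g2 := gmass K R _.
move=> TE; have -> : g1 / T - 1 = - (g2 / T).
  rewrite -(divff (lt0r_neq0 T0)) -mulrBl TE -mulNr; congr (_ / _).
  by rewrite opprD addrA subrr add0r.
rewrite normrN ger0_norm //.
by apply: divr_ge0; [exact: gmass_ge0|exact: ltW].
Unshelve. all: by end_near. Qed.

(** Markov's inequality bounds the probability of many vertices with two free slots; the second
    moment of the weight carries this over to graphs. *)
Lemma defect2_tail (e : K) : 0 < e -> exists J : nat, \forall n \near \oo,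
  gmass K R (fun G : graph n => (J <= defect2 R G)%N) <= e.
Proof.
move=> e0; have c0 : 0 < moment_bound K R by exact: expR_gt0.
pose L : K := 2 * moment_bound K R / e.
have L0 : 0 < L by rewrite divr_gt0 ?mulr_gt0.
pose S : K := (shape_bound R 2)%:R.
have S0 : 0 <= S by rewrite ler0n.
(* The choice gives S/J <= e/(4L); with the overfull event this costs at most e/2 after
   multiplication by L, the other half being the moment term. *)
have /filter_ex[J hJ] : \forall J \near \oo, 4 * L * S / e < J%:R.
  exact: nbhs_infty_gtr.
exists J; have h0 := @Pr_has_overfull_cvg0 K R R_gt1 1.
have J0 : 0 < J%:R :> K.
  apply: le_lt_trans hJ; apply: divr_ge0; last exact: ltW.
  by apply: mulr_ge0 => //; apply: mulr_ge0 => //; exact: ltW.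
near=> n.
apply: le_trans (gmass_le R_gt1 _ L0) _.
have t1 : J%:R * P n (fun M => (J <= pattern_counts base_types M (inr tt))%N) <= S.
  near: n; exact: (Pr_pattern_tail K R_gt1 base_types_le).
have t2 : P n (@has_overfull R 1 n) < e / (4 * L).
  have : `|P n (@has_overfull R 1 n)| < e / (4 * L).
    near: n; apply: (@cvgr0_norm_lt _ _ _ \oo _ _ h0).
    by rewrite divr_gt0 // mulr_gt0.
  by rewrite ger0_norm ?Pr_ge0.
have t3 : P n (fun M => simple M && (J <= defect2 R (graph_of M))%N) <=
    P n (fun M => (J <= pattern_counts base_types M (inr tt))%N) +
    P n (@has_overfull R 1 n).
  apply: le_trans (Pr_or _ _ _ _); apply: Pr_mono => M mM /andP[sM].
  have [hd _|nd] := boolP (has_overfull 1 M); first by rewrite orbT.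
  have sp : sparse R (graph_of M) 1 by exact: sparse_graph_of.
  by rewrite pattern_countsE orbF /defect2 (open0_graph_of mM sM sp).
have t4 : P n (fun M => (J <= pattern_counts base_types M (inr tt))%N) <= e / (4 * L).
  apply: le_trans (_ : S / J%:R <= _); first by rewrite ler_pdivlMr // mulrC.
  rewrite ler_pdivrMr // mulrAC ler_pdivlMr ?mulr_gt0 ?invr_gt0 //.
  move: hJ; rewrite ltr_pdivrMr // => /ltW; rewrite mulrC (mulrC e); exact.
have -> : moment_bound K R / L = e / 2 by rewrite /L; field; rewrite !gt_eqF.
have -> : e = e / 2 + L * (e / (4 * L) + e / (4 * L)) by field; rewrite gt_eqF.
rewrite [X in X / 2](_ : _ = e); last by field; rewrite gt_eqF.
rewrite lerD2l ler_wpM2l ?(ltW L0) //; apply: le_trans t3 _.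
by rewrite lerD // ltW.
Unshelve. all: by end_near. Qed.

Lemma gmass_defect2_split n J (Q : pred (graph n)) :
  gmass K R Q =
  \sum_(j < J) gmass K R (fun G => (defect2 R G == j) && Q G) +
  gmass K R (fun G => (J <= defect2 R G)%N && Q G).
Proof.
elim: J => [|J IH].
  rewrite big_ord0 add0r; congr (gmass K R _); apply/funext => G; by rewrite leq0n.
rewrite big_ord_recr /= -addrA IH; congr (_ + _).
rewrite (gmassD K R _ (fun G => defect2 R G == J)); congr (_ + _);
  congr (gmass K R _); apply/funext => G.
  by case: eqP => [->|]; rewrite ?leqnn ?andbT ?andbF.
by rewrite [in RHS]ltn_neqAle (eq_sym J); case: (_ == _); case: (Q G); case: leqP.
Qed.

(** For each j the mass with the prescribed counts is asymptotically l times the mass of all graphs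
    with that j. Finitely many j are summed; the tail is uniformly small and the total mass stays
    away from 0. *)
Lemma proportion_counts_cvg r s :
  (fun n => proportion K (bounded_graphs n R)
     (fun G => has_counts G R k r s)) @ \oo --> counts_limit r s.
Proof.
set l := counts_limit r s; have [c c0 hc] := gmass_total_ge.
have l0 : 0 <= l.
  by rewrite mulr_ge0 // prodr_ge0 // => p _; rewrite ltW // poisson_weight_gt0 // ltr0q pattern_mean_gt0.
apply/cvgrPdist_lt => e e0.
(* Chosen so that the two tails, with coefficients 1 and l, together cost at most ec/2; division by
   a total mass of at least c then gives e/2. *)
pose d := e * c / (2 * (1 + l)).
have l1 : 0 < 1 + l by rewrite ltr_pwDl.
have d0 : 0 < d by rewrite divr_gt0 ?mulr_gt0.
have [J hJ] := defect2_tail d0.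
pose Z n := \sum_(j < J) (gmass K R (fun G : graph n =>
     (defect2 R G == j) && `[< has_counts G R k r s >]) -
   l * gmass K R (fun G : graph n => defect2 R G == j)).
have Z0 : Z @ \oo --> (0 : K).
  have -> : (0 : K) = \sum_(j < J) ((2 ^ j)%:R * (base_limit j * l) -
      l * ((2 ^ j)%:R * base_limit j)).
    by rewrite big1 // => j _; rewrite mulrA [l * _]mulrC subrr.
  apply: (@cvg_sum_fin K 'I_J predT) => j _.
  apply: cvgB; first exact: counts_gmass_cvg.
  by apply: cvgMr; exact: defect2_gmass_cvg.
near=> n.
have cT : c <= gmass K R (fun _ : graph n => true) by near: n.
have T0 : 0 < gmass K R (fun _ : graph n => true) by apply: lt_le_trans cT.
have tl : gmass K R (fun G : graph n => (J <= defect2 R G)%N) <= d by near: n.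
have Zn : `|Z n| < e * c / 2.
  by near: n; apply: (@cvgr0_norm_lt _ _ _ \oo _ _ Z0); rewrite divr_gt0 ?mulr_gt0.
rewrite proportion_gmass.
have hA := gmass_defect2_split J (fun G : graph n => `[< has_counts G R k r s >]).
have hT := gmass_defect2_split J (fun _ : graph n => true).
set A := gmass K R _ in hA *; set T := gmass K R (fun=> true) in hT cT T0 *.
have tA : 0 <= gmass K R (fun G : graph n => (J <= defect2 R G)%N && `[< has_counts G R k r s >]) <= d.
  rewrite gmass_ge0; apply: le_trans tl; apply: gmass_mono => G _.
  by move=> /andP[].
have tT : 0 <= gmass K R (fun G : graph n => (J <= defect2 R G)%N && true) <= d.
  rewrite gmass_ge0; apply: le_trans tl; apply: gmass_mono => G _.
  by move=> /andP[].
move: hA hT tA tT; set a := gmass K R _; set b := gmass K R _.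
move=> hA hT /andP[a0 ad] /andP[b0 bd].
have eq1 : A - l * T = Z n + (a - l * b).
  rewrite hA hT /Z sumrB -mulr_sumr.
  rewrite (eq_bigr (fun j : 'I_J => gmass K R (fun G : graph n => defect2 R G == j))
    (F1 := fun j : 'I_J => gmass K R (fun G : graph n => (defect2 R G == j) && true))).
    ring.
  by move=> j _; congr (gmass K R _); apply/funext => G; rewrite andbT.
have -> : l - A / T = - ((A - l * T) / T).
  by field; rewrite gt_eqF.
rewrite normrN normrM normfV (ger0_norm (ltW T0)) ltr_pdivrMr // eq1.
apply: lt_le_trans (_ : e * c <= _); last by rewrite ler_pM2l.
apply: le_lt_trans (ler_normD _ _) _.
have : `|a - l * b| <= e * c / 2.
  have -> : e * c / 2 = (1 + l) * d by rewrite /d; field; rewrite gt_eqF.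
  have lb0 : 0 <= l * b by rewrite mulr_ge0.
  have lbd : l * b <= l * d by rewrite ler_wpM2l.
  rewrite ler_norml mulrDl mul1r; apply/andP; split; lra.
lra.
Unshelve. all: by end_near. Qed.

End ShortPatterns.

Theorem theorem3p1 (K : realType) (R : nat) (hR : (2 <= R)%N) :
  [/\
   (* (i) *)
   forall k : nat, (0 < k)%N ->
     [/\ (fun n : nat => proportion K (bounded_graphs n R) (fun G =>
            [/\ no_dense_subgraph G k,
                no_deficient_near_cycle G R k,
                no_close_deficient_triple G R k &
                no_close_deficient_pair G R k])) @ \oo --> (1 : K),
         forall (n : nat) (G : graph n), G \in bounded_graphs n R ->
           no_dense_subgraph G k -> no_close_cycles G k &
         forall (n : nat) (G : graph n), G \in bounded_graphs n R ->
           no_deficient_near_cycle G R k -> no_deficient_on_cycle G R k],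
   (* (ii) *)
   forall k : nat, (3 <= k)%N ->
     exists lambda mu : nat -> rat,
       [/\ forall p : nat, (3 <= p <= k)%N -> 0 < lambda p,
           forall p : nat, (1 <= p <= k)%N -> 0 < mu p &
           forall r s : nat -> nat,
             let l : K :=
               (\prod_(3 <= p < k.+1)
                  (ratr (lambda p) ^+ r p * expR (- ratr (lambda p))
                     / (r p)`!%:R)) *
               (\prod_(1 <= p < k.+1)
                  (ratr (mu p) ^+ s p * expR (- ratr (mu p))
                     / (s p)`!%:R)) in
             (fun n : nat => proportion K (bounded_graphs n R)
                (fun G => has_counts G R k r s)) @ \oo --> l /\
             (forall j : nat,
               (fun n : nat => proportion K (bounded_graphs_with n R j)
                  (fun G => has_counts G R k r s)) @ \oo --> l)] &
   (* (iii) *)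
   (3 <= R)%N -> forall k : nat,
     (fun n : nat => proportion K (bounded_graphs n R)
        (fun G => has_small_component G k)) @ \oo --> (0 : K)].
Proof.
split=> [k k_gt0|k k_ge3|R_gt2 k].
- split=> [|n G _|n G _]; last 2 first.
  + exact: no_dense_no_close_cycles.
  + exact: near_cycle_on_cycle.
  apply: (@proportion_cvg1 K R hR _ (2 * k + 1)) => n G _ sp; split.
  + by apply: (@sparse_no_dense_subgraph n R); apply: sparse_le sp; lia.
  + by apply: sparse_near_cycle; apply: sparse_le sp; lia.
  + exact: sparse_close_triple.
  + exact: sparse_close_pair.
(* A p-cycle is the closed chain with last vertex p - 1, a p-path the open chain with last vertex
   p. *)
- exists (fun p => pattern_mean R false p.-1), (pattern_mean R true).
  split=> [p _|p _|r s l]; try exact: pattern_mean_gt0.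
  have -> : l = counts_limit K R k r s.
    by rewrite /l; congr (_ * _); apply: eq_bigr => p _; rewrite mulrAC.
  split=> [|j]; first exact: proportion_counts_cvg.
  exact: proportion_with_cvg.
- apply: (@proportion_cvg0 K R hR _ k) => n G bG sp.
  apply: (sparse_small_component R_gt2 sp) => v.
  by move: bG; rewrite inE => /forallP.
Qed.
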